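(* Given real matrices $U_1, \dots, U_N$ with $U_j \in \mathbb{R}^{I_j \times R}$, there exists a data structure satisfying the following. 1. The data structure has construction time $O\left(\sum_{j=1}^{N} I_j R^2\right)$ and requires additional storage space $O\left(\sum_{j=1}^{N} I_j R\right)$. If a single entry in a matrix $U_j$ changes, the data structure can be updated in time $O(R \log (I_j / R))$. If the entire matrix $U_j$ changes, it can be updated in time $O\left(I_j R^2\right)$. 2. The data structure produces $J$ samples from the Khatri-Rao product $U_1 \odot \cdots \odot U_N$ (assumed to be a nonzero matrix) according to the exact leverage score distribution on its rows in time $$O\left(NR^3 + J \sum_{k=1}^N R^2 \log \max(I_k, R)\right)$$ using $O(R^3)$ scratch space. The structure can also draw samples from the Khatri-Rao product of any subset of $U_1, \dots, U_N$ (again assumed nonzero).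
   Context: Khatri-Rao product: for $A \in \mathbb{R}^{m_1 \times n}$, $B \in \mathbb{R}^{m_2 \times n}$, the matrix $A \odot B \in \mathbb{R}^{m_1 m_2 \times n}$ is the column-wise Kronecker product, i.e. its $j$-th column is $A[:,j] \otimes B[:,j]$. Thus the rows of $A = U_1 \odot \cdots \odot U_N \in \mathbb{R}^{(\prod_j I_j) \times R}$ are indexed by multi-indices $(i_1,\dots,i_N) \in \{1,\dots,I_1\} \times \cdots \times \{1,\dots,I_N\}$, and the row with this index is the entrywise product of the rows $U_1[i_1,:], \dots, U_N[i_N,:]$. Leverage scores: the leverage score of row $i$ of a matrix $A$ is $\ell_i = A[i,:]\,(A^\top A)^+ A[i,:]^\top$, where $M^+$ is the pseudoinverse of $M$. For $A \neq 0$ (possibly rank-deficient), the leverage score distribution on the rows of $A$ assigns row $i$ the probability $\ell_i / \sum_{i'} \ell_{i'}$ (the sum of all leverage scores equals $\operatorname{rank}(A)$). A sample is a multi-index $(i_1,\dots,i_N)$ identifying a row; the $J$ samples are drawn i.i.d. ''Additional storage space'' is the persistent space used by the data structure beyond the matrices $U_1,\dots,U_N$ themselves; ''scratch space'' is temporary space used during sampling.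
   Formalization: Each logarithm in the time bounds is read as max(1, log): literally, log(I_j/R) is at most 0 when I_j ≤ R, and log max(I_k,R) = 0 when I_k = R = 1, where J samples cannot be output in time O(N). Dimensions N, R, I_j and the chosen subsets are nonempty. *)

(* Defs.v *)
From mathcomp Require Import all_boot all_order all_algebra.
From mathcomp Require Import all_classical all_reals all_analysis.

Set Implicit Arguments.
Unset Strict Implicit.
Unset Printing Implicit Defensive.

Import Order.TTheory GRing.Theory Num.Theory.

Local Open Scope ring_scope.

Definition penrose (R : realType) m n (A : 'M[R]_(m, n)) (X : 'M[R]_(n, m)) : Prop :=
  [/\ A *m X *m A = A, X *m A *m X = X,
      (A *m X)^T = A *m X & (X *m A)^T = X *m A].

Definition pinv (R : realType) m n (A : 'M[R]_(m, n)) : 'M[R]_(n, m) :=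
  xget 0 [set X | penrose A X]%classic.

Definition leverage (R : realType) m n (A : 'M[R]_(m, n)) (i : 'I_m) : R :=
  (row i A *m pinv (A^T *m A) *m (row i A)^T) 0 0.

Definition leverage_prob (R : realType) m n (A : 'M[R]_(m, n)) (i : 'I_m) : R :=
  leverage A i / \sum_(i' < m) leverage A i'.

Definition multi_index N (I : 'I_N -> nat) : finType :=
  {dffun forall k : 'I_N, 'I_(I k)}.

(* Rows are numbered by [enum_rank] of their multi-index; leverage scores do
   not depend on the order of the rows. *)
Definition khatri_rao (R : realType) N r (I : 'I_N -> nat)
    (U : forall k, 'M[R]_(I k, r)) : 'M[R]_(#|multi_index I|, r) :=
  \matrix_(i, c) \prod_(k < N) U k ((enum_val i : multi_index I) k) c.

(* The pseudoinverse exists and is unique, so that the default value in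
   [pinv] is never used. *)

Lemma penrose_uniq (R : realType) m n (A : 'M[R]_(m, n)) X Y :
  penrose A X -> penrose A Y -> X = Y.
Proof.
move=> [X1 X2 X3 X4] [Y1 Y2 Y3 Y4].
have AXY : A *m X = A *m Y.
  rewrite -[RHS]Y3 -[in RHS]X1 -!mulmxA [in RHS]mulmxA trmx_mul Y3 X3.
  by rewrite mulmxA Y1.
have XYA : X *m A = Y *m A.
  rewrite -[RHS]Y4 -{2}X1 -!mulmxA [in RHS]mulmxA trmx_mul X4 Y4.
  by rewrite -mulmxA (mulmxA A) Y1.
by rewrite -X2 XYA -mulmxA AXY mulmxA Y2.
Qed.

Lemma gram_unit (R : realType) m n (C : 'M[R]_(m, n)) :
  row_free C -> C *m C^T \in unitmx.
Proof.
move=> Cfree; rewrite -row_free_unit -kermx_eq0.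
apply/rowV0P => v /sub_kermxP vCC.
have : (v *m C) *m (v *m C)^T = 0.
  by rewrite trmx_mul -mulmxA (mulmxA C) mulmxA vCC mul0mx.
move=> /matrixP/(_ 0 0); rewrite !mxE => /eqP.
rewrite psumr_eq0 => [/allP vC0|i _]; last by rewrite !mxE -expr2 sqr_ge0.
apply: (row_free_inj Cfree); rewrite mul0mx; apply/rowP => j; rewrite [RHS]mxE.
by have := vC0 j (mem_index_enum j); rewrite [_^T _ _]mxE mulf_eq0 orbb => /eqP.
Qed.

Lemma pinvP (R : realType) m n (A : 'M[R]_(m, n)) : penrose A (pinv A).
Proof.
suff ex : exists X, penrose A X by exact: (@xgetPex _ 0 [set X | penrose A X]%classic ex).
have [q [B [C [ABC Bfull Cfree]]]] :
    exists (q : nat) (B : 'M[R]_(m, q)) (C : 'M[R]_(q, n)),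
    [/\ A = B *m C, row_full B & row_free C].
  exists (\rank A), (col_base A), (row_base A).
  by rewrite mulmx_base col_base_full row_base_free.
have CU : C *m C^T \in unitmx by exact: gram_unit.
have BU : B^T *m B \in unitmx.
  by rewrite -{2}[B]trmxK; apply: gram_unit; rewrite /row_free mxrank_tr.
pose K := invmx (C *m C^T); pose L := invmx (B^T *m B).
have Ksym : K^T = K by rewrite /K trmx_inv trmx_mul trmxK.
have Lsym : L^T = L by rewrite /L trmx_inv trmx_mul trmxK.
have CK : C *m (C^T *m K) = 1%:M by rewrite mulmxA mulmxV.
have LB : (L *m B^T) *m B = 1%:M by rewrite -mulmxA mulVmx.
pose X := C^T *m K *m (L *m B^T).
have AX : A *m X = B *m (L *m B^T).
  by rewrite ABC /X -!mulmxA (mulmxA C) (mulmxA (C *m _)) -(mulmxA C) CK mul1mx.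
have XA : X *m A = C^T *m K *m C.
  by rewrite ABC /X mulmxA -(mulmxA (C^T *m K)) LB mulmx1.
exists X; split.
- by rewrite AX {1}ABC mulmxA -(mulmxA B) LB mulmx1 -ABC.
- by rewrite XA /X mulmxA -(mulmxA (C^T *m K) C) CK mulmx1.
- by rewrite AX !trmx_mul trmxK Lsym mulmxA.
- by rewrite XA !trmx_mul trmxK Ksym mulmxA.
Qed.

(* Machine model: a randomized real RAM with a structured program text.

   A machine has word registers and fixed-size arrays of words and of reals.
   Programs are finite syntactic objects that do not depend on the input.
   Every arithmetic operation, memory access, comparison, coin toss and loop
   iteration costs one unit of time.  Arrays never grow, so the space used is
   the total length of the arrays supplied: reading outside an array returns
   0 and writing outside an array has no effect.  Words are reduced modulo
   [W] whenever they are stored, so that data cannot be packed into large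
   integers.  There is no conversion between reals and words. *)

(* [Inp] holds the matrices; [Data] is the persistent memory of the data
   structure; the arguments of an operation [Arg], its output [Out] and its
   scratch memory [Scr] do not survive the operation. *)
Inductive region := Inp | Arg | Out | Data of nat | Scr of nat.

Definition region_eqb (a b : region) : bool :=
  match a, b with
  | Inp, Inp | Arg, Arg | Out, Out => true
  | Data i, Data j | Scr i, Scr j => i == j
  | _, _ => false
  end.

Inductive iexp :=
  | IConst of nat
  | IReg of nat
  | ILoad of region & iexp
  | IAdd of iexp & iexp
  | ISub of iexp & iexp
  | IMul of iexp & iexp
  | IDiv of iexp & iexp.

Inductive rexp :=
  | RZero
  | ROne
  | RLoad of region & iexp
  | RAdd of rexp & rexp
  | RSub of rexp & rexp
  | RMul of rexp & rexp
  | RDiv of rexp & rexp.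

Inductive cmd :=
  | Skip
  | Seq of cmd & cmd
  | SetReg of nat & iexp
  | IStore of region & iexp & iexp
  | RStore of region & iexp & rexp
  | IfI of iexp & iexp & cmd & cmd    (* integer test e1 <= e2 *)
  | IfR of rexp & rexp & cmd & cmd    (* real test e1 <= e2 *)
  | Flip of rexp & cmd & cmd
  | For of nat & iexp & cmd.

Section Machine.
Variable R : realType.

Record state := State {
  reg : nat -> nat;
  imem : region -> seq nat;
  rmem : region -> seq R }.

Fixpoint icost (e : iexp) : nat :=
  match e with
  | IConst _ | IReg _ => 1
  | ILoad _ e => (icost e).+1
  | IAdd e1 e2 | ISub e1 e2 | IMul e1 e2 | IDiv e1 e2 => (icost e1 + icost e2).+1
  end%N.

Fixpoint rcost (e : rexp) : nat :=
  match e with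
  | RZero | ROne => 1
  | RLoad _ e => (icost e).+1
  | RAdd e1 e2 | RSub e1 e2 | RMul e1 e2 | RDiv e1 e2 => (rcost e1 + rcost e2).+1
  end%N.

Fixpoint ieval (s : state) (e : iexp) : nat :=
  match e with
  | IConst n => n
  | IReg x => reg s x
  | ILoad a e => nth 0 (imem s a) (ieval s e)
  | IAdd e1 e2 => ieval s e1 + ieval s e2
  | ISub e1 e2 => ieval s e1 - ieval s e2
  | IMul e1 e2 => ieval s e1 * ieval s e2
  | IDiv e1 e2 => ieval s e1 %/ ieval s e2
  end%N.

Fixpoint reval (s : state) (e : rexp) : R :=
  match e with
  | RZero => 0
  | ROne => 1
  | RLoad a e => nth 0 (rmem s a) (ieval s e)
  | RAdd e1 e2 => reval s e1 + reval s e2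
  | RSub e1 e2 => reval s e1 - reval s e2
  | RMul e1 e2 => reval s e1 * reval s e2
  | RDiv e1 e2 => reval s e1 / reval s e2
  end.

Definition write T (x0 : T) (l : seq T) (i : nat) (v : T) : seq T :=
  if (i < size l)%N then set_nth x0 l i v else l.

Definition set_reg (W : nat) (s : state) (x v : nat) : state :=
  State (fun y => if y == x then v %% W else reg s y)%N (imem s) (rmem s).

Definition set_imem (W : nat) (s : state) (a : region) (i v : nat) : state :=
  State (reg s)
    (fun b => if region_eqb b a then write 0 (imem s b) i (v %% W) else imem s b)%N
    (rmem s).

Definition set_rmem (s : state) (a : region) (i : nat) (v : R) : state :=
  State (reg s) (imem s)
    (fun b => if region_eqb b a then write 0 (rmem s b) i v else rmem s b).

(* Finitely supported distributions on pairs (elapsed time, state), as lists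
   of weighted outcomes. *)
Definition dist := seq (R * (nat * state)).

Definition ret (t : nat) (s : state) : dist := [:: (1, (t, s))].

Definition bind (d : dist) (k : state -> dist) : dist :=
  [seq (o.1 * p.1, ((o.2.1 + p.2.1)%N, p.2.2)) | o <- d, p <- k o.2.2].

Definition scale (p : R) (d : dist) : dist := [seq (p * o.1, o.2) | o <- d].

(* [Flip e c1 c2] runs [c1] with probability [e] truncated to [0, 1], and
   [c2] otherwise: it compares [e] with a fresh uniform sample from [0, 1].
   The bound of [For x e c] is evaluated once, and [x] runs through
   0, ..., e - 1. *)
Fixpoint run (W : nat) (c : cmd) (s : state) {struct c} : dist :=
  match c with
  | Skip => ret 1 s
  | Seq c1 c2 => bind (run W c1 s) (run W c2)
  | SetReg x e => ret (icost e).+1 (set_reg W s x (ieval s e))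
  | IStore a i e =>
      ret (icost i + icost e).+1 (set_imem W s a (ieval s i) (ieval s e))
  | RStore a i e =>
      ret (icost i + rcost e).+1 (set_rmem s a (ieval s i) (reval s e))
  | IfI e1 e2 c1 c2 =>
      bind (ret (icost e1 + icost e2).+1 s)
        (if (ieval s e1 <= ieval s e2)%N then run W c1 else run W c2)
  | IfR e1 e2 c1 c2 =>
      bind (ret (rcost e1 + rcost e2).+1 s)
        (if reval s e1 <= reval s e2 then run W c1 else run W c2)
  | Flip e c1 c2 =>
      let p := Num.max 0 (Num.min 1 (reval s e)) in
      bind (ret (rcost e).+1 s)
        (fun s => scale p (run W c1 s) ++ scale (1 - p) (run W c2 s))
  | For x e c =>
      foldl (fun d i => bind d (fun s => bind (ret 1 (set_reg W s x i)) (run W c)))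
        (ret (icost e).+1 s) (iota 0 (ieval s e))
  end.

Definition Pr (d : dist) (Q : nat -> state -> Prop) : R :=
  \sum_(o <- d | `[< Q o.2.1 o.2.2 >]) o.1.

End Machine.

Section Encoding.
Variable R : realType.

Definition entries m n (A : 'M[R]_(m, n)) : seq R :=
  [seq A i j | i <- enum 'I_m, j <- enum 'I_n].

Definition set_entry N r (I : 'I_N -> nat) (U : forall k, 'M[R]_(I k, r))
    (j : 'I_N) (i : 'I_(I j)) (c : 'I_r) (x : R) : forall k, 'M[R]_(I k, r) :=
  dfwith U j (\matrix_(a, b) if (a == i) && (b == c) then x else U j a b).

(* The J x m array of samples, row by row. *)
Definition encode_samples J m (I : 'I_m -> nat) (t : 'I_J -> multi_index I) : seq nat :=
  [seq nat_of_ord (t d k) | d <- enum 'I_J, k <- enum 'I_m].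

(* The matrices U_1, ..., U_N are in the memory, which moreover contains
   exactly [C] arrays of [len] words and [C] arrays of [len] reals for the data
   structure, whose contents satisfy [valid]. *)
Definition stored (C len N r : nat) (I : 'I_N -> nat) (U : forall k, 'M[R]_(I k, r))
    (valid : (nat -> seq nat) -> (nat -> seq R) -> Prop) (s : state R) : Prop :=
  [/\ imem s Inp = N :: r :: [seq I j | j <- enum 'I_N],
      rmem s Inp = flatten [seq entries (U j) | j <- enum 'I_N],
      forall k, size (imem s (Data k)) = (if k < C then len else 0)%N,
      forall k, size (rmem s (Data k)) = (if k < C then len else 0)%N
    & valid (fun k => imem s (Data k)) (fun k => rmem s (Data k))].

(* An operation is called with the arguments [ia] and [ra], an output array of
   [nout] words, and [C] scratch arrays of [nscr] words and of [nscr] reals.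
   Registers, output and scratch memory are not initialized. *)
Definition called (C nscr nout : nat) (ia : seq nat) (ra : seq R) (s : state R) : Prop :=
  [/\ imem s Arg = ia /\ rmem s Arg = ra,
      size (imem s Out) = nout, rmem s Out = [::],
      forall k, size (imem s (Scr k)) = (if k < C then nscr else 0)%N
    & forall k, size (rmem s (Scr k)) = (if k < C then nscr else 0)%N].

(* log x, read as 1 where it is smaller than 1. *)
Definition log1 (x : R) : R := Num.max 1 (ln x).

End Encoding.

Record data_structure := DataStructure {
  build : cmd;
  update_entry : cmd;
  update_matrix : cmd;
  sample : cmd }.

(* Main.v *)
(** The rows of every matrix are cut into blocks of about [r] rows, and a binary
    heap stores the Gram matrices of all the unions of blocks that correspond to
    its nodes.  A change of an entry changes one row and one column of the Gram
    matrices on a path of the heap.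

    Let [G] be the entrywise product of the Gram matrices of the chosen matrices,
    which is the Gram matrix of the Khatri-Rao product, and [X] a symmetric matrix
    with [G X G = G] and [X G X = X]; it can replace the pseudoinverse in the
    leverage scores, and is built in [O(r^3)] by rank one updates.  The indices of a
    sample are drawn one after the other.  If [h] is the entrywise product of
    the rows drawn so far, then the total leverage score of their extensions is
    the quadratic form of [X * G'] at [h], where [G'] is the entrywise product of
    the Gram matrices that remain.  Writing [X * G''] (one matrix less) as a sum of
    [w w^T / d] by elimination splits the weight of a row [a] into the terms
    [(h * w . a)^2 / d].  One pivot [w] is drawn by descending a heap over the
    pivots, then a block by descending the heap of the matrix, both in [O(r^2)] per
    level, and finally a row of the block by reservoir sampling.  What does not
    depend on [h] costs [O(m r^3)] and is shared by a batch of [r^2] samples.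

    The probability of an output is computed by a martingale argument: the
    conditional probability of the output, given the indices drawn so far, has
    constant expectation along the run. *)

From HB Require Import structures.
Require Import Defs.
From mathcomp Require Import all_boot all_order all_algebra.
From mathcomp Require Import all_classical all_reals all_analysis.
From mathcomp Require Import ring lra zify.

Set Implicit Arguments.
Unset Strict Implicit.
Unset Printing Implicit Defensive.

Import Order.TTheory GRing.Theory Num.Theory.

Local Open Scope ring_scope.

(** * Expectations of programs *)

(** The machine offers field operations and comparisons of reals but no roots, so exact sampling
    must stay rational in the input: a reflexive generalized inverse replaces the spectral
    pseudoinverse, and an elimination with terms [w w^T / d] replaces a Cholesky or eigenvalue
    decomposition. Pivots with [d = 0] need no test: division by 0 yields 0, and the vector divided
    is then itself 0. The pivots exist for the sake of the last stage. The weight of a row is a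
    quadratic form that costs r^2, hence r^3 for a block; once a pivot is fixed, it is the square of
    an inner product of length r, and a whole block costs only r^2. Blocks of r rows balance the
    space: I_j / r nodes of r^2 entries fit into O(I_j r) cells. A batch of r^2 samples keeps one
    vector of length r per sample, which exhausts the scratch space r^3, and leaves each sample with
    a share m r of the precomputation. Zero weights are the delicate point of exactness. Outcomes of
    weight zero are dropped from every claim, and the invariants keep the weight of whatever has
    been drawn so far positive, so that every ratio used as a probability is a true one. *)

Lemma region_eqbP : Equality.axiom region_eqb.
Proof.
move=> a b; apply: (iffP idP) => [|->]; last by case: b => //= i.
by case: a; case: b => //= i j /eqP ->.
Qed.
HB.instance Definition _ := hasDecEq.Build region region_eqbP.

Section Logic.
Variables (R : realType) (W : nat).
Implicit Types (s : state R) (c : cmd) (d : dist R) (Q : state R -> Prop).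

(** Outcomes of weight zero are exempt: [Flip] lists both branches even if its probability is 0 or
    1, and the impossible branch may break the invariant. *)
Definition supported d (P : nat -> state R -> Prop) :=
  forall o, List.In o d -> o.1 != 0 -> P o.2.1 o.2.2.

Definition expect d (f : state R -> R) : R := \sum_(o <- d) o.1 * f o.2.2.

Lemma In_bind d k o : List.In o (bind d k) ->
  exists o1 o2, [/\ List.In o1 d, List.In o2 (k o1.2.2) &
    o = (o1.1 * o2.1, ((o1.2.1 + o2.2.1)%N, o2.2.2))].
Proof.
elim: d => [|o1 d IH] //=; move=> /List.in_app_iff [|/IH]; last first.
  by case=> a [b [Ha Hb ->]]; exists a, b; split => //; right.
by move=> /List.in_map_iff [ o2 [ <- o2in]]; exists o1, o2; split => //; left.
Qed.

Lemma supported_bind d k (P P' : nat -> state R -> Prop) :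
  supported d P ->
  (forall t s, P t s -> supported (k s) (fun t' => P' (t + t')%N)) ->
  supported (bind d k) P'.
Proof.
move=> dP kP o /In_bind [a [b [ain bin ->]]] /=; rewrite mulf_eq0 negb_or.
by case/andP => a0 b0; exact: (kP _ _ (dP _ ain a0) _ bin b0).
Qed.

Lemma supported_ret t s (P : nat -> state R -> Prop) : P t s -> supported (ret t s) P.
Proof. by move=> Pts o [ <-|[]]. Qed.

Lemma supported_mono d (P P' : nat -> state R -> Prop) :
  supported d P -> (forall t s, P t s -> P' t s) -> supported d P'.
Proof. by move=> dP PP' o oin o0; apply/PP'/dP. Qed.

Lemma expect_bind d k f :
  expect (bind d k) f = expect d (fun s => expect (k s) f).
Proof.
rewrite /expect /bind big_allpairs_dep; apply: eq_bigr => o _ /=.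
by rewrite big_distrr /=; apply: eq_bigr => p _; rewrite mulrA.
Qed.

Lemma expect_ret t s f : expect (ret t s) f = f s.
Proof. by rewrite /expect /ret big_seq1 mul1r. Qed.

Lemma expect_scale p d f : expect (scale p d) f = p * expect d f.
Proof.
rewrite /expect /scale big_map big_distrr /=.
by apply: eq_bigr => o _; rewrite mulrA.
Qed.

Lemma expect_cat d d' f : expect (d ++ d') f = expect d f + expect d' f.
Proof. by rewrite /expect big_cat. Qed.

Lemma eq_expect_supported d (P : nat -> state R -> Prop) f g :
  supported d P -> (forall t s, P t s -> f s = g s) -> expect d f = expect d g.
Proof.
move=> dP fg; rewrite /expect; elim: d dP => [|o d IH] dP; first by rewrite !big_nil.
rewrite !big_cons; congr (_ + _); last by apply: IH => a ain; apply: dP; right.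
have [->|o0] := eqVneq o.1 0; first by rewrite !mul0r.
by rewrite (fg _ _ (dP o (or_introl erefl) o0)).
Qed.

Definition loop (x : nat) c d n : dist R :=
  foldl (fun d i => bind d (fun s => bind (ret 1 (set_reg W s x i)) (run W c)))
    d (iota 0 n).

Lemma loopS x c d n : loop x c d n.+1 =
  bind (loop x c d n) (fun s => bind (ret 1 (set_reg W s x n)) (run W c)).
Proof. by rewrite /loop -[n.+1]addn1 iotaD foldl_cat add0n. Qed.

Lemma run_For x e c s :
  run W (For x e c) s = loop x c (ret (icost e).+1 s) (ieval s e).
Proof. by []. Qed.

(** The branches of [Flip] weigh p and 1 - p, so no mass is lost; this turns a property of all
    possible outcomes into one of probability exactly 1. *)
Lemma expect1 c s : expect (run W c s) (fun=> 1) = 1.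
Proof.
elim: c s => [|c1 IH1 c2 IH2|x e|a i e|a i e|e1 e2 c1 IH1 c2 IH2|e1 e2 c1 IH1 c2 IH2
  |e c1 IH1 c2 IH2|x e c IH] s; rewrite ?expect_ret //.
- rewrite expect_bind -[RHS](IH1 s); congr expect; apply/funext => s'; exact: IH2.
- by rewrite /= expect_bind expect_ret; case: ifP.
- by rewrite /= expect_bind expect_ret; case: ifP.
- by rewrite /= expect_bind expect_ret expect_cat !expect_scale IH1 IH2; ring.
- rewrite run_For; elim: (ieval s e) => [|n IHn]; first by rewrite /loop expect_ret.
  rewrite loopS expect_bind -[RHS]IHn; congr expect; apply/funext => s'.
  by rewrite expect_bind expect_ret.
Qed.

(** The time is bounded on every possible outcome, not on average; hence the running times of the
    theorem hold with probability 1. *)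
Definition safe c s (T : nat) Q :=
  supported (run W c s) (fun t s' => (t <= T)%N /\ Q s').

Lemma safe_mono c s T T' Q Q' :
  safe c s T Q -> (T <= T')%N -> (forall s', Q s' -> Q' s') -> safe c s T' Q'.
Proof.
move=> cQ TT QQ; apply: supported_mono cQ _ => t s' [tT Qs].
by split; [exact: leq_trans TT|exact: QQ].
Qed.

Lemma safe_post c s T Q Q' :
  safe c s T Q -> (forall s', Q s' -> Q' s') -> safe c s T Q'.
Proof. by move=> cQ QQ; apply: safe_mono cQ (leqnn _) QQ. Qed.

Lemma safe_time c s T T' Q : safe c s T Q -> (T <= T')%N -> safe c s T' Q.
Proof. by move=> cQ TT; apply: safe_mono cQ TT _ => s'. Qed.

Lemma safe_Skip s Q : Q s -> safe Skip s 1 Q.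
Proof. by move=> Qs; apply: supported_ret. Qed.

Lemma safe_Seq0 c1 c2 s T1 T2 Q1 Q :
  safe c1 s T1 Q1 -> (forall s', Q1 s' -> safe c2 s' T2 Q) ->
  safe (Seq c1 c2) s (T1 + T2) Q.
Proof.
move=> c1Q c2Q; apply: supported_bind c1Q _ => t s' [tT Q1s].
by apply: supported_mono (c2Q _ Q1s) _ => t' s'' [tT' Qs]; split=> //; apply: leq_add.
Qed.

Lemma safe_SetReg x e s Q :
  Q (set_reg W s x (ieval s e)) -> safe (SetReg x e) s (icost e).+1 Q.
Proof. by move=> Qs; apply: supported_ret. Qed.

Lemma safe_IStore a i e s Q :
  Q (set_imem W s a (ieval s i) (ieval s e)) ->
  safe (IStore a i e) s (icost i + icost e).+1 Q.
Proof. by move=> Qs; apply: supported_ret. Qed.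

Lemma safe_RStore a i e s Q :
  Q (set_rmem s a (ieval s i) (reval s e)) ->
  safe (RStore a i e) s (icost i + rcost e).+1 Q.
Proof. by move=> Qs; apply: supported_ret. Qed.

(** The bound adds the times of both branches instead of taking their maximum: constant factors do
    not matter and sums keep the arithmetic linear. *)
Lemma safe_IfI e1 e2 c1 c2 s T1 T2 Q :
  ((ieval s e1 <= ieval s e2)%N -> safe c1 s T1 Q) ->
  ((ieval s e2 < ieval s e1)%N -> safe c2 s T2 Q) ->
  safe (IfI e1 e2 c1 c2) s ((icost e1 + icost e2).+1 + (T1 + T2)) Q.
Proof.
move=> H1 H2; apply: (supported_bind (P := fun t s' => (t <= (icost e1 + icost e2).+1)%N /\ s' = s)).
  exact: supported_ret.
move=> t _ [tT ->]; case: leqP => cmp.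
  apply: supported_mono (H1 cmp) _ => t' s'' [tT' Qs]; split=> //.
  by rewrite leq_add // (leq_trans tT') // leq_addr.
apply: supported_mono (H2 cmp) _ => t' s'' [tT' Qs]; split=> //.
by rewrite leq_add // (leq_trans tT') // leq_addl.
Qed.

Lemma safe_IfI_then e1 e2 c1 c2 s T Q :
  (ieval s e1 <= ieval s e2)%N -> safe c1 s T Q ->
  safe (IfI e1 e2 c1 c2) s ((icost e1 + icost e2).+1 + T) Q.
Proof.
move=> cmp c1Q; rewrite -[T]addn0; apply: safe_IfI => // cmp'.
by rewrite leqNgt cmp' in cmp.
Qed.

Lemma safe_IfI_else e1 e2 c1 c2 s T Q :
  (ieval s e2 < ieval s e1)%N -> safe c2 s T Q ->
  safe (IfI e1 e2 c1 c2) s ((icost e1 + icost e2).+1 + T) Q.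
Proof.
move=> cmp c2Q; rewrite -[T]add0n; apply: safe_IfI => // cmp'.
by rewrite ltnNge cmp' in cmp.
Qed.

Lemma safe_IfR e1 e2 c1 c2 s T1 T2 Q :
  (reval s e1 <= reval s e2 -> safe c1 s T1 Q) ->
  (reval s e2 < reval s e1 -> safe c2 s T2 Q) ->
  safe (IfR e1 e2 c1 c2) s ((rcost e1 + rcost e2).+1 + (T1 + T2)) Q.
Proof.
move=> H1 H2; apply: (supported_bind (P := fun t s' => (t <= (rcost e1 + rcost e2).+1)%N /\ s' = s)).
  exact: supported_ret.
move=> t _ [tT ->]; case: leP => cmp.
  apply: supported_mono (H1 cmp) _ => t' s'' [tT' Qs]; split=> //.
  by rewrite leq_add // (leq_trans tT') // leq_addr.
apply: supported_mono (H2 cmp) _ => t' s'' [tT' Qs]; split=> //.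
by rewrite leq_add // (leq_trans tT') // leq_addl.
Qed.

Definition clamp (p : R) : R := Num.max 0 (Num.min 1 p).

Lemma clamp_id p : 0 <= p <= 1 -> clamp p = p.
Proof. by case/andP => p0 p1; rewrite /clamp min_r // max_r. Qed.

(** Each branch is examined only if its probability is nonzero. This is how the descents know that
    they never enter a subtree of weight zero. *)
Lemma safe_Flip e c1 c2 s T1 T2 Q :
  (clamp (reval s e) != 0 -> safe c1 s T1 Q) ->
  (clamp (reval s e) != 1 -> safe c2 s T2 Q) ->
  safe (Flip e c1 c2) s ((rcost e).+1 + (T1 + T2)) Q.
Proof.
move=> H1 H2; apply: (supported_bind (P := fun t s' => (t <= (rcost e).+1)%N /\ s' = s)).
  exact: supported_ret.
move=> t _ [tT ->] o /List.in_app_iff [] /List.in_map_iff [ o' [ <- o'in]] /=;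
  rewrite mulf_eq0 negb_or => /andP [p0 o0].
  have [tT' Qs] := H1 p0 _ o'in o0; split=> //.
  by rewrite leq_add // (leq_trans tT') // leq_addr.
have [|tT' Qs] := H2 _ _ o'in o0; first by rewrite eq_sym -subr_eq0.
by split=> //; rewrite leq_add // (leq_trans tT') // leq_addl.
Qed.

Lemma safe_For0 x e c s (T : nat -> nat) (I : nat -> state R -> Prop) :
  I 0%N s ->
  (forall i s', (i < ieval s e)%N -> I i s' ->
     safe c (set_reg W s' x i) (T i) (I i.+1)) ->
  safe (For x e c) s ((icost e).+1 + \sum_(i < ieval s e) (T i).+1) (I (ieval s e)).
Proof.
move=> I0 IS; rewrite /safe run_For.
elim: {-2}(ieval s e) (leqnn (ieval s e)) => [|n IHn] ln.
  by rewrite big_ord0 addn0; exact: supported_ret.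
rewrite loopS big_ord_recr /= addnA; apply: supported_bind (IHn (ltnW ln)) _.
move=> t s' [tT Is]; apply: (supported_bind (P := fun t' s'' => t' = 1%N /\ s'' = set_reg W s' x n)).
  exact: supported_ret.
move=> _ _ [-> ->]; apply: supported_mono (IS _ _ ln Is) _ => t' s'' [tT' Is'].
by split=> //; rewrite leq_add // add1n ltnS.
Qed.

(** A quantitative weakest precondition: the expectation is pushed backwards through the program. *)
Definition wp c s f := expect (run W c s) f.

Lemma wp_Seq c1 c2 s f : wp (Seq c1 c2) s f = wp c1 s (fun s' => wp c2 s' f).
Proof. exact: expect_bind. Qed.

Lemma wp_Flip e c1 c2 s f :
  wp (Flip e c1 c2) s f =
  clamp (reval s e) * wp c1 s f + (1 - clamp (reval s e)) * wp c2 s f.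
Proof. by rewrite /wp /= expect_bind expect_ret expect_cat !expect_scale. Qed.

Lemma wp_IfI e1 e2 c1 c2 s f : wp (IfI e1 e2 c1 c2) s f =
  if (ieval s e1 <= ieval s e2)%N then wp c1 s f else wp c2 s f.
Proof. by rewrite /wp /= expect_bind expect_ret; case: ifP. Qed.

Lemma wp_SetReg x e s f : wp (SetReg x e) s f = f (set_reg W s x (ieval s e)).
Proof. exact: expect_ret. Qed.

Lemma wp_Skip s f : wp Skip s f = f s.
Proof. exact: expect_ret. Qed.

Lemma eq_wp c s T Q f g :
  safe c s T Q -> (forall s', Q s' -> f s' = g s') -> wp c s f = wp c s g.
Proof. by move=> cQ fg; apply: eq_expect_supported cQ _ => t s' [_]; apply: fg. Qed.

Lemma wp_const c s T Q f v :
  safe c s T Q -> (forall s', Q s' -> f s' = v) -> wp c s f = v.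
Proof.
move=> cQ fv; rewrite (eq_wp (g := fun=> v * 1) cQ) => [|s' Qs]; last first.
  by rewrite mulr1; exact: fv.
transitivity (v * wp c s (fun=> 1)); last by rewrite /wp expect1 mulr1.
rewrite /wp /expect big_distrr /=; apply: eq_bigr => o _; ring.
Qed.

Lemma wp_Seq_safe c1 c2 s T Q f v :
  safe c1 s T Q -> (forall s', Q s' -> wp c2 s' f = v) -> wp (Seq c1 c2) s f = v.
Proof. by move=> cQ fv; rewrite wp_Seq; exact: wp_const cQ fv. Qed.

(* The martingale rule: the conditional expectation [phi i] of the final
   quantity is preserved by every iteration. *)
Lemma wp_For x e c s (T : nat -> nat) (I : nat -> state R -> Prop) phi :
  I 0%N s ->
  (forall i s', (i < ieval s e)%N -> I i s' ->
     safe c (set_reg W s' x i) (T i) (I i.+1)) ->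
  (forall i s', (i < ieval s e)%N -> I i s' ->
     wp c (set_reg W s' x i) (phi i.+1) = phi i s') ->
  wp (For x e c) s (phi (ieval s e)) = phi 0%N s.
Proof.
move=> I0 IS phiS.
have loopI n : (n <= ieval s e)%N ->
    supported (loop x c (ret (icost e).+1 s) n) (fun _ => I n).
  elim: n => [|n IHn] ln; first exact: supported_ret.
  rewrite loopS; apply: supported_bind (IHn (ltnW ln)) _ => t s' Is.
  apply: (supported_bind (P := fun t' s'' => s'' = set_reg W s' x n)).
    exact: supported_ret.
  by move=> _ _ ->; apply: supported_mono (IS _ _ ln Is) _ => t' s'' [].
rewrite /wp run_For.
elim: {-2}(ieval s e) (leqnn (ieval s e)) => [|n IHn] ln.
  by rewrite /loop expect_ret.
rewrite loopS expect_bind -(IHn (ltnW ln)).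
apply: eq_expect_supported (loopI _ (ltnW ln)) _ => t s' Is.
by rewrite expect_bind expect_ret; exact: phiS.
Qed.

Lemma Pr_safe c s T Q (P : nat -> state R -> Prop) :
  safe c s T Q -> (forall t s', (t <= T)%N -> Q s' -> P t s') ->
  Pr (run W c s) P = 1.
Proof.
move=> cQ PQ; rewrite -(expect1 c s) /Pr /expect.
rewrite /safe in cQ; elim: (run W c s) cQ => [|o d IH] dQ; first by rewrite !big_nil.
have {}IH : \sum_(o <- d | `[< P o.2.1 o.2.2 >]) o.1 = \sum_(o <- d) o.1 * 1.
  by apply: IH => a ain; apply: dQ; right.
rewrite !big_cons mulr1; have [ o0|o0] := eqVneq o.1 0.
  by case: ifP => _; rewrite ?o0 ?add0r IH.
have [tT Qs] := dQ o (or_introl erefl) o0.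
by case: asboolP => [_|[]]; [rewrite IH|exact: PQ].
Qed.

Lemma Pr_wp c s (P : state R -> Prop) :
  Pr (run W c s) (fun _ => P) = wp c s (fun s' => if `[< P s' >] then 1 else 0).
Proof.
rewrite /Pr /wp /expect big_mkcond; apply: eq_bigr => o _.
by case: asboolP; rewrite ?mulr1 ?mulr0.
Qed.

(** * Frame conditions: what a program cannot change *)

Fixpoint wregs c : seq nat :=
  match c with
  | Seq c1 c2 | IfI _ _ c1 c2 | IfR _ _ c1 c2 | Flip _ c1 c2 => wregs c1 ++ wregs c2
  | SetReg x _ => [:: x]
  | For x _ c => x :: wregs c
  | _ => [::]
  end.

Fixpoint wwords c : seq region :=
  match c with
  | Seq c1 c2 | IfI _ _ c1 c2 | IfR _ _ c1 c2 | Flip _ c1 c2 => wwords c1 ++ wwords c2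
  | IStore a _ _ => [:: a]
  | For _ _ c => wwords c
  | _ => [::]
  end.

Fixpoint wreals c : seq region :=
  match c with
  | Seq c1 c2 | IfI _ _ c1 c2 | IfR _ _ c1 c2 | Flip _ c1 c2 => wreals c1 ++ wreals c2
  | RStore a _ _ => [:: a]
  | For _ _ c => wreals c
  | _ => [::]
  end.

(** The write sets are computed from the program text, so most side conditions of frame reasoning
    are closed boolean terms, proved by [isT]. The sizes of the arrays are kept even for those that
    are written. *)
Record framed (X : seq nat) (A B : seq region) s s' : Prop := Framed {
  fr_reg : forall x, x \notin X -> reg s' x = reg s x;
  fr_words : forall a, a \notin A -> imem s' a = imem s a;
  fr_reals : forall a, a \notin B -> rmem s' a = rmem s a;
  fr_wsize : forall a, size (imem s' a) = size (imem s a);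
  fr_rsize : forall a, size (rmem s' a) = size (rmem s a) }.

Definition frame c := framed (wregs c) (wwords c) (wreals c).

Lemma framed_refl X A B s : framed X A B s s. Proof. by split. Qed.

Lemma framed_trans X A B s1 s2 s3 :
  framed X A B s1 s2 -> framed X A B s2 s3 -> framed X A B s1 s3.
Proof.
case=> a1 a2 a3 a4 a5 [b1 b2 b3 b4 b5]; split=> [x xX|a aA|a aB|a|a].
- by rewrite b1 ?a1.
- by rewrite b2 ?a2.
- by rewrite b3 ?a3.
- by rewrite b4 a4.
- by rewrite b5 a5.
Qed.

Lemma framed_sub X A B X' A' B' s s' :
  {subset X <= X'} -> {subset A <= A'} -> {subset B <= B'} ->
  framed X A B s s' -> framed X' A' B' s s'.
Proof.
by move=> XX AA BB [a1 a2 a3 a4 a5]; split=> // [x xX|a aA|a aB];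
  [apply: a1|apply: a2|apply: a3]; apply: contra xX || apply: contra aA || apply: contra aB;
  [exact: XX|exact: AA|exact: BB].
Qed.

Lemma size_write (T : Type) (x0 : T) l i v : size (write x0 l i v) = size l.
Proof.
rewrite /write; case: ifP => // il; rewrite size_set_nth.
by apply/maxn_idPr.
Qed.

Lemma nth_write (T : Type) (x0 : T) l i v j :
  nth x0 (write x0 l i v) j = if (j == i) && (i < size l)%N then v else nth x0 l j.
Proof.
rewrite /write; case: ltnP => _; last by rewrite andbF.
by rewrite nth_set_nth /= andbT.
Qed.

Lemma framed_set_reg X A B s x v : x \in X -> framed X A B s (set_reg W s x v).
Proof.
move=> xX; split=> // y yX; rewrite /set_reg /=.
by case: eqP => // yx; rewrite yx xX in yX.
Qed.

Lemma framed_set_imem X A B s a i v : a \in A -> framed X A B s (set_imem W s a i v).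
Proof.
move=> aA; split=> // [b bA|b] /=; rewrite -/(b == a); case: eqP => // ba.
  by rewrite ba aA in bA.
by rewrite size_write.
Qed.

Lemma framed_set_rmem X A B s a i v : a \in B -> framed X A B s (set_rmem s a i v).
Proof.
move=> aA; split=> // [b bA|b] /=; rewrite -/(b == a); case: eqP => // ba.
  by rewrite ba aA in bA.
by rewrite size_write.
Qed.

Lemma supported_frame c s : supported (run W c s) (fun _ => frame c s).
Proof.
have catl (T : eqType) (l1 l2 : seq T) : {subset l1 <= l1 ++ l2}.
  by move=> x xl; rewrite mem_cat xl.
have catr (T : eqType) (l1 l2 : seq T) : {subset l2 <= l1 ++ l2}.
  by move=> x xl; rewrite mem_cat xl orbT.
elim: c s => [|c1 IH1 c2 IH2|x e|a i e|a i e|e1 e2 c1 IH1 c2 IH2|e1 e2 c1 IH1 c2 IH2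
  |e c1 IH1 c2 IH2|x e c IH] s.
- by apply: supported_ret; exact: framed_refl.
- apply: supported_bind (IH1 s) _ => // _ s1 f1.
  apply: supported_mono (IH2 s1) _ => // _ s2 f2.
  by apply: (framed_trans (s2 := s1));
    [apply: framed_sub f1; exact: catl|apply: framed_sub f2; exact: catr].
- by apply: supported_ret; apply: framed_set_reg; rewrite inE.
- by apply: supported_ret; apply: framed_set_imem; rewrite inE.
- by apply: supported_ret; apply: framed_set_rmem; rewrite inE.
- rewrite /=; apply: (supported_bind (P := fun _ s' => s' = s)).
    exact: supported_ret.
  move=> _ _ ->; case: ifP => _.
    by apply: supported_mono (IH1 s) _ => // _ s2; apply: framed_sub; exact: catl.
  by apply: supported_mono (IH2 s) _ => // _ s2; apply: framed_sub; exact: catr.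
- rewrite /=; apply: (supported_bind (P := fun _ s' => s' = s)).
    exact: supported_ret.
  move=> _ _ ->; case: ifP => _.
    by apply: supported_mono (IH1 s) _ => // _ s2; apply: framed_sub; exact: catl.
  by apply: supported_mono (IH2 s) _ => // _ s2; apply: framed_sub; exact: catr.
- rewrite /=; apply: (supported_bind (P := fun _ s' => s' = s)).
    exact: supported_ret.
  move=> _ _ -> o /List.in_app_iff [] /List.in_map_iff [ o' [ <- o'in]] /=;
    rewrite mulf_eq0 negb_or => /andP [p0 o0].
    by have := IH1 s _ o'in o0; apply: framed_sub; exact: catl.
  by have := IH2 s _ o'in o0; apply: framed_sub; exact: catr.
- rewrite run_For; elim: (ieval s e) => [|n IHn].
    by apply: supported_ret; exact: framed_refl.
  rewrite loopS; apply: supported_bind IHn _ => _ s1 f1.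
  apply: (supported_bind (P := fun _ s' => s' = set_reg W s1 x n)).
    exact: supported_ret.
  move=> _ _ ->; apply: supported_mono (IH _) _ => // _ s2 f2.
  apply: framed_trans f1 _; apply: (framed_trans (s2 := set_reg W s1 x n)).
    by apply: framed_set_reg; rewrite inE eqxx.
  by apply: framed_sub f2 => // y yc; rewrite inE yc orbT.
Qed.

Lemma safe_frame c s T Q : safe c s T Q -> safe c s T (fun s' => Q s' /\ frame c s s').
Proof.
move=> cQ o oin o0; have [tT Qs] := cQ o oin o0.
by split=> //; split=> //; exact: (@supported_frame c s o oin o0).
Qed.

Lemma safe_Seq c1 c2 s T1 T2 Q1 Q :
  safe c1 s T1 Q1 -> (forall s', Q1 s' -> frame c1 s s' -> safe c2 s' T2 Q) ->
  safe (Seq c1 c2) s (T1 + T2) Q.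
Proof. by move=> /safe_frame c1Q c2Q; apply: safe_Seq0 c1Q _ => s' []; exact: c2Q. Qed.

(** The body may assume the frame of the whole loop relative to the initial state, so an invariant
    only has to mention what the loop changes. *)
Lemma safe_For x e c s (T : nat -> nat) (I : nat -> state R -> Prop) :
  I 0%N s ->
  (forall i s', (i < ieval s e)%N -> frame (For x e c) s s' -> I i s' ->
     safe c (set_reg W s' x i) (T i) (I i.+1)) ->
  safe (For x e c) s ((icost e).+1 + \sum_(i < ieval s e) (T i).+1) (I (ieval s e)).
Proof.
move=> I0 IS; apply: (safe_post (Q := fun s' => I (ieval s e) s' /\ frame (For x e c) s s')).
  apply: (@safe_For0 x e c s T (fun i s' => I i s' /\ frame (For x e c) s s')).
    by split=> //; exact: framed_refl.
  move=> i s' il [Is fs]; apply: safe_post (safe_frame (IS _ _ il fs Is)) _.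
  move=> s2 [Is2 f2]; split=> //; apply: framed_trans fs _.
  apply: (framed_trans (s2 := set_reg W s' x i)).
    by apply: framed_set_reg; rewrite inE eqxx.
  by apply: framed_sub f2 => // y yc; rewrite inE yc orbT.
by move=> s' [].
Qed.

End Logic.

(** * Reading memory, and patterns for loops that fill or sum *)

Section Views.
Variable R : realType.
Implicit Types s : state R.

Definition rd s (a : region) (i : nat) : R := nth 0 (rmem s a) i.
Definition ird s (a : region) (i : nat) : nat := nth 0%N (imem s a) i.

Lemma rd_set_rmem s a i v b j : rd (set_rmem s a i v) b j =
  if [&& b == a, j == i & (i < size (rmem s a))%N] then v else rd s b j.
Proof.
rewrite /rd /= -/(b == a); case: eqP => [->|] //=; exact: nth_write.
Qed.

Lemma rd_set_reg W s x v b j : rd (set_reg W s x v) b j = rd s b j.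
Proof. by []. Qed.

Lemma frame_rd c s s' a : frame c s s' -> a \notin wreals c -> forall i, rd s' a i = rd s a i.
Proof. by move=> [_ _ H _ _] ac i; rewrite /rd H. Qed.

Lemma frame_ird c s s' a : frame c s s' -> a \notin wwords c -> forall i, ird s' a i = ird s a i.
Proof. by move=> [_ H _ _ _] ac i; rewrite /ird H. Qed.

Lemma frame_rsize c s s' a : frame c s s' -> size (rmem s' a) = size (rmem s a).
Proof. by case. Qed.

Lemma frame_reg c s s' x : frame c s s' -> x \notin wregs c -> reg s' x = reg s x.
Proof. by move=> [H _ _ _ _]; exact: H. Qed.

Lemma frame_For W x e c s s' i : frame (For x e c) s s' ->
  frame (For x e c) s (set_reg W s' x i).
Proof.
by move=> f; apply: framed_trans f _; apply: framed_set_reg; rewrite inE eqxx.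
Qed.

(** Boolean, so that for a concrete program it is decided by computation. *)
Definition spares (words reals : seq region) c :=
  all (fun a => a \notin wwords c) words && all (fun a => a \notin wreals c) reals.

Variable W : nat.

(** The invariant must be insensitive to the counter, which is overwritten before each iteration.
    The counter takes values below [n] only, so [n <= W] is enough to keep it from being reduced. *)
Lemma safe_loop x e c s n (T : nat -> nat) (I : nat -> state R -> Prop) :
  ieval s e = n -> (n <= W)%N -> I 0%N s ->
  (forall i s' v, I i s' -> I i (set_reg W s' x v)) ->
  (forall i s', (i < n)%N -> frame (For x e c) s s' -> reg s' x = i -> I i s' ->
     safe W c s' (T i) (I i.+1)) ->
  safe W (For x e c) s ((icost e).+1 + \sum_(i < n) (T i).+1) (I n).
Proof.
move=> <- nW I0 Ireg IS; apply: safe_For => // i s' il fs Is.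
apply: IS => //; first exact: frame_For.
  by rewrite /= eqxx modn_small // (leq_trans il).
exact: Ireg.
Qed.

Lemma safe_Seq_SetReg x e c s v T Q :
  ieval s e = v -> (v < W)%N ->
  (forall s', frame (SetReg x e) s s' -> reg s' x = v -> safe W c s' T Q) ->
  safe W (Seq (SetReg x e) c) s ((icost e).+1 + T) Q.
Proof.
move=> ev vW H; apply: (safe_Seq (Q1 := fun s' => reg s' x = v)).
  by apply: safe_SetReg; rewrite /= eqxx ev modn_small.
by move=> s' s'v fs; apply: H.
Qed.

(** The body sees the cells before [off + i] filled and all others with their old content, which
    also covers loops that update an array in place. *)
Lemma safe_fill x e c s a off n (F : nat -> R) T :
  ieval s e = n -> (n <= W)%N ->
  (forall i s', (i < n)%N -> frame (For x e c) s s' -> reg s' x = i ->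
     (forall k, rd s' a k = if (off <= k < off + i)%N then F (k - off)%N else rd s a k) ->
     safe W c s' T (fun s'' => rd s'' a (off + i) = F i /\
        forall k, k != (off + i)%N -> rd s'' a k = rd s' a k)) ->
  safe W (For x e c) s ((icost e).+1 + n * T.+1)
    (fun s' => forall k, rd s' a k =
       if (off <= k < off + n)%N then F (k - off)%N else rd s a k).
Proof.
move=> en nW H; have Tn : (n * T.+1 = \sum_(i < n) T.+1)%N by rewrite sum_nat_const card_ord.
rewrite Tn -en.
apply: (safe_For (T := fun=> T) (I := fun n s' => forall k, rd s' a k =
       if (off <= k < off + n)%N then F (k - off)%N else rd s a k)).
  by move=> k; rewrite addn0; case: ifP => //; lia.
move=> i s' il fs Is; rewrite en in il.
apply: safe_post (H i _ il (frame_For W i fs) _ Is) _.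
  by rewrite /= eqxx modn_small // (leq_trans il).
move=> s'' [Ha Hk] k; have [->|kn] := eqVneq k (off + i)%N.
  by rewrite Ha addKn ifT //; lia.
rewrite (Hk _ kn) rd_set_reg Is.
by have -> : (off <= k < off + i.+1)%N = (off <= k < off + i)%N by lia.
Qed.

(* The running total is kept in a memory cell, as there are no real registers. *)
Lemma safe_sum x e a ie re s i0 n (F : nat -> R) :
  ieval s e = n -> (n <= W)%N -> (i0 < size (rmem s a))%N ->
  (forall i s', (i < n)%N -> frame (For x e (RStore a ie (RAdd (RLoad a ie) re))) s s' ->
     reg s' x = i -> (forall k, k != i0 -> rd s' a k = rd s a k) ->
     ieval s' ie = i0 /\ reval s' re = F i) ->
  safe W (For x e (RStore a ie (RAdd (RLoad a ie) re))) s
    ((icost e).+1 + n * (icost ie + icost ie + rcost re).+4)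
    (fun s' => rd s' a i0 = rd s a i0 + \sum_(i < n) F i /\
       forall k, k != i0 -> rd s' a k = rd s a k).
Proof.
set T := (icost ie + icost ie + rcost re).+3.
move=> en nW i0s H; have -> : (n * T.+1 = \sum_(i < n) T.+1)%N by rewrite sum_nat_const card_ord.
rewrite -en.
apply: (safe_For (T := fun=> T) (I := fun n s' => rd s' a i0 = rd s a i0 + \sum_(i < n) F i /\
       forall k, k != i0 -> rd s' a k = rd s a k)).
  by rewrite big_ord0 addr0.
move=> i s' il fs [I1 I2]; rewrite en in il.
have [|ie0 reF] := H i _ il (frame_For W i fs) _ I2.
  by rewrite /= eqxx modn_small // (leq_trans il).
apply: (safe_time (T := (icost ie + rcost (RAdd (RLoad a ie) re)).+1)); last by rewrite /T /=; lia.
apply: safe_RStore; rewrite ie0 /=; split.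
  rewrite rd_set_rmem !eqxx /= (frame_rsize _ fs) i0s ie0 reF big_ord_recr /= -/(rd s' a i0) I1.
  by rewrite addrA.
by move=> k kn; rewrite rd_set_rmem (negbTE kn) andbF; exact: I2.
Qed.

Definition sum_into a ie x e re :=
  Seq (RStore a ie RZero) (For x e (RStore a ie (RAdd (RLoad a ie) re))).

Lemma safe_sum_into x e a ie re s i0 n (F : nat -> R) :
  ieval s e = n -> (n <= W)%N -> (i0 < size (rmem s a))%N -> ieval s ie = i0 ->
  (forall i s', (i < n)%N -> frame (sum_into a ie x e re) s s' ->
     reg s' x = i -> (forall k, k != i0 -> rd s' a k = rd s a k) ->
     ieval s' ie = i0 /\ reval s' re = F i) ->
  safe W (sum_into a ie x e re) s
    ((icost ie).+2 + ((icost e).+1 + n * (icost ie + icost ie + rcost re).+4))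
    (fun s' => rd s' a i0 = \sum_(i < n) F i /\
       forall k, k != i0 -> rd s' a k = rd s a k).
Proof.
move=> en nW i0s ie0 H; have -> : (icost ie).+2 = (icost ie + rcost RZero).+1 by rewrite /= addn1.
(* Integer expressions never read reals, so resetting the accumulator changes neither the loop bound
   nor an address. *)
have ev (e' : iexp) : ieval (set_rmem s a i0 (reval s RZero)) e' = ieval s e'.
  by elim: e' => //= [b e1 ->|e1 -> e2 ->|e1 -> e2 ->|e1 -> e2 ->|e1 -> e2 ->].
apply: (safe_Seq0 (Q1 := fun s' => s' = set_rmem s a i0 0)).
  by apply: safe_RStore; rewrite ie0.
move=> _ ->.
have nb k : k != i0 -> rd (set_rmem s a i0 0) a k = rd s a k.
  by move=> kn; rewrite rd_set_rmem (negbTE kn) andbF.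
apply: safe_post; first apply: (safe_sum (i0 := i0) (n := n) (F := F)) => //.
- by rewrite -en -(ev e).
- by rewrite (_ : size _ = size (rmem s a)) // /=; case: ifP => _; rewrite ?size_write.
- move=> i s' il fs xi kn; apply: (H i) => //.
    apply: (@framed_trans _ _ _ _ _ (set_rmem s a i0 0)).
      by apply: framed_set_rmem; rewrite inE eqxx.
    by apply: framed_sub fs => // y yc; rewrite inE yc orbT.
  by move=> k k0; rewrite kn ?nb.
move=> s' [H1 H2]; split.
  by rewrite H1 rd_set_rmem !eqxx /= i0s add0r.
by move=> k kn; rewrite H2 ?nb.
Qed.

End Views.

(** * Programs *)

Declare Scope iexp_scope.
Delimit Scope iexp_scope with ie.
Infix "+" := IAdd : iexp_scope.
Infix "-" := ISub : iexp_scope.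
Infix "*" := IMul : iexp_scope.
Infix "/" := IDiv : iexp_scope.
Notation "# n" := (IConst n) (at level 0, format "# n") : iexp_scope.
Declare Scope rexp_scope.
Delimit Scope rexp_scope with re.
Infix "+" := RAdd : rexp_scope.
Infix "-" := RSub : rexp_scope.
Infix "*" := RMul : rexp_scope.
Infix "/" := RDiv : rexp_scope.
Notation "a ![ i ]" := (RLoad a i%ie) (at level 1, format "a ![ i ]") : rexp_scope.
Notation "c1 ;; c2" := (Seq c1 c2) (at level 80, right associativity).

(* [vE], [vT], [vX], [vC] are loop counters. *)
Notation vE := (IReg 0).
Notation vT := (IReg 1).
Notation vJ := (IReg 2).
Notation vX := (IReg 3).
Notation vNode := (IReg 4).
Notation vK := (IReg 6).
Notation vB := (IReg 7).
Notation vD := (IReg 8).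
Notation vU := (IReg 9).
Notation vRow := (IReg 10).
Notation vBase := (IReg 11).
Notation vBn := (IReg 12).
Notation vDst := (IReg 13).
Notation vSrc := (IReg 14).
Notation vCnt := (IReg 15).
Notation vC := (IReg 16).
Notation vBlk := (IReg 17).

Notation eN := (ILoad Inp (IConst 0)).
Notation eR := (ILoad Inp (IConst 1)).
Notation eRR := (IMul eR eR).
Notation eI j := (ILoad Inp (IAdd (IConst 2) j)).
Notation eOff j := (ILoad (Data 0) j).
Notation eLg x := (ILoad (Data 1) x).
Notation eMod x := (ISub x (IMul (IDiv x eR) eR)).

(* Truncated subtraction makes this [max 1 (I_j / r)]. *)
Definition eBlocks (j : iexp) := (eI j / eR + (#1 - eI j / eR))%ie.

Definition gram_rows (dst : region) : cmd :=
  For 0 eRR (sum_into dst (vDst + vE)%ie 1 vCnt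
    (Inp![vSrc + vT * eR + vE / eR] * Inp![vSrc + vT * eR + eMod vE])%re).

(** Nodes are filled from [vBn - 1] down to 1, so that both children of a node are final when it is
    computed. *)
Definition add_nodes (a : region) : cmd :=
  For 3 (vBn - #1)%ie
    (SetReg 4 (vBn - #1 - vX)%ie ;;
     For 0 eRR (RStore a (vBase + vNode * eRR + vE)%ie
       (a![vBase + (#2 * vNode) * eRR + vE] +
        a![vBase + (#2 * vNode + #1) * eRR + vE])%re)).

(** The last block absorbs the remainder of the division by r, and is the whole matrix if there are
    fewer than r rows. *)
Definition block_size (b : iexp) : cmd :=
  IfI vBn (b + #1)%ie (SetReg 15 (eI vJ - b * eR)%ie) (SetReg 15 eR).

(** With fewer than r rows no heap is stored, as a single node of r^2 entries would exceed the space
    I_j r. Otherwise the 2 * (I_j / r) nodes fit into 2 I_j r cells, which is why the heap of a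
    matrix starts at twice the offset of its rows. *)
Definition build_tree : cmd :=
  IfI eR (eI vJ)
    (SetReg 11 (#2 * eOff vJ)%ie ;;
     SetReg 12 (eBlocks vJ) ;;
     For 3 vBn
       (SetReg 13 (vBase + (vBn + vX) * eRR)%ie ;;
        SetReg 14 (eOff vJ + vX * eRR)%ie ;;
        block_size vX ;;
        gram_rows (Data 0)) ;;
     add_nodes (Data 0))
    Skip.

(** Besides the offsets, a table of integer logarithms is prepared, because the number of levels of
    a heap bounds the loops that walk through it and the machine has no logarithm. *)
Definition build_prog : cmd :=
  IStore (Data 0) #0%ie #0%ie ;;
  For 2 eN (IStore (Data 0) (vJ + #1)%ie (eOff vJ + eI vJ * eR)%ie) ;;
  For 3 (eOff eN + #1)%ie
    (IfI vX #1%ie (IStore (Data 1) vX #0%ie)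
       (IStore (Data 1) vX (eLg (vX / #2)%ie + #1)%ie)) ;;
  For 2 eN build_tree.

Definition update_matrix_prog : cmd :=
  SetReg 2 (ILoad Arg #0%ie) ;;
  For 0 (eI vJ * eR)%ie (RStore Inp (eOff vJ + vE)%ie Arg![vE]%re) ;;
  build_tree.

Definition eDelta : rexp := (Arg![#0] - Inp![vSrc + vC])%re.

Definition update_node : cmd :=
  For 0 eR
    (RStore (Data 0) (vBase + vNode * eRR + (vE * eR + vC))%ie
       ((Data 0)![vBase + vNode * eRR + (vE * eR + vC)] + eDelta * Inp![vSrc + vE])%re ;;
     RStore (Data 0) (vBase + vNode * eRR + (vC * eR + vE))%ie
       ((Data 0)![vBase + vNode * eRR + (vC * eR + vE)] + eDelta * Inp![vSrc + vE])%re) ;;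
  RStore (Data 0) (vBase + vNode * eRR + (vC * eR + vC))%ie
    ((Data 0)![vBase + vNode * eRR + (vC * eR + vC)] + eDelta * eDelta)%re.

(** The input entry is overwritten last, since the difference [eDelta] and the old row are read from
    the input at every node of the path. The truncated difference x - (x - y) is the minimum of x
    and y; it selects the last block for the rows of the remainder. *)
Definition update_entry_prog : cmd :=
  SetReg 2 (ILoad Arg #0%ie) ;;
  SetReg 16 (ILoad Arg #2%ie) ;;
  SetReg 14 (eOff vJ + ILoad Arg #1%ie * eR)%ie ;;
  IfI eR (eI vJ)
    (SetReg 11 (#2 * eOff vJ)%ie ;;
     SetReg 12 (eBlocks vJ) ;;
     SetReg 17 (ILoad Arg #1%ie / eR)%ie ;;
     SetReg 4 (vBn + (vBlk - (vBlk - (vBn - #1))))%ie ;;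
     For 5 (eLg vBn + #2)%ie
       (IfI #1%ie vNode (update_node ;; SetReg 4 (vNode / #2)%ie) Skip))
    Skip ;;
  RStore Inp (vSrc + vC)%ie Arg![#0]%re.

Notation sAcc := (Scr 0).
Notation sAcc2 := (Scr 1).
Notation sTot := (Scr 2).
Notation sVec := (Scr 3).
Notation sHist := (Scr 4).
Notation sProd := (Scr 5).
Notation sZero := (Scr 6).
Notation sGram := (Scr 7).
Notation sInv := (Scr 8).
Notation sMat := (Scr 9).
Notation sFac := (Scr 10).
Notation sTree := (Scr 11).
Notation sDir := (Scr 12).
Notation sAll := (Scr 13).

Definition quad (a : region) (node : iexp) (dst : region) : cmd :=
  sum_into dst #0%ie 0 eRR
    (sVec![vE / eR] * sVec![eMod vE] * a![vBase + node * eRR + vE])%re.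

(** If the number of leaves is not a power of two, the leaves lie at two depths; a walk that arrives
    early idles for the rest of the loop. *)
Definition descend (a : region) : cmd :=
  SetReg 4 #1%ie ;;
  For 5 (eLg vBn + #1)%ie
    (IfI vBn vNode Skip
       (quad a (#2 * vNode)%ie sAcc ;;
        quad a (#2 * vNode + #1)%ie sAcc2 ;;
        Flip (sAcc![#0] / (sAcc![#0] + sAcc2![#0]))%re
          (SetReg 4 (#2 * vNode)%ie) (SetReg 4 (#2 * vNode + #1)%ie))).

Definition scan_weight : cmd :=
  sum_into sAcc #0%ie 1 eR (sVec![vT] * Inp![vSrc + vX * eR + vT])%re ;;
  RStore sAcc #0%ie (sAcc![#0] * sAcc![#0])%re ;;
  RStore sTot #0%ie (sTot![#0] + sAcc![#0])%re.

(* Reservoir sampling of a row of the block. *)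
Definition scan : cmd :=
  SetReg 10 #0%ie ;;
  RStore sTot #0%ie RZero ;;
  For 3 vCnt (scan_weight ;; Flip (sAcc![#0] / sTot![#0])%re (SetReg 10 vX) Skip).

(** The root of the heap is node 1, hence the offset [eRR]. Without a heap there are fewer than r
    rows, and recomputing the Gram matrix costs only r^3. *)
Definition gram_matrix : cmd :=
  IfI eR (eI vJ)
    (For 0 eRR (RStore sGram vE (Data 0)![#2 * eOff vJ + eRR + vE]%re))
    (SetReg 13 #0%ie ;; SetReg 14 (eOff vJ) ;; SetReg 15 (eI vJ) ;; gram_rows sGram).

Definition if_zero (e : rexp) (c1 c2 : cmd) : cmd :=
  IfR e RZero (IfR RZero e c1 c2) c2.

Notation eMats := (ILoad Arg (IConst 1)).
Notation ePick k := (ILoad Arg (IAdd (IConst 2) k)).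

(* [sProd] holds products of nonzero factors and [sZero] the numbers of zero
   factors, so that factors can later be removed by division. *)
Definition products : cmd :=
  For 0 eRR (RStore sProd vE ROne ;; RStore sZero vE RZero) ;;
  For 6 eMats
    (SetReg 2 (ePick vK) ;;
     gram_matrix ;;
     For 0 eRR (if_zero sGram![vE]%re
       (RStore sZero vE (sZero![vE] + ROne)%re)
       (RStore sProd vE (sProd![vE] * sGram![vE])%re))) ;;
  For 0 eRR (IfR sZero![vE]%re RZero (RStore sAll vE sProd![vE]%re) (RStore sAll vE RZero)).

Definition gen_inverse : cmd :=
  For 0 eRR (RStore sInv vE RZero) ;;
  For 16 eR
    (For 3 eR
       (sum_into sDir vX 1 eR (sInv![vX * eR + vT] * sAll![vT * eR + vC])%re ;;
        RStore sDir vX (RZero - sDir![vX])%re) ;;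
     RStore sDir vC (sDir![vC] + ROne)%re ;;
     sum_into sAcc #0%ie 1 eR (sDir![vT] * sAll![vT * eR + vC])%re ;;
     For 0 eRR (RStore sInv vE
       (sInv![vE] + sDir![vE / eR] * sDir![eMod vE] / sAcc![#0])%re)).

Definition conditional_matrix : cmd :=
  For 0 eRR
    (if_zero sGram![vE]%re
       (RStore sZero vE (sZero![vE] - ROne)%re)
       (RStore sProd vE (sProd![vE] / sGram![vE])%re) ;;
     IfR sZero![vE]%re RZero
       (RStore sMat vE (sInv![vE] * sProd![vE])%re) (RStore sMat vE RZero)).

Definition eTerm : rexp :=
  (sFac![vU * eR + vE / eR] * sFac![vU * eR + eMod vE] / sFac![vU * eR + vU])%re.

(** The leaf of pivot [u] is node [r + u]. It holds the term of the pivot times the current Gram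
    matrix, entrywise, so that its quadratic form at the history vector is the weight of this pivot
    summed over all rows. *)
Definition factorize : cmd :=
  For 9 eR
    (For 16 eR (RStore sFac (vU * eR + vC)%ie sMat![vC * eR + vU]%re) ;;
     For 0 eRR (RStore sTree ((eR + vU) * eRR + vE)%ie (eTerm * sGram![vE])%re) ;;
     For 0 eRR (RStore sMat vE (sMat![vE] - eTerm)%re)) ;;
  SetReg 11 #0%ie ;;
  SetReg 12 eR ;;
  add_nodes sTree.

Definition sample_index : cmd :=
  For 0 eR (RStore sVec vE sHist![vD * eR + vE]%re) ;;
  SetReg 11 #0%ie ;;
  SetReg 12 eR ;;
  descend sTree ;;
  SetReg 9 (vNode - vBn)%ie ;;
  For 0 eR (RStore sVec vE (sVec![vE] * sFac![vU * eR + vE])%re) ;;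
  SetReg 11 (#2 * eOff vJ)%ie ;;
  SetReg 12 (eBlocks vJ) ;;
  descend (Data 0) ;;
  SetReg 17 (vNode - vBn)%ie ;;
  SetReg 14 (eOff vJ + vBlk * eRR)%ie ;;
  block_size vBlk ;;
  scan ;;
  SetReg 10 (vBlk * eR + vRow)%ie ;;
  IStore Out ((vB * eRR + vD) * eMats + vK)%ie vRow ;;
  For 0 eR (RStore sHist (vD * eR + vE)%ie
    (sHist![vD * eR + vE] * Inp![eOff vJ + vRow * eR + vE])%re).

Definition eLeft : iexp := (ILoad Arg #0 - vB * eRR)%ie.

(** The bound of the inner loop is the minimum of r^2 and the number of samples still to be drawn,
    so that the last batch may be incomplete. *)
Definition sample_step : cmd :=
  SetReg 2 (ePick vK) ;;
  gram_matrix ;;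
  conditional_matrix ;;
  factorize ;;
  For 8 (eRR - (eRR - eLeft))%ie sample_index.

Definition batch : cmd :=
  products ;;
  gen_inverse ;;
  For 0 (eRR * eR)%ie (RStore sHist vE ROne) ;;
  For 6 eMats sample_step.

Definition sample_prog : cmd :=
  For 7 ((ILoad Arg #0 + (eRR - #1)) / eRR)%ie batch.

(** * Memory layout: rows, blocks and offsets *)

Section Env.
Variables (R : realType) (W N r : nat) (n : nat -> nat) (u : nat -> nat -> nat -> R).
Implicit Types s : state R.

Definition row_offset (j : nat) : nat := \sum_(l < j) n l * r.

Lemma offS j : row_offset j.+1 = (row_offset j + n j * r)%N.
Proof. by rewrite /row_offset big_ord_recr. Qed.

Lemma off_le j : (j < N)%N -> (row_offset j + n j * r <= row_offset N)%N.
Proof.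
move=> jN; rewrite -offS /row_offset -(subnKC jN) -[X in (X <= _)%N]addn0.
by rewrite big_split_ord /= leq_add.
Qed.

Definition block_count (j : nat) : nat := maxn 1 (n j %/ r).

Definition block_height (j b : nat) : nat := if (block_count j <= b.+1)%N then (n j - b * r)%N else r.

Record env s : Prop := Env {
  env_N : ird s Inp 0 = N;
  env_r : ird s Inp 1 = r;
  env_n : forall j, (j < N)%N -> ird s Inp (2 + j) = n j;
  env_off : forall j, (j <= N)%N -> ird s (Data 0) j = row_offset j;
  env_lg : forall i, (i <= row_offset N)%N -> ird s (Data 1) i = trunc_log 2 i }.

Lemma env_eq s s' : imem s' Inp = imem s Inp -> imem s' (Data 0) = imem s (Data 0) ->
  imem s' (Data 1) = imem s (Data 1) -> env s -> env s'.
Proof.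
by move=> e1 e2 e3 [h1 h2 h3 h4 h5]; split; rewrite /ird ?e1 ?e2 ?e3.
Qed.

Lemma env_frame c s s' : frame c s s' -> spares [:: Inp; Data 0; Data 1] [::] c ->
  env s -> env s'.
Proof. by move=> [_ fw _ _ _] /andP [/and4P [h1 h2 h3 _] _]; apply: env_eq; exact: fw. Qed.

Definition rows_in s := forall j t c, (j < N)%N -> (t < n j)%N -> (c < r)%N ->
  rd s Inp (row_offset j + t * r + c) = u j t c.

Lemma rows_in_frame c s s' : frame c s s' -> Inp \notin wreals c -> rows_in s -> rows_in s'.
Proof.
by move=> fs h H j t k jN tn kr; rewrite (frame_rd fs h); exact: H.
Qed.

End Env.

(** * Construction and updates *)

Lemma node_in base q i i' e : (e < q)%N ->
  (base + i * q <= base + i' * q + e < base + i * q + q)%N = (i' == i).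
Proof.
move=> eq; case: (ltngtP i' i) => [lt|lt|->]; last by lia.
  have : (i'.+1 * q <= i * q)%N by rewrite leq_mul2r lt orbT.
  by rewrite mulSn; lia.
have : (i.+1 * q <= i' * q)%N by rewrite leq_mul2r lt orbT.
by rewrite mulSn; lia.
Qed.

Section Eval.
Variables (R : realType) (W : nat).
Implicit Types s : state R.

Lemma ieval_const s n : ieval s (IConst n) = n. Proof. by []. Qed.
Lemma ieval_reg s x : ieval s (IReg x) = reg s x. Proof. by []. Qed.
Lemma ieval_load s a e : ieval s (ILoad a e) = ird s a (ieval s e). Proof. by []. Qed.
Lemma ieval_add s e1 e2 : ieval s (IAdd e1 e2) = (ieval s e1 + ieval s e2)%N. Proof. by []. Qed.
Lemma ieval_sub s e1 e2 : ieval s (ISub e1 e2) = (ieval s e1 - ieval s e2)%N. Proof. by []. Qed.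
Lemma ieval_mul s e1 e2 : ieval s (IMul e1 e2) = (ieval s e1 * ieval s e2)%N. Proof. by []. Qed.
Lemma ieval_div s e1 e2 : ieval s (IDiv e1 e2) = (ieval s e1 %/ ieval s e2)%N. Proof. by []. Qed.
Lemma reval_zero s : reval s RZero = 0. Proof. by []. Qed.
Lemma reval_one s : reval s ROne = 1. Proof. by []. Qed.
Lemma reval_load s a e : reval s (RLoad a e) = rd s a (ieval s e). Proof. by []. Qed.
Lemma reval_add s e1 e2 : reval s (RAdd e1 e2) = reval s e1 + reval s e2. Proof. by []. Qed.
Lemma reval_sub s e1 e2 : reval s (RSub e1 e2) = reval s e1 - reval s e2. Proof. by []. Qed.
Lemma reval_mul s e1 e2 : reval s (RMul e1 e2) = reval s e1 * reval s e2. Proof. by []. Qed.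
Lemma reval_div s e1 e2 : reval s (RDiv e1 e2) = reval s e1 / reval s e2. Proof. by []. Qed.
Definition evalE := (ieval_const, ieval_reg, ieval_load, ieval_add, ieval_sub, ieval_mul,
  ieval_div, reval_zero, reval_one, reval_load, reval_add, reval_sub, reval_mul, reval_div).

Lemma reg_set_reg s x v y :
  reg (set_reg W s x v) y = if y == x then (v %% W)%N else reg s y.
Proof. by []. Qed.
Lemma ird_set_reg s x v a i : ird (set_reg W s x v) a i = ird s a i. Proof. by []. Qed.

End Eval.

Section Build.
Variables (R : realType) (W N r : nat) (n : nat -> nat) (u : nat -> nat -> nat -> R).
Implicit Types s : state R.
Hypothesis r0 : (0 < r)%N.
Hypothesis n0 : forall j, (j < N)%N -> (0 < n j)%N.
Local Notation off := (row_offset r n).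
Local Notation env := (env N r n).
Local Notation nblk := (block_count r n).
Local Notation bcnt := (block_height r n).
Hypothesis hW : (16 * (off N + r ^ 3) <= W)%N.

(** Apart from the counters that depend on the number of samples, the words that are stored are
    addresses, row numbers and node numbers. All of them are small multiples of [off N + r ^ 3], so
    the reduction modulo [W] never acts. *)
Lemma lt_W x : (x <= 8 * (off N + r ^ 3))%N -> (x < W)%N.
Proof.
move=> xs; apply: leq_ltn_trans xs _; apply: leq_trans hW.
have : (0 < r ^ 3)%N by rewrite expn_gt0 r0.
lia.
Qed.

Lemma rr_le : (r * r <= r ^ 3)%N.
Proof. by rewrite !expnS expn0 muln1 mulnA leq_pmulr. Qed.

Lemma r_le : (r <= r ^ 3)%N.
Proof. by apply: leq_trans rr_le; rewrite leq_pmulr. Qed.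

Lemma gram_rows_safe dst s D src cnt (row : nat -> nat -> R) :
  env s -> dst != Inp -> reg s 13 = D -> reg s 14 = src -> reg s 15 = cnt ->
  (cnt <= W)%N -> (D + r * r <= size (rmem s dst))%N ->
  (forall t c, (t < cnt)%N -> (c < r)%N -> rd s Inp (src + t * r + c) = row t c) ->
  safe W (gram_rows dst) s (100 * (r * r * cnt.+1)) (fun s' => forall k,
    rd s' dst k = if (D <= k < D + r * r)%N
      then \sum_(t < cnt) row t ((k - D) %/ r)%N * row t ((k - D) %% r)%N
      else rd s dst k).
Proof.
move=> es dI rD rs rc cW Ds rowE.
apply: safe_time.
  apply: (@safe_fill R W 0 _ _ s dst D (r * r)%N
    (fun e => \sum_(t < cnt) row t (e %/ r)%N * row t (e %% r)%N)).
  - by rewrite !evalE (env_r es).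
  - by apply/ltnW/lt_W; have := rr_le; lia.
  move=> e s1 er f1 s1e ks1.
  have e1 : env s1 by exact: (env_frame f1 isT es).
  apply: (safe_sum_into (i0 := (D + e)%N) (n := cnt)
    (F := fun t => row t (e %/ r)%N * row t (e %% r)%N)) => //.
  - by rewrite evalE (frame_reg f1).
  - by rewrite (frame_rsize _ f1); apply: leq_trans Ds; rewrite ltn_add2l.
  - by rewrite !evalE (frame_reg f1) // rD s1e.
  move=> t s2 tc f2 s2t ks2.
  have e2 : env s2 by exact: (env_frame f2 isT e1).
  rewrite !evalE !(env_r e2) s2t !(frame_reg f2) // s1e !(frame_reg f1) // rD rs.
  have rdI i : rd s2 Inp i = rd s Inp i.
    by rewrite (frame_rd f2) ?(frame_rd f1) //= !inE orbb eq_sym.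
  split=> //; rewrite !rdI !rowE //.
    congr (_ * row _ _); rewrite {1}(divn_eq e r); lia.
  - by rewrite {1}(divn_eq e r) addKn ltn_mod.
  - by rewrite ltn_divLR.
have q0 : (0 < r * r)%N by rewrite muln_gt0 r0.
by move: (r * r)%N q0 => q q0 /=; nia.
Qed.

Definition node (s : state R) a base i e : R := rd s a (base + i * (r * r) + e).

Definition heap (s : state R) a base B := forall i e,
  (0 < i < B)%N -> (e < r * r)%N ->
  node s a base i e = node s a base (2 * i)%N e + node s a base (2 * i + 1)%N e.

Lemma add_nodes_safe a s base B :
  env s -> reg s 11 = base -> reg s 12 = B -> (0 < B)%N -> (B < W)%N ->
  (base + 2 * B * (r * r) <= size (rmem s a))%N ->
  safe W (add_nodes a) s (100 * (B * (r * r))) (fun s' => heap s' a base B /\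
    forall k, ~~ (base + r * r <= k < base + B * (r * r))%N -> rd s' a k = rd s a k).
Proof.
move=> es rb rB B0 BW sz; have q0 : (0 < r * r)%N by rewrite muln_gt0 r0.
have qW : (r * r <= W)%N by apply/ltnW/lt_W; have := rr_le; lia.
have eB : ieval s (vBn - #1)%ie = B.-1 by rewrite !evalE rB subn1.
(* After [x] iterations the nodes from [B - x] to [B - 1] are final and everything else is
   untouched. *)
pose I x s' := (forall i e, (B - x <= i < B)%N -> (0 < i)%N -> (e < r * r)%N ->
      node s' a base i e = node s' a base (2 * i)%N e + node s' a base (2 * i + 1)%N e) /\
    forall k, ~~ (base + (B - x) * (r * r) <= k < base + B * (r * r))%N ->
      rd s' a k = rd s a k.
apply: safe_mono.
- apply: (@safe_loop R W 3 _ _ s B.-1 (fun=> 20 + r * r * 60)%N I) => //.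
  - by lia.
  - by split=> // i e iB; lia.
  move=> x s1 xB f1 s1x [Ih Ik].
  have e1 : env s1 by exact: (env_frame f1 isT es).
  set nd := (B - 1 - x)%N.
  apply: safe_time.
    apply: (safe_Seq_SetReg (v := nd)).
      by rewrite !evalE s1x !(frame_reg f1) // rB.
      by rewrite /nd; lia.
    move=> s2 f2 r2.
    have e2 : env s2 by exact: (env_frame f2 isT e1).
    have rd2 k : rd s2 a k = rd s1 a k by rewrite (frame_rd f2).
    have b2 : reg s2 11 = base by rewrite (frame_reg f2) // (frame_reg f1).
    apply: safe_post.
      apply: (@safe_fill R W 0 _ _ s2 a (base + nd * (r * r))%N (r * r)%N
        (fun e => node s2 a base (2 * nd)%N e + node s2 a base (2 * nd + 1)%N e)) => //.
        by rewrite !evalE (env_r e2).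
      move=> e s3 er f3 s3e k3.
      have e3 : env s3 by exact: (env_frame f3 isT e2).
      have ev : ieval s3 (vBase + vNode * eRR + vE)%ie = (base + nd * (r * r) + e)%N.
        by rewrite !evalE (env_r e3) s3e !(frame_reg f3) // b2 r2.
      apply: safe_RStore; rewrite ev; split.
        rewrite rd_set_rmem !eqxx !andTb (frame_rsize _ f3) ifT; last first.
          rewrite (frame_rsize _ f2) (frame_rsize _ f1); apply: leq_trans sz.
          have : (nd < B)%N by rewrite /nd; lia.
          by nia.
        rewrite !evalE (env_r e3) s3e !(frame_reg f3) // b2 r2 /node.
        rewrite !k3 !ifF //; apply/negP; have nd0: (0 < nd)%N by rewrite /nd; lia.
          by nia.
        by nia.
      by move=> k kn; rewrite rd_set_rmem (negbTE kn) andbF.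
    move=> s3 k3; rewrite /I.
    have ndB : (B - x.+1 = nd)%N by rewrite /nd; lia.
    have nd0: (0 < nd)%N by rewrite /nd; lia.
    rewrite ndB; split.
      move=> i e iB i0 er.
      have far m : (nd < m)%N -> node s3 a base m e = node s1 a base m e.
        move=> ndm; rewrite /node k3 rd2 ifF //; apply/negP; nia.
      have [->|ni] := eqVneq i nd.
        rewrite (far (2 * nd)%N) ?(far (2 * nd + 1)%N); try lia; rewrite /node k3 ifT; last by nia.
        by rewrite addnC addnK /node !rd2.
      rewrite (far i) ?(far (2 * i)%N) ?(far (2 * i + 1)%N); try lia.
      by apply: Ih => //; rewrite /nd in ni iB *; lia.
    move=> k kn; rewrite k3 ifF; last by apply/negP; nia.
    by rewrite rd2; apply: Ik; apply: contra kn; rewrite /nd; nia.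
  by rewrite /=; lia.
- rewrite sum_nat_const card_ord /=.
  by move: (r * r)%N q0 => q q1; nia.
move=> s' [Ih Ik]; split.
  by move=> i e iB er; apply: Ih => //; lia.
by move=> k kn; apply: Ik; rewrite (_ : B - B.-1 = 1)%N ?mul1n; last lia.
Qed.

End Build.

(** * Heaps of Gram matrices *)

Section Trees.
Variables (R : realType) (W N r : nat) (n : nat -> nat) (u : nat -> nat -> nat -> R).
Implicit Types s : state R.
Hypothesis r0 : (0 < r)%N.
Hypothesis n0 : forall j, (j < N)%N -> (0 < n j)%N.
Local Notation off := (row_offset r n).
Local Notation env := (env N r n).
Local Notation nblk := (block_count r n).
Local Notation bcnt := (block_height r n).
Lemma nblk_gt0 j : (0 < nblk j)%N.
Proof. by rewrite /block_count leq_maxl. Qed.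

(** A block other than the last has r rows, and the last one gains a remainder below r. The factor 2
    enters the cost of a scan and of a leaf. *)
Lemma bcnt_le j b : (b < nblk j)%N -> (b * r + bcnt j b <= n j)%N /\ (bcnt j b <= 2 * r)%N.
Proof.
rewrite /block_height /block_count => bn.
have := divn_eq (n j) r; have := ltn_mod (n j) r; rewrite r0.
move: (n j %/ r)%N (n j %% r)%N bn => [|q] m bn mr ->.
  have -> : b = 0%N by lia.
  by rewrite /=; split; lia.
rewrite (maxn_idPr _) // in bn *.
case: leqP => bq; last first.
  have -> : b = q by lia.
  by rewrite mulSn; split; lia.
have : (b.+2 * r <= q.+1 * r)%N by rewrite leq_mul2r; lia.
by rewrite !mulSn; split; lia.
Qed.

Lemma nblk_off j : (j < N)%N -> (nblk j <= off N)%N.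
Proof.
move=> jN; apply: leq_trans (off_le r n jN); rewrite /block_count geq_max.
have h1 : (n j <= n j * r)%N by rewrite leq_pmulr.
apply/andP; split; first by have := n0 jN; lia.
by apply: leq_trans (leq_div _ _) _; lia.
Qed.

Lemma nblk_big j : (r <= n j)%N -> (nblk j * r <= n j)%N.
Proof.
move=> rn; rewrite /block_count (maxn_idPr _) ?leq_trunc_div //.
by rewrite divn_gt0.
Qed.

Definition leaf_gram j b e : R :=
  \sum_(t < bcnt j b) u j (b * r + t)%N (e %/ r)%N * u j (b * r + t)%N (e %% r)%N.

(** Nothing is claimed of a matrix with fewer than r rows: no heap is stored for it. *)
Definition tree_ok s j := (r <= n j)%N ->
  (forall b e, (b < nblk j)%N -> (e < r * r)%N ->
     node r s (Data 0) (2 * off j) (nblk j + b) e = leaf_gram j b e) /\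
  heap r s (Data 0) (2 * off j) (nblk j).

(** There are 2 * [nblk j] nodes of r * r cells and [nblk j * r <= n j]; hence heaps of different
    matrices do not overlap. *)
Lemma tree_bound j i e : (r <= n j)%N -> (i < 2 * nblk j)%N -> (e < r * r)%N ->
  (2 * off j + i * (r * r) + e < 2 * off j.+1)%N.
Proof.
move=> rn iB er; rewrite offS; have := nblk_big rn => h.
by have : (i.+1 * (r * r) <= 2 * n j * r)%N; nia.
Qed.

Lemma tree_ok_eq s s' j :
  (forall k, (2 * off j <= k < 2 * off j.+1)%N -> rd s' (Data 0) k = rd s (Data 0) k) ->
  tree_ok s j -> tree_ok s' j.
Proof.
move=> eqk H rn; have [H1 H2] := H rn.
have eqn i e : (i < 2 * nblk j)%N -> (e < r * r)%N ->
    node r s' (Data 0) (2 * off j) i e = node r s (Data 0) (2 * off j) i e.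
  by move=> iB er; rewrite /node eqk //; have := tree_bound rn iB er; lia.
split=> [b e bB er|i e iB er]; first by rewrite eqn ?H1 //; lia.
have [i1 i2 i3] : [/\ i < 2 * nblk j, 2 * i < 2 * nblk j & 2 * i + 1 < 2 * nblk j]%N.
  by split; lia.
by rewrite (eqn i) // (eqn (2 * i)%N) // (eqn (2 * i + 1)%N) //; apply: H2.
Qed.

Lemma eval_blocks s j : env s -> reg s 2 = j -> (j < N)%N ->
  ieval s (eBlocks vJ) = nblk j.
Proof.
move=> es rj jN; rewrite /eBlocks !evalE rj (env_n es jN) (env_r es) /block_count.
by rewrite maxnE; lia.
Qed.

Hypothesis hW : (16 * (off N + r ^ 3) <= W)%N.

Lemma block_size_safe s j x b : env s -> reg s 2 = j -> (j < N)%N ->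
  reg s 12 = nblk j -> reg s x = b -> (b < nblk j)%N ->
  safe W (block_size (IReg x)) s 50 (fun s' => reg s' 15 = bcnt j b).
Proof.
move=> es rj jN rB rx bB; have [b1 b2] := bcnt_le bB; have := off_le r n jN => h3.
have bW : (bcnt j b < W)%N by apply: (lt_W r0 hW); nia.
have rW : (r < W)%N by apply: (lt_W r0 hW); have := r_le r0; nia.
have nE : (n j - b * r < W)%N by apply: (lt_W r0 hW); nia.
apply: safe_time.
  apply: safe_IfI => cmp; apply: safe_SetReg; rewrite reg_set_reg eqxx.
    rewrite !evalE rj rx (env_n es jN) (env_r es) modn_small // /block_height.
    by rewrite ifT //; rewrite !evalE rB rx addn1 in cmp.
  rewrite !evalE (env_r es) modn_small // /block_height ifF //.
  by rewrite !evalE rB rx addn1 in cmp; apply/negbTE; rewrite -ltnNge.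
by [].
Qed.

Lemma build_tree_safe s j : env s -> rows_in N r n u s -> reg s 2 = j -> (j < N)%N ->
  (2 * off N <= size (rmem s (Data 0)))%N ->
  safe W build_tree s (1500 * (n j * r ^ 2)) (fun s' => tree_ok s' j /\
    forall k, ~~ (2 * off j <= k < 2 * off j.+1)%N -> rd s' (Data 0) k = rd s (Data 0) k).
Proof.
move=> es us rj jN sz; have q0 : (0 < r * r)%N by rewrite muln_gt0 r0.
have oN := off_le r n jN; have nj0 := n0 jN.
have BN := nblk_off jN; have B0 := nblk_gt0 j.
have t0 : (0 < n j * r ^ 2)%N by rewrite muln_gt0 nj0 expn_gt0 r0.
have [rn|rn] := leqP r (n j); last first.
  apply: safe_time.
    apply: safe_IfI_else; first by rewrite !evalE (env_r es) rj (env_n es jN).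
    by apply: safe_Skip; split=> // rn'; lia.
  by rewrite /=; lia.
apply: safe_time.
  apply: safe_IfI_then; first by rewrite !evalE (env_r es) rj (env_n es jN).
  have BR := nblk_big rn.
  have BR2 : (nblk j * (r * r) <= n j * r)%N by nia.
  have nN : (n j <= off N)%N by apply: leq_trans oN; have := leq_pmulr (n j) r0; lia.
  have rN : (r <= off N)%N by lia.
  apply: (safe_Seq_SetReg (v := 2 * off j)).
  + by rewrite !evalE rj (env_off es) // ltnW.
  + by apply: (lt_W r0 hW); lia.
  move=> s1 f1 b1; have e1 := env_frame f1 isT es.
  have j1 : reg s1 2 = j by rewrite (frame_reg f1).
  apply: (safe_Seq_SetReg (v := nblk j)).
  + exact: eval_blocks.
  + by apply: (lt_W r0 hW); lia.
  move=> s2 f2 B2; have e2 := env_frame f2 isT e1.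
  have j2 : reg s2 2 = j by rewrite (frame_reg f2).
  have b2 : reg s2 11 = (2 * off j)%N by rewrite (frame_reg f2).
  have u2 : rows_in N r n u s2.
    exact: (rows_in_frame f2 isT (rows_in_frame f1 isT us)).
  have rd2 k : rd s2 (Data 0) k = rd s (Data 0) k by rewrite (frame_rd f2) // (frame_rd f1).
  have sz2 : (2 * off N <= size (rmem s2 (Data 0)))%N.
    by rewrite (frame_rsize _ f2) (frame_rsize _ f1).
  pose I x s' := (forall b e, (b < x)%N -> (e < r * r)%N ->
        node r s' (Data 0) (2 * off j) (nblk j + b) e = leaf_gram j b e) /\
     forall k, ~~ (2 * off j <= k < 2 * off j.+1)%N -> rd s' (Data 0) k = rd s2 (Data 0) k.
  apply: (safe_Seq (Q1 := I (nblk j))).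
    apply: (@safe_loop R W 3 _ _ s2 (nblk j) (fun=> 400 * (r * r * r))%N I).
    + by rewrite evalE.
    + by apply/ltnW/(lt_W r0 hW); lia.
    + by [].
    + by [].
    move=> b s3 bB f3 s3b [Ih Ik]; have [c1 c2] := bcnt_le bB.
    have e3 := env_frame f3 isT e2.
    have j3 : reg s3 2 = j by rewrite (frame_reg f3).
    have bq : (b.+1 * (r * r) <= nblk j * (r * r))%N by rewrite leq_mul2r bB orbT.
    have nd : (2 * off j + (nblk j + b) * (r * r) + r * r <= 2 * off j.+1)%N.
      by rewrite offS mulnDl; rewrite mulSn in bq; lia.
    have off1 : (off j.+1 <= off N)%N by rewrite offS.
    apply: safe_time.
      apply: (safe_Seq_SetReg (v := (2 * off j + (nblk j + b) * (r * r))%N)).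
      * by rewrite !evalE s3b !(frame_reg f3) // b2 B2 (env_r e3).
      * by apply: (lt_W r0 hW); lia.
      move=> s4 f4 d4; have e4 := env_frame f4 isT e3.
      have j4 : reg s4 2 = j by rewrite (frame_reg f4).
      apply: (safe_Seq_SetReg (v := (off j + b * (r * r))%N)).
      * by rewrite !evalE j4 (env_off e4) 1?ltnW // (frame_reg f4) // s3b (env_r e4).
      * by apply: (lt_W r0 hW); rewrite mulSn in bq; lia.
      move=> s5 f5 c5; have e5 := env_frame f5 isT e4.
      have j5 : reg s5 2 = j by rewrite (frame_reg f5).
      apply: (safe_Seq).
        apply: (@block_size_safe s5 j 3 b) => //.
          by rewrite (frame_reg f5) // (frame_reg f4) // (frame_reg f3).
        by rewrite (frame_reg f5) // (frame_reg f4).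
      move=> s6 c6 f6; have e6 := env_frame f6 isT e5.
      have rd6 k : rd s6 (Data 0) k = rd s3 (Data 0) k.
        by rewrite (frame_rd f6) // (frame_rd f5) // (frame_rd f4).
      apply: safe_post.
        apply: (@gram_rows_safe R W N r n r0 hW (Data 0) s6 (2 * off j + (nblk j + b) * (r * r))%N
          (off j + b * (r * r))%N (bcnt j b) (fun t c => u j (b * r + t)%N c)) => //.
        * by rewrite (frame_reg f6) // (frame_reg f5).
        * by rewrite (frame_reg f6).
        * by apply/ltnW/(lt_W r0 hW); lia.
        * rewrite (frame_rsize _ f6) (frame_rsize _ f5) (frame_rsize _ f4) (frame_rsize _ f3).
          by apply: leq_trans sz2; lia.
        * move=> t c tc cr.
          have -> : rd s6 Inp (off j + b * (r * r) + t * r + c) =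
                    rd s2 Inp (off j + (b * r + t) * r + c).
            rewrite (frame_rd f6) // (frame_rd f5) // (frame_rd f4) // (frame_rd f3) //.
            by congr rd; rewrite mulnDl mulnA; lia.
          by apply: u2 => //; lia.
      move=> s7 k7; split.
        move=> b' e b'B er; rewrite /node k7 node_in // eqn_add2l; case: eqP => [->|bb'].
          by rewrite addKn.
        by rewrite rd6; apply: Ih => //; lia.
      move=> k kn; rewrite k7 ifF ?rd6; first exact: Ik.
      by apply/negP; move: kn nd; rewrite mulnDl; lia.
    rewrite /=; have : (0 < r * r * r)%N by rewrite !muln_gt0 r0.
    have : (r * r * (bcnt j b).+1 <= r * r * (3 * r))%N by rewrite leq_mul2l; lia.
    by lia.
  move=> s3 [Ih Ik] f3; have e3 := env_frame f3 isT e2.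
  apply: safe_post.
    apply: (@add_nodes_safe R W N r n r0 hW (Data 0) s3 (2 * off j)%N (nblk j)) => //.
    + by rewrite (frame_reg f3).
    + by rewrite (frame_reg f3).
    + by apply: (lt_W r0 hW); lia.
    + by rewrite (frame_rsize _ f3); apply: leq_trans sz2; lia.
  move=> s4 [Hh Hk]; split.
    move=> _; split=> // b e bB er; rewrite -Ih // /node Hk //.
    by rewrite mulnDl; lia.
  by move=> k kn; rewrite Hk ?Ik ?rd2 //; apply: contra kn; rewrite offS; lia.
(* Each block costs O(r^3) because it has at most 2r rows, and [nblk j * r <= n j] turns the sum
   over the blocks into O(n_j r^2). *)
rewrite sum_nat_const card_ord /=; have -> : (r ^ 2 = r * r)%N by [].
have BR : (nblk j * (r * r * r) <= n j * (r * r))%N.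
  by have := nblk_big rn; nia.
rewrite (_ : r ^ 2 = r * r)%N // in t0.
have : (nblk j <= n j * (r * r))%N by have := nblk_big rn; nia.
have : (nblk j * (r * r) <= n j * (r * r))%N by have := nblk_big rn; nia.
by move: BR t0; nia.
Qed.

End Trees.

Lemma ird_set_imem (R : realType) W (s : state R) a i v b j : ird (set_imem W s a i v) b j =
  if [&& b == a, j == i & (i < size (imem s a))%N] then (v %% W)%N else ird s b j.
Proof.
rewrite /ird /= -/(b == a); case: eqP => [->|] //=; exact: nth_write.
Qed.

(** * Building everything and replacing one matrix *)

Section Construction.
Variables (R : realType) (W N r : nat) (n : nat -> nat) (u : nat -> nat -> nat -> R).
Implicit Types s : state R.
Hypothesis r0 : (0 < r)%N.
Hypothesis n0 : forall j, (j < N)%N -> (0 < n j)%N.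
Local Notation off := (row_offset r n).
Local Notation env := (env N r n).
Local Notation nblk := (block_count r n).
Local Notation bcnt := (block_height r n).
Lemma off_geN k : (k <= N)%N -> (k <= off k)%N.
Proof.
elim: k => // k IH kN; rewrite offS; have := IH (ltnW kN).
by have := n0 kN; have := leq_pmulr (n k) r0; lia.
Qed.

Lemma off_mono k : (k <= N)%N -> (off k <= off N)%N.
Proof.
move=> kN; rewrite /row_offset -(subnKC kN) -[X in (X <= _)%N]addn0.
by rewrite big_split_ord /= leq_add.
Qed.

Definition header s := [/\ ird s Inp 0 = N, ird s Inp 1 = r &
  forall j, (j < N)%N -> ird s Inp (2 + j) = n j].

Lemma header_frame c s s' : frame c s s' -> Inp \notin wwords c -> header s -> header s'.
Proof.
move=> f nc [h1 h2 h3]; split; rewrite ?(frame_ird f) // => j jN.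
by rewrite (frame_ird f) // h3.
Qed.

Lemma tree_ok_ext (u' : nat -> nat -> nat -> R) s j :
  (forall t c, (t < n j)%N -> (c < r)%N -> u j t c = u' j t c) ->
  tree_ok r n u s j -> tree_ok r n u' s j.
Proof.
move=> uu H rn; have [H1 H2] := H rn; split=> // b e bB er.
rewrite H1 // /leaf_gram; apply: eq_bigr => t _; have [b1 _] := bcnt_le r0 bB.
have tn : (b * r + t < n j)%N by have := ltn_ord t; lia.
by rewrite !uu // ?ltn_mod // ltn_divLR.
Qed.

(** Addresses are mixed radix numerals: the matrices occupy disjoint intervals, and division by r
    separates row from column. A store to one entry therefore changes no other entry. *)
Lemma row_index_inj j t c j' t' c' : (j < N)%N -> (j' < N)%N -> (t < n j)%N -> (t' < n j')%N ->
  (c < r)%N -> (c' < r)%N ->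
  (off j + t * r + c == off j' + t' * r + c')%N = [&& j == j', t == t' & c == c'].
Proof.
move=> jN jN' tn tn' cr cr'.
have lt k l : (k < l)%N -> (off k + n k * r <= off l)%N.
  move=> kl; rewrite -offS /row_offset -(subnKC kl) big_split_ord /=; exact: leq_addr.
have in_ k t0 : (t0 < n k)%N -> (t0 * r + r <= n k * r)%N.
  by move=> tk; rewrite addnC -mulSn leq_mul2r tk orbT.
have := in_ _ _ tn; have := in_ _ _ tn'.
case: (ltngtP j j') => [/lt|/lt|->] /=; [by lia|by lia|] => i1 i2.
rewrite -!addnA eqn_add2l; apply/eqP/andP => [eq_|[/eqP -> /eqP ->] //].
have := congr1 (divn^~ r) eq_; have := congr1 (modn^~ r) eq_.
by rewrite !modnMDl !divnMDl // !modn_small // !divn_small // !addn0 => -> ->; rewrite !eqxx.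
Qed.

Hypothesis hW : (16 * (off N + r ^ 3) <= W)%N.

Lemma build_prog_safe s : (0 < N)%N -> header s -> rows_in N r n u s ->
  (2 * off N <= size (imem s (Data 0)))%N -> (2 * off N <= size (imem s (Data 1)))%N ->
  (2 * off N <= size (rmem s (Data 0)))%N ->
  safe W build_prog s (2000 * \sum_(j < N) n j * r ^ 2) (fun s' =>
    env s' /\ forall j, (j < N)%N -> tree_ok r n u s' j).
Proof.
move=> N0 hs us sz0 sz1 szr.
have offN1 : (N <= off N)%N := off_geN (leqnn N).
have TN : (off N <= \sum_(j < N) n j * r ^ 2)%N.
  rewrite /row_offset; apply: leq_sum => j _; rewrite leq_mul2l expnS expn1 leq_pmulr ?orbT //.
have NW : (N < W)%N by apply: (lt_W r0 hW); lia.
apply: safe_time.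
  apply: (safe_Seq (Q1 := fun s' => ird s' (Data 0) 0 = 0%N)).
    apply: safe_IStore; rewrite ird_set_imem !evalE !eqxx !andTb ifT ?mod0n //.
    by lia.
  move=> s1 z1 f1; have h1 := header_frame f1 isT hs.
  have [a1 b1 c1] := h1.
  apply: (safe_Seq (Q1 := fun s' => forall j, (j <= N)%N -> ird s' (Data 0) j = off j)).
    apply: (@safe_loop R W 2 _ _ s1 N (fun=> 20)%N
      (fun x s' => forall j, (j <= x)%N -> ird s' (Data 0) j = off j)).
    - by rewrite evalE.
    - exact: ltnW.
    - by move=> j; rewrite leqn0 => /eqP ->; rewrite z1 /row_offset big_ord0.
    - by [].
    move=> x s2 xN f2 x2 I2; have [a2 b2 c2] := header_frame f2 isT h1.
    apply: safe_time.
      apply: safe_IStore => j jx; rewrite ird_set_imem !evalE x2 I2 // b2 c2 // eqxx andTb.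
      rewrite -offS (fr_wsize f2) (fr_wsize f1) addn1.
      have [->|jx'] := eqVneq j x.+1.
        rewrite ifT; last by lia.
        by rewrite modn_small //; apply: (lt_W r0 hW); have := off_mono xN; lia.
      by rewrite I2 //; lia.
    by [].
  move=> s2 I2 f2; have h2 := header_frame f2 isT h1; have [a2 b2 c2] := h2.
  apply: (safe_Seq (Q1 := fun s' => forall i, (i < (off N).+1)%N -> ird s' (Data 1) i = trunc_log 2 i)).
    apply: (@safe_loop R W 3 _ _ s2 (off N).+1 (fun=> 20)%N
      (fun x s' => forall i, (i < x)%N -> ird s' (Data 1) i = trunc_log 2 i)).
    - by rewrite !evalE a2 I2 // addn1.
    - by apply: (lt_W r0 hW); lia.
    - by [].
    - by [].
    move=> x s3 xN f3 x3 I3.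
    have sz3 : (x < size (imem s3 (Data 1)))%N.
      by rewrite (fr_wsize f3) (fr_wsize f2) (fr_wsize f1); lia.
    apply: safe_time.
      apply: safe_IfI; rewrite !evalE x3 => x1; apply: safe_IStore => i ix;
        rewrite ird_set_imem !evalE x3 eqxx andTb sz3 andbT.
        have [->|ix'] := eqVneq i x; last by apply: I3; lia.
        by rewrite mod0n; case: x x1 {xN x3 I3 ix sz3} => [|[|x]].
      have [->|ix'] := eqVneq i x; last by apply: I3; lia.
      rewrite I3; last by apply: ltn_Pdiv => //; lia.
      rewrite addn1 divn2 -trunc_log2S // modn_small //.
      apply: (lt_W r0 hW); have := trunc_logP (isT : 1 < 2)%N (ltnW x1).
      by have := ltn_expl (trunc_log 2 x) (isT : 1 < 2)%N; lia.
    by [].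
  move=> s3 I3 f3; have [a3 b3 c3] := header_frame f3 isT h2.
  have e3 : env s3 by split=> // j jN; rewrite (frame_ird f3) // I2.
  have u3 : rows_in N r n u s3.
    exact: (rows_in_frame f3 isT (rows_in_frame f2 isT (rows_in_frame f1 isT us))).
  have sz3 : (2 * off N <= size (rmem s3 (Data 0)))%N.
    by rewrite (frame_rsize _ f3) (frame_rsize _ f2) (frame_rsize _ f1).
  apply: safe_post; first apply: safe_frame.
    apply: (@safe_loop R W 2 _ _ s3 N (fun j => 1500 * (n j * r ^ 2))%N
      (fun x s' => forall j, (j < x)%N -> tree_ok r n u s' j)).
    - by rewrite evalE.
    - exact: ltnW.
    - by [].
    - by move=> i s' v H j ji; apply: tree_ok_eq (H j ji).
    move=> x s4 xN f4 x4 I4; have e4 := env_frame f4 isT e3.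
    apply: safe_post.
      apply: (build_tree_safe (u := u) (N := N) (n := n) (r := r)) => //.
        exact: (rows_in_frame f4 isT u3).
      by rewrite (frame_rsize _ f4).
    move=> s5 [t5 k5] j jx; have [->//|jx'] := eqVneq j x.
    have jlt : (j < x)%N by lia.
    apply: tree_ok_eq (I4 j jlt) => //.
    move=> k kj; apply: k5; apply/negP => kx.
    have : (off j.+1 <= off x)%N.
      rewrite /row_offset -(subnKC jlt) big_split_ord /=; exact: leq_addr.
    by lia.
  move=> s4 [I4 f4]; split=> //; exact: env_frame f4 isT e3.
set Tot := (\sum_(j < N) n j * r ^ 2)%N.
have -> : (\sum_(i < N) (1500 * (n i * r ^ 2)).+1 = 1500 * Tot + N)%N.
  rewrite /Tot big_distrr /= -[X in (_ + X)%N]card_ord -sum1_card -big_split /=.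
  by apply: eq_bigr => i _; rewrite addn1.
rewrite !sum_nat_const !card_ord /= -/Tot in TN *; lia.
Qed.

Definition set_matrix j (v : nat -> nat -> R) : nat -> nat -> nat -> R :=
  fun j' t c => if j' == j then v t c else u j' t c.

Lemma update_matrix_safe s j v : env s -> (j < N)%N -> ird s Arg 0 = j ->
  rows_in N r n u s -> (forall i, (i < N)%N -> tree_ok r n u s i) ->
  (forall t c, (t < n j)%N -> (c < r)%N -> rd s Arg (t * r + c) = v t c) ->
  (2 * off N <= size (rmem s (Data 0)))%N -> (off N <= size (rmem s Inp))%N ->
  safe W update_matrix_prog s (2000 * (n j * r ^ 2)) (fun s' =>
    (forall i, (i < N)%N -> tree_ok r n (set_matrix j v) s' i) /\
    forall k, rd s' Inp k =
      if (off j <= k < off j + n j * r)%N then rd s Arg (k - off j) else rd s Inp k).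
Proof.
move=> es jN aj us ts av sz szi; have nj0 := n0 jN; have oj := off_le r n jN.
have offN1 : (N <= off N)%N := off_geN (leqnn N).
apply: safe_time.
  apply: (safe_Seq_SetReg (v := j)).
  - by rewrite !evalE.
  - by apply: (lt_W r0 hW); lia.
  move=> s1 f1 j1; have e1 := env_frame f1 isT es.
  have rd1 a k : rd s1 a k = rd s a k by rewrite (frame_rd f1).
  apply: (safe_Seq (Q1 := fun s' => forall k, rd s' Inp k =
      if (off j <= k < off j + n j * r)%N then rd s Arg (k - off j) else rd s1 Inp k)).
    apply: (@safe_fill R W 0 _ _ s1 Inp (off j) (n j * r)%N (fun k => rd s Arg k)).
    - by rewrite !evalE j1 (env_n e1) // (env_r e1).
    - by apply/ltnW/(lt_W r0 hW); lia.
    move=> k s2 kn f2 k2 I2; have e2 := env_frame f2 isT e1.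
    apply: safe_RStore.
    have -> : ieval s2 (eOff vJ + vE)%ie = (off j + k)%N.
      by rewrite !evalE (frame_reg f2) // j1 k2 (env_off e2) // ltnW.
    split.
      rewrite rd_set_rmem !eqxx !andTb (frame_rsize _ f2) (frame_rsize _ f1) ifT; last by lia.
      by rewrite !evalE k2 (frame_rd f2) // rd1.
    by move=> l kl; rewrite rd_set_rmem (negbTE kl) andbF.
  move=> s2 k2 f2; have e2 := env_frame f2 isT e1.
  have u2 : rows_in N r n (set_matrix j v) s2.
    move=> i t c iN tn cr; rewrite k2 /set_matrix.
    have ti : (t * r + r <= n i * r)%N by rewrite addnC -mulSn leq_mul2r tn orbT.
    have [ij|ij] := eqVneq i j.
      rewrite ij in tn ti *; rewrite ifT; last by lia.
      by rewrite -addnA addKn av.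
    rewrite ifF; first by rewrite rd1 us.
    have lt i1 l : (i1 < l)%N -> (off i1 + n i1 * r <= off l)%N.
      move=> kl; rewrite -offS /row_offset -(subnKC kl) big_split_ord /=; exact: leq_addr.
    by apply/negP; case: (ltngtP i j) ij => // /lt; lia.
  apply: safe_post; first apply: safe_frame.
    apply: (@build_tree_safe R W N r n (set_matrix j v) r0 n0 hW s2 j) => //.
      by rewrite (frame_reg f2).
    by rewrite (frame_rsize _ f2) (frame_rsize _ f1).
  move=> s3 [[t3 k3] f3]; split; last first.
    by move=> k; rewrite (frame_rd f3) // k2 rd1.
  move=> i iN; have [->//|ij] := eqVneq i j.
  apply: (tree_ok_eq r0 (s := s)).
    move=> k ki; rewrite k3 ?(frame_rd f2) ?rd1 //; apply/negP => kj.
    have lt i1 l : (i1 < l)%N -> (off i1.+1 <= off l)%N.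
      move=> kl; rewrite /row_offset -(subnKC kl) big_split_ord /=; exact: leq_addr.
    by case: (ltngtP i j) ij => // /lt; lia.
  by apply: tree_ok_ext (ts i iN) => t c _ _; rewrite /set_matrix (negbTE ij).
rewrite /=; have : (0 < n j * r)%N by rewrite muln_gt0 nj0.
have : (n j * r <= n j * r ^ 2)%N by rewrite leq_mul2l expnS expn1 leq_pmulr ?orbT.
lia.
Qed.

End Construction.

(** In this additive form two successive increments compose without asking whether they hit the same
    cell, as they do on the diagonal. *)
Lemma rd_set_rmem_add (R : realType) (s : state R) a i v b j :
  rd (set_rmem s a i (rd s a i + v)) b j =
  rd s b j + (if [&& b == a, j == i & (i < size (rmem s a))%N] then v else 0).
Proof.
rewrite rd_set_rmem; case: (b =P a) => [->|] /=; last by rewrite addr0.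
case: (j =P i) => [->|] /=; last by rewrite addr0.
by case: ifP => // _; rewrite addr0.
Qed.

Lemma eq_divmod r a b e : (b < r)%N -> (e == a * r + b)%N = (e %/ r == a)%N && (e %% r == b)%N.
Proof.
move=> br; apply/eqP/andP => [->|[/eqP <- /eqP <-]]; last exact: divn_eq.
by rewrite divnMDl ?modnMDl ?(leq_ltn_trans _ br) // divn_small // modn_small // addn0 !eqxx.
Qed.

(** * Replacing one entry *)

Section UpdateEntry.
Variables (R : realType) (W N r : nat) (n : nat -> nat) (u : nat -> nat -> nat -> R).
Implicit Types s : state R.
Hypothesis r0 : (0 < r)%N.
Hypothesis n0 : forall j, (j < N)%N -> (0 < n j)%N.
Local Notation off := (row_offset r n).
Local Notation env := (env N r n).
Local Notation nblk := (block_count r n).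
Local Notation bcnt := (block_height r n).

(* The change of the Gram matrix x x^T when [d] is added to entry [c] of x. *)
Definition gram_delta (x : nat -> R) c d e : R :=
  (if (e %% r == c)%N then d * x (e %/ r)%N else 0) +
  (if (e %/ r == c)%N then d * x (e %% r)%N else 0) +
  (if (e %/ r == c)%N && (e %% r == c)%N then d * d else 0).

Lemma gram_deltaE (x y : nat -> R) c d e :
  (forall a, y a = x a + (if a == c then d else 0)) ->
  y (e %/ r)%N * y (e %% r)%N = x (e %/ r)%N * x (e %% r)%N + gram_delta x c d e.
Proof.
move=> yE; rewrite !yE /gram_delta.
by case: (e %/ r =P c)%N => [->|_]; case: (e %% r =P c)%N => [->|_] /=; ring.
Qed.

Definition set_entry_nat j i c x : nat -> nat -> nat -> R :=
  fun j' t c' => if [&& j' == j, t == i & c' == c] then x else u j' t c'.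

(** The minimum sends the rows of the remainder to the last block. *)
Definition block_of j i := minn (i %/ r) (nblk j).-1.

Lemma block_ofP j i : (i < n j)%N ->
  [/\ block_of j i < nblk j, block_of j i * r <= i & i < block_of j i * r + bcnt j (block_of j i)]%N.
Proof.
move=> ij; have B0 := nblk_gt0 r n j; rewrite /block_of /block_height.
have dE := divn_eq i r; have mE : (i %% r < r)%N by rewrite ltn_mod.
have bi : (minn (i %/ r) (nblk j).-1 <= i %/ r)%N by rewrite geq_minl.
have bB : (minn (i %/ r) (nblk j).-1 < nblk j)%N by rewrite (leq_ltn_trans (geq_minr _ _)) // prednK.
have le1 : (minn (i %/ r) (nblk j).-1 * r <= i %/ r * r)%N by rewrite leq_mul2r bi orbT.
split=> //; first by lia.
case: ifP => cmp; first by lia.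
have -> : minn (i %/ r) (nblk j).-1 = (i %/ r)%N by lia.
by lia.
Qed.

Lemma block_of_uniq j i b : (i < n j)%N -> (b < nblk j)%N ->
  (b * r <= i < b * r + bcnt j b)%N -> b = block_of j i.
Proof.
move=> ij bB; have [] := block_ofP ij; set b' := block_of j i => b'B h1 h2 /andP [h3 h4].
(* A block that is followed by another one has exactly r rows, so it ends where the next begins. *)
have side c c' : (c < c')%N -> (c' < nblk j)%N -> (c' * r <= i)%N ->
    (i < c * r + bcnt j c)%N -> False.
  move=> cc' c'B i1 i2; move: i2; rewrite /block_height ifF; last by apply/negP; lia.
  have : (c.+1 * r <= c' * r)%N by rewrite leq_mul2r cc' orbT.
  by rewrite mulSn; lia.
case: (ltngtP b b') => // lt; exfalso; [exact: (side b b')|exact: (side b' b)].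
Qed.

(** The changed row lies in exactly one block, so one leaf receives the correction and the others
    keep their value. *)
Lemma leaf_gram_set j i c x b e : (i < n j)%N -> (b < nblk j)%N -> (e < r * r)%N ->
  leaf_gram r n (set_entry_nat j i c x) j b e =
  leaf_gram r n u j b e +
  (if b == block_of j i then gram_delta (u j i) c (x - u j i c) e else 0).
Proof.
move=> ij bB er; rewrite /leaf_gram.
pose F t := u j t (e %/ r)%N * u j t (e %% r)%N.
pose D := gram_delta (u j i) c (x - u j i c) e.
have step t : set_entry_nat j i c x j t (e %/ r)%N * set_entry_nat j i c x j t (e %% r)%N
    = F t + (if t == i then D else 0).
  rewrite /set_entry_nat eqxx /=; have [->|ti] := eqVneq t i; last by rewrite /= addr0.
  rewrite /= (gram_deltaE (x := u j i) (c := c) (d := x - u j i c)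
     (y := fun a => if a == c then x else u j i a)) // => a.
  by case: eqP => [->|_]; rewrite ?addr0 // addrC subrK.
transitivity (\sum_(t < bcnt j b) (F (b * r + t)%N + (if (b * r + t)%N == i then D else 0))).
  by apply: eq_bigr => t _; rewrite step.
rewrite big_split /=; congr (_ + _).
case: eqP => [bE|bE].
  have [h1 h2 h3] := block_ofP ij; rewrite -bE in h1 h2 h3.
  have kb : (i - b * r < bcnt j b)%N by lia.
  rewrite (bigD1 (Ordinal kb)) //= subnKC // eqxx big1 ?addr0 // => t tk.
  rewrite ifF //; apply/negP => /eqP tE; case/eqP: tk; apply: val_inj => /=; lia.
rewrite big1 // => t _; rewrite ifF //; apply/negP => /eqP tE; apply: bE.
by apply: block_of_uniq => //; have := ltn_ord t; lia.
Qed.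

Hypothesis hW : (16 * (off N + r ^ 3) <= W)%N.

Lemma update_node_safe s base nd sr c d (x : nat -> R) : env s ->
  reg s 11 = base -> reg s 4 = nd -> reg s 16 = c -> reg s 14 = sr -> (c < r)%N ->
  rd s Arg 0 - rd s Inp (sr + c) = d -> (forall a, (a < r)%N -> rd s Inp (sr + a) = x a) ->
  (base + nd * (r * r) + r * r <= size (rmem s (Data 0)))%N ->
  safe W update_node s (300 * r) (fun s' => forall k, rd s' (Data 0) k =
    rd s (Data 0) k + (if (base + nd * (r * r) <= k < base + nd * (r * r) + r * r)%N
      then gram_delta x c d (k - (base + nd * (r * r))) else 0)).
Proof.
move=> es rb rnd rc rs cr dE xE sz; set P := (base + nd * (r * r))%N in sz *.
(* The part of [gram_delta] added after [m] iterations. Iteration [c] hits the diagonal cell (c, c)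
   twice, which gives 2 d x_c; the remaining d^2 is added after the loop. *)
pose G m e := (if (e %% r == c)%N && (e %/ r < m)%N then d * x (e %/ r)%N else 0) +
  (if (e %/ r == c)%N && (e %% r < m)%N then d * x (e %% r)%N else 0).
have bnd a b : (a < r)%N -> (b < r)%N -> (a * r + b < r * r)%N.
  move=> ar br; have : (a.+1 * r <= r * r)%N by rewrite leq_mul2r ar orbT.
  by rewrite mulSn; lia.
apply: safe_time.
  apply: (safe_Seq (Q1 := fun s' => forall k, rd s' (Data 0) k =
    rd s (Data 0) k + (if (P <= k < P + r * r)%N then G r (k - P)%N else 0))).
    apply: (@safe_loop R W 0 _ _ s r (fun=> 200)%N (fun m s' => forall k, rd s' (Data 0) k =
      rd s (Data 0) k + (if (P <= k < P + r * r)%N then G m (k - P)%N else 0))).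
    - by rewrite evalE (env_r es).
    - by apply/ltnW/(lt_W r0 hW); have := r_le r0; lia.
    - by move=> k; rewrite /G !ltn0 !andbF addr0 if_same addr0.
    - by [].
    move=> m s1 mr f1 m1 I1; have e1 := env_frame f1 isT es.
    have dl1 : reval s1 (eDelta * Inp![vSrc + vE])%re = d * x m.
      by rewrite /eDelta !evalE m1 !(frame_reg f1) // rc rs !(frame_rd f1) // dE xE.
    apply: safe_time.
      apply: (safe_Seq (Q1 := fun s' => s' = set_rmem s1 (Data 0) (P + (m * r + c))
         (rd s1 (Data 0) (P + (m * r + c)) + d * x m))).
        apply: safe_RStore; rewrite reval_add dl1 reval_load.
        have -> // : ieval s1 (vBase + vNode * eRR + (vE * eR + vC))%ie = (P + (m * r + c))%N.
        by rewrite !evalE m1 (env_r e1) !(frame_reg f1) // rb rnd rc.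
      move=> s2 s2E f2; have e2 := env_frame f2 isT e1.
      have dl2 : reval s2 (eDelta * Inp![vSrc + vE])%re = d * x m.
        by rewrite -dl1 /eDelta !evalE !(frame_reg f2) // !(frame_rd f2).
      apply: safe_RStore; rewrite reval_add dl2 reval_load.
      have -> : ieval s2 (vBase + vNode * eRR + (vC * eR + vE))%ie = (P + (c * r + m))%N.
        by rewrite !evalE !(frame_reg f2) // m1 (env_r e2) !(frame_reg f1) // rb rnd rc.
      move=> k; rewrite rd_set_rmem_add s2E rd_set_rmem_add -s2E eqxx !andTb.
      rewrite (frame_rsize _ f2) (frame_rsize _ f1) I1.
      rewrite (_ : (P + (m * r + c) < _)%N = true); last first.
        by apply: leq_trans sz; rewrite -addnS leq_add2l bnd.
      rewrite (_ : (P + (c * r + m) < _)%N = true); last first.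
        by apply: leq_trans sz; rewrite -addnS leq_add2l bnd.
      rewrite !andbT; have [kP|kP] := boolP (P <= k < P + r * r)%N; last first.
        rewrite !ifF ?addr0 //; apply/negP => /eqP kE; case/negP: kP.
          by have := bnd _ _ cr mr; lia.
        by have := bnd _ _ mr cr; lia.
      have kE X : (k == P + X)%N = (k - P == X)%N by apply/eqP/eqP; lia.
      rewrite !kE !eq_divmod // -!addrA; congr (_ + _).
      have ltS a : (a < m.+1)%N = (a == m) || (a < m)%N by rewrite ltnS leq_eqVlt.
      rewrite /G; move: (k - P)%N => e; rewrite !ltS.
      case: (e %/ r =P c)%N => [->|_]; case: (e %% r =P c)%N => [->|_] /=.
      + by case: (c =P m) => [->|_] /=; rewrite ?ltnn /=; ring.
      + by case: (e %% r =P m)%N => [->|_] /=; rewrite ?ltnn /= ?andbF; ring.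
      + by case: (e %/ r =P m)%N => [->|_] /=; rewrite ?ltnn /= ?andbF; ring.
      + by rewrite ?andbF; ring.
    by [].
  move=> s1 I1 f1; have e1 := env_frame f1 isT es.
  have dl1 : reval s1 (eDelta * eDelta)%re = d * d.
    by rewrite /eDelta !evalE !(frame_reg f1) // rc rs !(frame_rd f1) // dE.
  apply: safe_RStore; rewrite reval_add dl1 reval_load.
  have -> : ieval s1 (vBase + vNode * eRR + (vC * eR + vC))%ie = (P + (c * r + c))%N.
    by rewrite !evalE (env_r e1) !(frame_reg f1) // rb rnd rc.
  move=> k; rewrite rd_set_rmem_add eqxx andTb (frame_rsize _ f1) I1.
  rewrite (_ : (P + (c * r + c) < _)%N = true); last first.
    by apply: leq_trans sz; rewrite -addnS leq_add2l bnd.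
  rewrite andbT; have [kP|kP] := boolP (P <= k < P + r * r)%N; last first.
    rewrite !ifF ?addr0 //; apply/negP => /eqP kE; case/negP: kP.
    by have := bnd _ _ cr cr; lia.
  have kE X : (k == P + X)%N = (k - P == X)%N by apply/eqP/eqP; lia.
  rewrite kE eq_divmod // -!addrA; congr (_ + _).
  have kq : (k - P < r * r)%N by lia.
  rewrite /G /gram_delta; move: (k - P)%N kq => e er.
  rewrite ltn_mod r0 ltn_divLR // er !andbT; by rewrite !addrA.
by rewrite sum_nat_const card_ord /=; lia.
Qed.

End UpdateEntry.

Section UpdateEntryProg.
Variables (R : realType) (W N r : nat) (n : nat -> nat) (u : nat -> nat -> nat -> R).
Implicit Types s : state R.
Hypothesis r0 : (0 < r)%N.
Hypothesis n0 : forall j, (j < N)%N -> (0 < n j)%N.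
Local Notation off := (row_offset r n).
Local Notation env := (env N r n).
Local Notation nblk := (block_count r n).
Local Notation bcnt := (block_height r n).
Hypothesis hW : (16 * (off N + r ^ 3) <= W)%N.

Lemma divn_half m l : (m %/ 2 ^ l %/ 2 = m %/ 2 ^ l.+1)%N.
Proof. by rewrite -divnMA -expnSr. Qed.

Lemma update_path_safe s j i c x : env s -> (j < N)%N -> (i < n j)%N -> (c < r)%N ->
  (r <= n j)%N -> rd s Arg 0 = x -> reg s 2 = j -> reg s 16 = c ->
  reg s 14 = (off j + i * r)%N -> reg s 11 = (2 * off j)%N -> reg s 12 = nblk j ->
  reg s 4 = (nblk j + block_of r n j i)%N ->
  rows_in N r n u s -> tree_ok r n u s j ->
  (2 * off N <= size (rmem s (Data 0)))%N ->
  safe W (For 5 (eLg vBn + #2)%ie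
       (IfI #1%ie vNode (update_node ;; SetReg 4 (vNode / #2)%ie) Skip)) s
    (500 * (r * (trunc_log 2 (nblk j) + 2))) (fun s' =>
      tree_ok r n (set_entry_nat u j i c x) s' j /\
      forall k, ~~ (2 * off j <= k < 2 * off j.+1)%N -> rd s' (Data 0) k = rd s (Data 0) k).
Proof.
move=> es jN ij cr rn xE rj rc rs rb rB rnd us ts sz.
have B0 := nblk_gt0 r n j; have BN := nblk_off r0 n0 jN; have oj := off_le r n jN.
have [b0B _ _] := block_ofP r0 ij; set b0 := block_of r n j i in rnd b0B *.
(* The leaf is numbered below 2 * [nblk j], hence below 2^L, so that L halvings lead past the root
   to 0. *)
set L := (trunc_log 2 (nblk j) + 2)%N.
have x0L : (nblk j + b0 < 2 ^ L)%N.
  have := trunc_log_ltn (nblk j) (isT : (1 < 2)%N).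
  by rewrite /L addn2 [in X in _ -> X]expnS; move: (2 ^ _)%N => p; lia.
have LW : (L <= W)%N.
  apply/ltnW/(lt_W r0 hW); have := trunc_logP (isT : 1 < 2)%N B0.
  by have := ltn_expl (trunc_log 2 (nblk j)) (isT : 1 < 2)%N; rewrite /L; move: (2 ^ _)%N => p; lia.
set D := gram_delta r (u j i) c (x - u j i c).
have [t1 t2] := ts rn.
pose nd l := ((nblk j + b0) %/ 2 ^ l)%N.
pose T s' := node r s' (Data 0) (2 * off j).
(* Once the leaf has been corrected, the heap equation fails only at the current node, which lacks
   the correction that its child already has. The defect moves up with the walk and disappears when
   the current node becomes 0, which is not a node of the heap. *)
pose I l s' := [/\ reg s' 4 = nd l,
  forall b e, (b < nblk j)%N -> (e < r * r)%N ->
    T s' (nblk j + b)%N e = leaf_gram r n u j b e + (if (b == b0) && (0 < l)%N then D e else 0),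
  forall k e, (0 < k < nblk j)%N -> (e < r * r)%N ->
    T s' k e + (if (k == nd l) && (0 < l)%N then D e else 0) =
    T s' (2 * k)%N e + T s' (2 * k + 1)%N e &
  forall k, ~~ (2 * off j <= k < 2 * off j.+1)%N -> rd s' (Data 0) k = rd s (Data 0) k].
have loopP : safe W (For 5 (eLg vBn + #2)%ie
       (IfI #1%ie vNode (update_node ;; SetReg 4 (vNode / #2)%ie) Skip)) s
    ((icost (eLg vBn + #2)%ie).+1 + \sum_(l < L) (300 * r + 20).+1) (I L).
  apply: (@safe_loop R W 5 _ _ s L (fun=> 300 * r + 20)%N I).
  - by rewrite !evalE rB (env_lg es).
  - exact: LW.
  - split=> //; first by rewrite /nd expn0 divn1.
      by move=> b e bB er; rewrite andbF addr0 /T t1.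
    by move=> k e kB er; rewrite andbF addr0; exact: t2.
  - move=> l s' v [h1 h2 h3 h4]; split=> //.
  move=> l s1 lL f1 l1 [h1 h2 h3 h4]; have e1 := env_frame f1 isT es.
  have ndS : (nd l %/ 2 = nd l.+1)%N by rewrite /nd divn_half.
  have [nd0|nd0] := leqP 1 (nd l); last first.
    apply: safe_time.
      apply: safe_IfI_else; first by rewrite !evalE h1.
      apply: safe_Skip; have ndE : nd l = 0%N by lia.
      have l0 : (0 < l)%N.
        by case: l ndE {h1 h2 h3 lL l1 ndS nd0} => // ; rewrite /nd expn0 divn1; lia.
      split=> //; first by rewrite h1 -ndS ndE.
        by move=> b e bB er; rewrite h2 // l0.
      move=> k e kB er; rewrite -h3 //; congr (_ + _).
      by rewrite -ndS ndE div0n l0.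
    by rewrite /=; lia.
  have ndB : (nd l < 2 * nblk j)%N by apply: leq_ltn_trans (leq_div _ _) _; lia.
  have ndl : (0 < l)%N -> (nd l < nblk j)%N.
    case: l {h1 h2 h3 lL l1 ndS nd0 ndB} => // l _.
    rewrite /nd ltn_divLR ?expn_gt0 // expnS mulnC -mulnA.
    have := expn_gt0 2 l => /= p0; have : (1 * nblk j <= 2 ^ l * nblk j)%N by rewrite leq_mul2r p0 orbT.
    lia.
  have ndl0 : l = 0%N -> nd l = (nblk j + b0)%N by move=> ->; rewrite /nd expn0 divn1.
  have tb e : (e < r * r)%N -> (2 * off j + nd l * (r * r) + e < 2 * off j.+1)%N.
    by move=> er; apply: (tree_bound r0 rn).
  have tb' : (2 * off j + nd l * (r * r) + r * r <= 2 * off j.+1)%N.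
    have q0 : (0 < r * r)%N by rewrite muln_gt0 r0.
    have := @tb (r * r).-1; rewrite prednK // => /(_ (leqnn _)); lia.
  have off1 : (off j.+1 <= off N)%N by rewrite offS.
  apply: safe_time.
    apply: safe_IfI_then; first by rewrite !evalE h1.
    apply: safe_Seq.
      apply: (@update_node_safe R W N r n r0 hW s1 (2 * off j) (nd l) (off j + i * r) c
        (x - u j i c) (u j i)) => //; rewrite ?(frame_reg f1) //.
      - by rewrite !(frame_rd f1) // xE us.
      - by move=> a ar; rewrite (frame_rd f1) // us.
      - by rewrite (frame_rsize _ f1); apply: leq_trans sz; lia.
    move=> s2 I2 f2; have e2 := env_frame f2 isT e1.
    have TE k e : (e < r * r)%N -> T s2 k e = T s1 k e + (if k == nd l then D e else 0).
      move=> er; rewrite /T /node I2 node_in //; case: eqP => [->|//].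
      by rewrite addKn.
    have T4 v k e : T (set_reg W s2 4 v) k e = T s2 k e by [].
    apply: safe_SetReg; split.
    - rewrite reg_set_reg eqxx !evalE (frame_reg f2) // h1 ndS modn_small //.
      by apply: (lt_W r0 hW); rewrite -ndS; have := leq_div (nd l) 2; lia.
    - move=> b e bB er; rewrite T4 TE // h2 // andbT -addrA; congr (_ + _).
      have [l0|l0] := posnP l.
        by rewrite ndl0 // eqn_add2l andbF add0r.
      have := ndl l0 => ndl'; rewrite andbT (_ : (nblk j + b == nd l)%N = false) ?addr0 //.
      by apply/negP => /eqP; lia.
    - move=> k e kB er; rewrite !T4 !TE // andbT.
      have k2 : (k == nd l.+1) = (nd l == 2 * k)%N || (nd l == 2 * k + 1)%N.
        rewrite -ndS; lia.
      have kl : (k == nd l) && (0 < l)%N = (k == nd l).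
        have [l0|l0] := posnP l; last by rewrite andbT.
        by rewrite ndl0 // andbF; apply/esym/negP => /eqP; lia.
      rewrite addrACA -(h3 _ _ kB er) kl k2; congr (_ + _).
      rewrite !(eq_sym (nd l)); case: (_ =P nd l) => [<-|_] /=; last by rewrite add0r.
      by rewrite (_ : (2 * k + 1 == 2 * k)%N = false) ?addr0 //; apply/negP => /eqP; lia.
    - move=> k kn; rewrite rd_set_reg I2 ifF ?addr0 ?h4 //; apply/negP => kP.
      by case/negP: kn; move: kP tb'; lia.
  by rewrite /=; lia.
apply: safe_mono loopP _ _.
  by rewrite sum_nat_const card_ord /= /L; nia.
move=> s' [h1 h2 h3 h4]; split=> // _; split.
  move=> b e bB er; rewrite [LHS]h2 // leaf_gram_set // /L addn2 andbT.
  by [].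
move=> k e kB er; rewrite -!/(T s' _ _) -h3 //.
rewrite (_ : nd L = 0%N) ?ifF ?addr0 //; last by rewrite /nd divn_small.
by apply/negP => /andP [/eqP]; lia.
Qed.

Lemma update_entry_safe s j i c x : env s -> (j < N)%N -> (i < n j)%N -> (c < r)%N ->
  ird s Arg 0 = j -> ird s Arg 1 = i -> ird s Arg 2 = c -> rd s Arg 0 = x ->
  rows_in N r n u s -> (forall k, (k < N)%N -> tree_ok r n u s k) ->
  (2 * off N <= size (rmem s (Data 0)))%N -> (off N <= size (rmem s Inp))%N ->
  safe W update_entry_prog s
    (1000 * (r * (trunc_log 2 (nblk j) + 2))) (fun s' =>
      (forall k, (k < N)%N -> tree_ok r n (set_entry_nat u j i c x) s' k) /\
      forall k, rd s' Inp k = if (k == off j + i * r + c)%N then x else rd s Inp k).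
Proof.
move=> es jN ij cr aj ai ac ax us ts sz szi.
have B0 := nblk_gt0 r n j; have BN := nblk_off r0 n0 jN; have oj := off_le r n jN.
have offN1 : (N <= off N)%N := off_geN r0 n0 (leqnn N).
have ir : (i * r + r <= n j * r)%N by rewrite addnC -mulSn leq_mul2r ij orbT.
have rr := r_le r0.
apply: safe_time.
  apply: (safe_Seq_SetReg (v := j)).
  - by rewrite !evalE.
  - by apply: (lt_W r0 hW); lia.
  move=> s1 f1 j1; have e1 := env_frame f1 isT es.
  apply: (safe_Seq_SetReg (v := c)).
  - by rewrite !evalE (frame_ird f1).
  - by apply: (lt_W r0 hW); lia.
  move=> s2 f2 c2; have e2 := env_frame f2 isT e1.
  have j2 : reg s2 2 = j by rewrite (frame_reg f2).
  apply: (safe_Seq_SetReg (v := (off j + i * r)%N)).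
  - by rewrite !evalE j2 (env_off e2) 1?ltnW // (env_r e2) (frame_ird f2) // (frame_ird f1) // ai.
  - by apply: (lt_W r0 hW); lia.
  move=> s3 f3 r3; have e3 := env_frame f3 isT e2.
  have j3 : reg s3 2 = j by rewrite (frame_reg f3).
  have c3 : reg s3 16 = c by rewrite (frame_reg f3).
  have rd3 a k : rd s3 a k = rd s a k by rewrite (frame_rd f3) // (frame_rd f2) // (frame_rd f1).
  have ird3 a k : ird s3 a k = ird s a k.
    by rewrite (frame_ird f3) // (frame_ird f2) // (frame_ird f1).
  have sz3 a : size (rmem s3 a) = size (rmem s a).
    by rewrite (frame_rsize _ f3) (frame_rsize _ f2) (frame_rsize _ f1).
  have u3 : rows_in N r n u s3 by move=> *; rewrite rd3 us.
  apply: (safe_Seq (T1 := 100 + 500 * (r * (trunc_log 2 (nblk j) + 2))) (Q1 := fun s' =>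
      tree_ok r n (set_entry_nat u j i c x) s' j /\
      forall k, ~~ (2 * off j <= k < 2 * off j.+1)%N -> rd s' (Data 0) k = rd s (Data 0) k)).
    have [rn|rn] := leqP r (n j); last first.
      apply: safe_time.
        apply: safe_IfI_else; first by rewrite !evalE (env_r e3) j3 (env_n e3).
        by apply: safe_Skip; split=> // rn'; lia.
      by rewrite /=; lia.
    apply: safe_time.
      apply: safe_IfI_then; first by rewrite !evalE (env_r e3) j3 (env_n e3).
      apply: (safe_Seq_SetReg (v := 2 * off j)).
      + by rewrite !evalE j3 (env_off e3) // ltnW.
      + by apply: (lt_W r0 hW); lia.
      move=> s4 f4 b4; have e4 := env_frame f4 isT e3.
      have j4 : reg s4 2 = j by rewrite (frame_reg f4).
      apply: (safe_Seq_SetReg (v := nblk j)).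
      + exact: eval_blocks e4 j4 jN.
      + by apply: (lt_W r0 hW); lia.
      move=> s5 f5 B5; have e5 := env_frame f5 isT e4.
      apply: (safe_Seq_SetReg (v := (i %/ r)%N)).
      + by rewrite !evalE (env_r e5) (frame_ird f5) // (frame_ird f4) // ird3 ai.
      + by apply: (lt_W r0 hW); have := leq_div i r; have := leq_pmulr i r0; lia.
      move=> s6 f6 q6; have e6 := env_frame f6 isT e5.
      have [bB _ _] := block_ofP r0 ij.
      apply: (safe_Seq_SetReg (v := (nblk j + block_of r n j i)%N)).
      + by rewrite !evalE q6 (frame_reg f6) // B5 /block_of minnE subn1.
      + by apply: (lt_W r0 hW); lia.
      move=> s7 f7 n7; have e7 := env_frame f7 isT e6.
      have rd7 a k : rd s7 a k = rd s a k.
        by rewrite (frame_rd f7) // (frame_rd f6) // (frame_rd f5) // (frame_rd f4) // rd3.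
      apply: safe_post.
        apply: (@update_path_safe s7 j i c x) => //.
        * by rewrite rd7.
        * by rewrite (frame_reg f7) // (frame_reg f6) // (frame_reg f5).
        * by rewrite (frame_reg f7) // (frame_reg f6) // (frame_reg f5) // (frame_reg f4).
        * by rewrite (frame_reg f7) // (frame_reg f6) // (frame_reg f5) // (frame_reg f4).
        * by rewrite (frame_reg f7) // (frame_reg f6) // (frame_reg f5).
        * by rewrite (frame_reg f7) // (frame_reg f6).
        * by move=> *; rewrite rd7 us.
        * by apply: (tree_ok_eq r0 (s := s)); [move=> *; rewrite rd7|exact: ts].
        * by rewrite (frame_rsize _ f7) (frame_rsize _ f6) (frame_rsize _ f5) (frame_rsize _ f4) sz3.
      by move=> s8 [h1 h2]; split=> // k kn; rewrite h2 // rd7.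
    rewrite /=; lia.
  move=> s4 [h1 h2] f4; have e4 := env_frame f4 isT e3.
  apply: safe_RStore.
  have -> : ieval s4 (vSrc + vC)%ie = (off j + i * r + c)%N.
    by rewrite !evalE !(frame_reg f4) // r3 c3.
  have -> : reval s4 (Arg![#0])%re = x by rewrite !evalE (frame_rd f4) // rd3.
  have rdD k : rd (set_rmem s4 Inp (off j + i * r + c) x) (Data 0) k = rd s4 (Data 0) k.
    by rewrite rd_set_rmem.
  split; last first.
    move=> k; rewrite rd_set_rmem eqxx andTb (frame_rsize _ f4) sz3 (frame_rd f4) // rd3.
    by case: eqP => [->|//]; rewrite ifT //; lia.
  move=> k kN; have [->|kj] := eqVneq k j.
    by apply: (tree_ok_eq r0 (s := s4)) => // l _; rewrite rdD.
  apply: (tree_ok_eq r0 (s := s)).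
    move=> l lk; rewrite rdD h2 //; apply/negP => lj.
    have lt i1 l1 : (i1 < l1)%N -> (off i1.+1 <= off l1)%N.
      move=> il; rewrite /row_offset -(subnKC il) big_split_ord /=; exact: leq_addr.
    by case: (ltngtP k j) kj => // /lt; lia.
  apply: (tree_ok_ext r0 _ (ts k kN)) => t a _ _.
  by rewrite /set_entry_nat (negbTE kj).
rewrite /=; have : (0 < r * (trunc_log 2 (nblk j) + 2))%N by rewrite muln_gt0 r0 addn2.
lia.
Qed.

End UpdateEntryProg.

(** * Precomputation for a batch of samples *)

(** The equations at the nodes 1, ..., B - 1 add up to an equality of the sum over these nodes and
    the sum over the nodes 2, ..., 2B - 1. All inner nodes except the root cancel, and the leaves
    remain; B need not be a power of two. *)
Lemma heap_root (V : zmodType) (S : nat -> V) B : (0 < B)%N ->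
  (forall i, (0 < i < B)%N -> S i = S (2 * i)%N + S (2 * i + 1)%N) ->
  S 1%N = \sum_(b < B) S (B + b)%N.
Proof.
move=> B0 H.
have E k : (0 < k <= B)%N -> \sum_(1 <= i < k) S i = \sum_(2 <= i < 2 * k) S i.
  elim: k => // -[|k] IH kB; first by rewrite !big_geq.
  rewrite big_nat_recr //= IH; last by lia.
  rewrite (H k.+1) //.
  rewrite (_ : 2 * k.+2 = (2 * k.+1 + 1).+1)%N; last by lia.
  rewrite [RHS]big_nat_recr /=; last by lia.
  by rewrite addn1 [X in _ = X + _]big_nat_recr ?addrA //; lia.
have E1 : \sum_(1 <= i < 2 * B) S i = S 1%N + \sum_(1 <= i < B) S i.
  by rewrite (E B) ?B0 ?leqnn //= big_ltn //; lia.
have E2 : \sum_(1 <= i < 2 * B) S i = \sum_(1 <= i < B) S i + \sum_(b < B) S (B + b)%N.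
  rewrite (big_cat_nat (n := B)) //=; last by lia.
  congr (_ + _); rewrite (_ : 2 * B = B + B)%N; last by lia.
  rewrite -[X in \sum_(X <= _ < _) _]add0n big_addn addnK big_mkord.
  by apply: eq_bigr => i _; rewrite addnC.
by move: E2; rewrite E1 addrC => /addrI.
Qed.

(** * Sums over rows, grouped by blocks *)

Section Blocks.
Variables (V : zmodType) (r : nat) (n : nat -> nat).
Hypothesis r0 : (0 < r)%N.

Lemma sum_rows (g : nat -> V) k :
  \sum_(b < k) \sum_(t < r) g (b * r + t)%N = \sum_(t < k * r) g t.
Proof.
elim: k => [|k IH]; first by rewrite !big_ord0.
rewrite big_ord_recr /= IH -[in RHS](big_mkord xpredT g) -[in LHS](big_mkord xpredT g).
rewrite mulSn (addnC r) [RHS](big_cat_nat (n := (k * r)%N)) //= ?leq_addr //; congr (_ + _).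
rewrite -[X in \sum_(X <= _ < _) _]add0n big_addn addKn big_mkord.
by apply: eq_bigr => t _; rewrite addnC.
Qed.

Lemma sum_blocks (g : nat -> V) j :
  \sum_(b < block_count r n j) \sum_(t < block_height r n j b) g (b * r + t)%N = \sum_(t < n j) g t.
Proof.
have B0 := nblk_gt0 r n j; have bl := @bcnt_le r n r0 j (block_count r n j).-1.
have E k : (k < block_count r n j)%N ->
    \sum_(b < k) \sum_(t < block_height r n j b) g (b * r + t)%N = \sum_(t < k * r) g t.
  move=> kB; rewrite -sum_rows; apply: eq_bigr => b _.
  by rewrite /block_height ifF //; apply/negP; have := ltn_ord b; lia.
rewrite -(prednK B0) big_ord_recr /= E; last by lia.
rewrite /block_height ifT ?prednK //; have [|bn _] := bl; first by lia.
set k := ((block_count r n j).-1 * r)%N in bn *.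
rewrite -[in LHS](big_mkord xpredT g) -[in RHS](big_mkord xpredT g).
rewrite [in RHS](big_cat_nat (n := k)) //=; last by lia.
congr (_ + _); rewrite -[X in _ = \sum_(X <= _ < _) _]add0n big_addn !big_mkord.
by apply: eq_bigr => t _; rewrite addnC.
Qed.

End Blocks.

(** * Products of Gram matrices with removable factors *)

Section Precompute.
Variables (R : realType) (W N r : nat) (n : nat -> nat) (u : nat -> nat -> nat -> R).
Implicit Types s : state R.
Hypothesis r0 : (0 < r)%N.
Hypothesis n0 : forall j, (j < N)%N -> (0 < n j)%N.
Local Notation off := (row_offset r n).
Local Notation env := (env N r n).
Local Notation nblk := (block_count r n).
Local Notation bcnt := (block_height r n).

Definition gram_entry j e : R := \sum_(t < n j) u j t (e %/ r)%N * u j t (e %% r)%N.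

Lemma root_gram s j e : (r <= n j)%N -> tree_ok r n u s j -> (e < r * r)%N ->
  rd s (Data 0) (2 * off j + r * r + e) = gram_entry j e.
Proof.
move=> rn ts er; have [h1 h2] := ts rn; have B0 := nblk_gt0 r n j.
transitivity (node r s (Data 0) (2 * off j) 1 e); first by rewrite /node mul1n.
rewrite (heap_root (S := fun i => node r s (Data 0) (2 * off j) i e) B0
  (fun i iB => h2 i e iB er)).
rewrite /gram_entry -(sum_blocks n r0 (fun t => u j t (e %/ r)%N * u j t (e %% r)%N)).
by apply: eq_bigr => b _; rewrite h1.
Qed.

Lemma safe_if_zero e c1 c2 s T1 T2 Q :
  (reval s e = 0 -> safe W c1 s T1 Q) -> (reval s e != 0 -> safe W c2 s T2 Q) ->
  safe W (if_zero e c1 c2) s (2 * rcost e + 4 + (T1 + T2 + T2)) Q.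
Proof.
move=> h1 h2; apply: safe_time.
  apply: safe_IfR; rewrite reval_zero => cmp.
    apply: safe_IfR; rewrite reval_zero => cmp'.
      by apply: h1; apply/eqP; rewrite eq_le cmp cmp'.
    by apply: h2; rewrite lt_eqF.
  by apply: h2; rewrite gt_eqF.
rewrite [rcost RZero]/=; clear; lia.
Qed.

Hypothesis hW : (16 * (off N + r ^ 3) <= W)%N.

Lemma gram_matrix_safe s j : env s -> rows_in N r n u s -> reg s 2 = j -> (j < N)%N ->
  tree_ok r n u s j -> (r * r <= size (rmem s sGram))%N ->
  safe W gram_matrix s (300 * r ^ 3) (fun s' =>
    forall e, (e < r * r)%N -> rd s' sGram e = gram_entry j e).
Proof.
move=> es us rj jN ts sz; have oN := off_le r n jN; have nj0 := n0 jN.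
have rr3 := rr_le r0; have r3 : (0 < r ^ 3)%N by rewrite expn_gt0 r0.
have qW : (r * r <= W)%N by apply/ltnW/(lt_W r0 hW); lia.
have [rn|rn] := leqP r (n j).
  apply: safe_time.
    apply: safe_IfI_then; first by rewrite !evalE (env_r es) rj (env_n es).
    apply: safe_post.
      apply: (@safe_fill R W 0 _ _ s sGram 0 (r * r) (gram_entry j)).
      - by rewrite !evalE (env_r es).
      - exact: qW.
      move=> e s1 er f1 e1 _; have es1 := env_frame f1 isT es.
      apply: safe_RStore; rewrite !evalE e1; split; last first.
        by move=> k kn; rewrite rd_set_rmem (negbTE kn) andbF.
      rewrite rd_set_rmem !eqxx !andTb (frame_rsize _ f1) ifT; last by lia.
      rewrite (frame_reg f1) // rj (env_off es1) 1?ltnW // (env_r es1) (frame_rd f1) //.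
      exact: root_gram.
    by move=> s' H e er; rewrite H /= add0n er subn0.
  by rewrite /=; lia.
have njr : (n j * r < r * r)%N by rewrite ltn_mul2r r0.
apply: safe_time.
  apply: safe_IfI_else; first by rewrite !evalE (env_r es) rj (env_n es).
  apply: (safe_Seq_SetReg (v := 0%N)) => //.
    by apply: (lt_W r0 hW).
  move=> s1 f1 d1; have e1 := env_frame f1 isT es.
  apply: (safe_Seq_SetReg (v := off j)).
  - by rewrite !evalE (frame_reg f1) // rj (env_off e1) // ltnW.
  - by apply: (lt_W r0 hW); lia.
  move=> s2 f2 c2; have e2 := env_frame f2 isT e1.
  apply: (safe_Seq_SetReg (v := n j)).
  - by rewrite !evalE (frame_reg f2) // (frame_reg f1) // rj (env_n e2).
  - by apply: (lt_W r0 hW); have := r_le r0; lia.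
  move=> s3 f3 n3; have e3 := env_frame f3 isT e2.
  apply: safe_post.
    apply: (@gram_rows_safe R W N r n r0 hW sGram s3 0 (off j) (n j) (u j)) => //.
    - by rewrite (frame_reg f3) // (frame_reg f2).
    - by rewrite (frame_reg f3).
    - by apply/ltnW/(lt_W r0 hW); have := r_le r0; lia.
    - by rewrite (frame_rsize _ f3) (frame_rsize _ f2) (frame_rsize _ f1).
    - move=> t c tn cr; rewrite (frame_rd f3) // (frame_rd f2) // (frame_rd f1) //.
      exact: us.
  by move=> s4 H e er; rewrite H /= add0n er subn0.
rewrite /=; have -> : (r ^ 3 = r * r * r)%N by rewrite !expnS expn0 muln1 mulnA.
have : (r * r * (n j).+1 <= r * r * r)%N by rewrite leq_mul2l rn orbT.
have : (0 < r * r * r)%N by rewrite !muln_gt0 r0.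
lia.
Qed.

Variables (m : nat) (f : nat -> nat).

Record picks s : Prop := Picks {
  pick_m : ird s Arg 1 = m;
  pick_f : forall k, (k < m)%N -> ird s Arg (2 + k) = f k;
  pick_N : forall k, (k < m)%N -> (f k < N)%N }.

Lemma picks_frame c s s' : frame c s s' -> Arg \notin wwords c -> picks s -> picks s'.
Proof.
move=> fs nc [h1 h2 h3]; split; rewrite ?(frame_ird fs) // => k km.
by rewrite (frame_ird fs) // h2.
Qed.

(** The factor 2 in the scratch size is for the pivot heap, which has 2r nodes of r^2 cells. *)
Record ready s : Prop := Ready {
  ready_env : env s;
  ready_rows : rows_in N r n u s;
  ready_tree : forall j, (j < N)%N -> tree_ok r n u s j;
  ready_picks : picks s;
  ready_size : forall k, (k < 14)%N -> (2 * r ^ 3 <= size (rmem s (Scr k)))%N }.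

Lemma ready_frame c s s' : frame c s s' ->
  spares [:: Arg; Inp; Data 0; Data 1] [:: Inp; Data 0] c -> ready s -> ready s'.
Proof.
move=> fs /andP [/and5P [a1 a2 a3 a4 _] /and3P [a5 a6 _]] [h1 h2 h3 h4 h5]; split.
- by apply: (env_frame fs) h1; rewrite /spares /= a2 a3 a4.
- exact: rows_in_frame fs _ h2.
- by move=> j jN; apply: (tree_ok_eq r0 (s := s)) (h3 j jN) => k _; rewrite (frame_rd fs).
- exact: picks_frame fs _ h4.
- by move=> k km; rewrite (frame_rsize _ fs) h5.
Qed.

Definition nonzero_prod k0 e : R :=
  \prod_(k0 <= k < m) (if gram_entry (f k) e == 0 then 1 else gram_entry (f k) e).
Definition zero_count k0 e : R :=
  \sum_(k0 <= k < m) (if gram_entry (f k) e == 0 then 1 else 0).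
Definition gram_suffix k0 e : R := \prod_(k0 <= k < m) gram_entry (f k) e.

(** A sum of indicators is at most 0 only if each of them is 0, and then no factor has been replaced
    by 1; otherwise a factor of the true product vanishes. *)
Lemma suffix_prodE k0 e :
  (if zero_count k0 e <= 0 then nonzero_prod k0 e else 0) = gram_suffix k0 e.
Proof.
rewrite /zero_count /nonzero_prod /gram_suffix.
have ge0 : 0 <= \sum_(k0 <= k < m) (if gram_entry (f k) e == 0 then 1 else 0 : R).
  by apply: sumr_ge0 => k _; case: ifP.
case: ifP => [le0|/negbT]; last first.
  rewrite -ltNge => gt0.
  have /hasP [k kin /eqP k0E] : has (fun k => gram_entry (f k) e == 0) (index_iota k0 m).
    apply/negPn/negP => /hasPn none; move: gt0; rewrite big1_seq ?ltxx // => k /andP [_ kin].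
    by rewrite (negbTE (none k kin)).
  by apply/esym/eqP; rewrite prodf_seq_eq0; apply/hasP; exists k => //=; rewrite k0E.
have {}le0 : \sum_(k0 <= k < m) (if gram_entry (f k) e == 0 then 1 else 0 : R) = 0 :> R.
  by apply/eqP; rewrite eq_le le0 ge0.
apply: eq_big_nat => k kk; case: eqP => // gk; exfalso.
move/eqP: le0; rewrite psumr_eq0 => [/allP /(_ k)|k' _]; last by case: ifP.
by rewrite mem_index_iota kk gk eqxx oner_eq0 => /(_ isT).
Qed.

Lemma sizeS s k i : ready s -> (k < 14)%N -> (i < r ^ 3)%N -> (i < size (rmem s (Scr k)))%N.
Proof.
by move=> rs kk ir; apply: leq_trans (ready_size rs kk); rewrite (leq_trans ir) // leq_pmull.
Qed.

Lemma products_safe s : ready s -> (m <= W)%N ->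
  safe W products s (1000 * (m * r ^ 3 + r ^ 3)) (fun s' =>
    forall e, (e < r * r)%N -> [/\ rd s' sProd e = nonzero_prod 0 e,
      rd s' sZero e = zero_count 0 e & rd s' sAll e = gram_suffix 0 e]).
Proof.
move=> rs mW; have es := ready_env rs.
have rr3 := rr_le r0; have r3 : (0 < r ^ 3)%N by rewrite expn_gt0 r0.
have qW : (r * r <= W)%N by apply/ltnW/(lt_W r0 hW); lia.
pose ok (P Z : nat -> R) s' := forall e, (e < r * r)%N -> rd s' sProd e = P e /\ rd s' sZero e = Z e.
apply: safe_time.
  apply: (safe_Seq (Q1 := ok (fun=> 1) (fun=> 0))).
    apply: (@safe_loop R W 0 _ _ s (r * r) (fun=> 10)%N (fun x s' =>
      forall e, (e < x)%N -> rd s' sProd e = 1 /\ rd s' sZero e = 0)).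
    - by rewrite !evalE (env_r es).
    - exact: qW.
    - by [].
    - by [].
    move=> e s1 er f1 e1 I1.
    have rs1 := ready_frame f1 isT rs.
    apply: safe_time.
      apply: (safe_Seq (Q1 := fun s' => s' = set_rmem s1 sProd e 1)).
        by apply: safe_RStore; rewrite !evalE e1.
      move=> s2 s2E f2; have rs2 := ready_frame f2 isT rs1.
      apply: safe_RStore; rewrite !evalE (frame_reg f2) // e1 => e' ee'.
      rewrite !rd_set_rmem s2E !rd_set_rmem -s2E !sizeS //; try lia.
      rewrite !andbT /=; case: eqP => [//|ne]; apply: I1; lia.
    by [].
  move=> s1 I1 f1; have rs1 := ready_frame f1 isT rs.
  have es1 := ready_env rs1; have [pm pf pN] := ready_picks rs1.
  pose P k e := \prod_(i < k) (if gram_entry (f i) e == 0 then 1 else gram_entry (f i) e).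
  pose Z k e := \sum_(i < k) (if gram_entry (f i) e == 0 then 1 else 0 : R).
  apply: (safe_Seq (Q1 := ok (P m) (Z m))).
    apply: (@safe_loop R W 6 _ _ s1 m (fun=> 400 * r ^ 3)%N (fun x => ok (P x) (Z x))).
    - by rewrite !evalE pm.
    - exact: mW.
    - by move=> e er; rewrite /P /Z !big_ord0; exact: I1.
    - by [].
    move=> k s2 km f2 k2 I2; have rs2 := ready_frame f2 isT rs1.
    have [pm2 pf2 pN2] := ready_picks rs2.
    apply: safe_time.
      apply: (safe_Seq_SetReg (v := f k)).
      - by rewrite !evalE k2 pf2.
      - by apply: (lt_W r0 hW); have := off_geN r0 n0 (leqnn N); have := pN k km; lia.
      move=> s3 f3 j3; have rs3 := ready_frame f3 isT rs2.
      apply: safe_Seq.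
        apply: (gram_matrix_safe (j := f k)) => //.
        + exact: ready_env.
        + exact: ready_rows.
        + exact: pN.
        + by apply: (ready_tree rs3); exact: pN.
        + by have := ready_size rs3 (isT : 7 < 14)%N; lia.
      move=> s4 G4 f4; have rs4 := ready_frame f4 isT rs3.
      have I4 : ok (P k) (Z k) s4.
        by move=> e er; rewrite !(frame_rd f4) // !(frame_rd f3) //; exact: I2.
      apply: (safe_post (Q := fun s' => forall e, (e < r * r)%N ->
         rd s' sProd e = P (if (e < r * r)%N then k.+1 else k) e /\
         rd s' sZero e = Z (if (e < r * r)%N then k.+1 else k) e)); last first.
        by move=> s5 I5 e er; have := I5 e er; rewrite er.
      apply: (@safe_loop R W 0 _ _ s4 (r * r) (fun=> 40)%N (fun x s' => forall e, (e < r * r)%N ->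
         rd s' sProd e = P (if (e < x)%N then k.+1 else k) e /\
         rd s' sZero e = Z (if (e < x)%N then k.+1 else k) e)).
      - by rewrite !evalE (env_r (ready_env rs4)).
      - exact: qW.
      - exact: I4.
      - by [].
      move=> e s5 er f5 e5 I5; have rs5 := ready_frame f5 isT rs4.
      have Ge : reval s5 (sGram![vE])%re = gram_entry (f k) e.
        by rewrite !evalE e5 (frame_rd f5) // G4.
      apply: safe_time.
        apply: safe_if_zero; rewrite Ge => g0; apply: safe_RStore; rewrite !evalE e5 => e' er';
          rewrite !rd_set_rmem /= !sizeS ?andbT //; try lia;
          have [i1 i2] := I5 e' er'.
          have [ee|ne] := eqVneq e' e; last first.
            have -> : (e' < e.+1)%N = (e' < e)%N by lia.
            by split.
          rewrite ee ltnn in i1 i2 *; rewrite ltnSn i1 i2 /P /Z !big_ord_recr /= g0 eqxx mulr1.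
          by split.
        have [ee|ne] := eqVneq e' e; last first.
          have -> : (e' < e.+1)%N = (e' < e)%N by lia.
          by split.
        rewrite ee ltnn in i1 i2 *; rewrite ltnSn -Ge !evalE e5 in g0 *.
        rewrite i1 i2 /P /Z !big_ord_recr /=.
        have -> : rd s5 sGram e = gram_entry (f k) e by rewrite -Ge !evalE e5.
        rewrite -Ge !evalE e5 (negbTE g0) addr0; by split.
      by [].
    rewrite sum_nat_const card_ord /=; lia.
  move=> s2 I2 f2; have rs2 := ready_frame f2 isT rs1.
  have es2 := ready_env rs2.
  have PE e : P m e = nonzero_prod 0 e by rewrite /P /nonzero_prod big_mkord.
  have ZE e : Z m e = zero_count 0 e by rewrite /Z /zero_count big_mkord.
  apply: safe_post; first apply: safe_frame.
    apply: (@safe_fill R W 0 _ _ s2 sAll 0 (r * r) (gram_suffix 0)).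
    - by rewrite !evalE (env_r es2).
    - exact: qW.
    move=> e s3 er f3 e3 _; have rs3 := ready_frame f3 isT rs2.
    have [i1 i2] := I2 e er.
    apply: (safe_time (T := 30)).
      apply: safe_time.
        apply: safe_IfR; rewrite !evalE e3 (frame_rd f3) // i2 ZE => cmp;
          apply: safe_RStore; rewrite !evalE e3; split.
        - rewrite rd_set_rmem !eqxx !andTb sizeS //; last by lia.
          by rewrite (frame_rd f3) // i1 PE -suffix_prodE cmp.
        - by move=> k kn; rewrite rd_set_rmem (negbTE kn) andbF.
        - rewrite rd_set_rmem !eqxx !andTb sizeS //; last by lia.
          by rewrite -suffix_prodE ifF //; apply/negP => cmp'; move: cmp; rewrite ltNge cmp'.
        - by move=> k kn; rewrite rd_set_rmem (negbTE kn) andbF.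
      by [].
    by [].
  move=> s3 [H f3] e er; have [i1 i2] := I2 e er.
  by split; rewrite ?H ?add0n ?er ?subn0 // (frame_rd f3) // ?i1 ?i2 ?PE ?ZE.
rewrite !sum_nat_const !card_ord /=; have : (m <= m * r ^ 3)%N by rewrite leq_pmulr.
move: (r ^ 3)%N (r * r)%N rr3 r3 => q p; clear; nia.
Qed.

End Precompute.

(** * Recurrences for the generalized inverse and the elimination *)

Section Elimination.
Variables (R : realType) (W N r : nat) (n : nat -> nat) (u : nat -> nat -> nat -> R).
Implicit Types s : state R.
Hypothesis r0 : (0 < r)%N.
Hypothesis n0 : forall j, (j < N)%N -> (0 < n j)%N.
Local Notation off := (row_offset r n).
Local Notation env := (env N r n).

Lemma flat_lt a b : (a < r)%N -> (b < r)%N -> (a * r + b < r * r)%N.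
Proof.
move=> ar br; have : (a.+1 * r <= r * r)%N by rewrite leq_mul2r ar orbT.
by rewrite mulSn; lia.
Qed.

Lemma flat_div a b : (b < r)%N -> ((a * r + b) %/ r = a)%N.
Proof. by move=> br; rewrite divnMDl // divn_small // addn0. Qed.

Lemma flat_mod a b : (b < r)%N -> ((a * r + b) %% r = b)%N.
Proof. by move=> br; rewrite modnMDl modn_small. Qed.

Lemma mod_sub e : (e - e %/ r * r = e %% r)%N.
Proof. by rewrite {1}(divn_eq e r) addKn. Qed.

(** Column [c] of 1 - X G, the defect of X as an inverse of G on the basis vector [c]. *)
Definition inv_dir (X G : nat -> R) c a : R :=
  (if a == c then 1 else 0) - \sum_(b < r) X (a * r + b)%N * G (b * r + c)%N.

Definition inv_step (X G : nat -> R) c e : R :=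
  X e + inv_dir X G c (e %/ r)%N * inv_dir X G c (e %% r)%N /
    \sum_(t < r) inv_dir X G c t * G (t * r + c)%N.

Fixpoint ginv_iter (G : nat -> R) c : nat -> R :=
  if c is c'.+1 then inv_step (ginv_iter G c') G c' else fun=> 0.

(** The rank one matrix [w w^T / d], with [w] the column [v] of M and [d] its diagonal entry; it is
    0 if [d] is 0. *)
Definition ldl_term (M : nat -> R) v e : R :=
  M (e %/ r * r + v)%N * M (e %% r * r + v)%N / M (v * r + v)%N.

(** Successive Schur complements, kept at full size: the first [v] rows and columns become 0 instead
    of being deleted. *)
Fixpoint ldl_iter (M : nat -> R) v : nat -> R :=
  if v is v'.+1 then fun e => ldl_iter M v' e - ldl_term (ldl_iter M v') v' e else M.

Variables (m : nat) (f : nat -> nat).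
Local Notation ready := (ready N r n u m f).
Hypothesis hW : (16 * (off N + r ^ 3) <= W)%N.

Let qW : (r * r <= W)%N.
Proof. by apply/ltnW/(lt_W r0 hW); have := rr_le r0; lia. Qed.

Let rW : (r <= W)%N.
Proof. by apply/ltnW/(lt_W r0 hW); have := r_le r0; lia. Qed.

Let small i : (i < r * r)%N -> (i < r ^ 3)%N.
Proof. by move=> ir; apply: leq_trans ir (rr_le r0). Qed.

Let small0 : (0 < r ^ 3)%N. Proof. by rewrite expn_gt0 r0. Qed.

Let smallr i : (i < r)%N -> (i < r ^ 3)%N.
Proof. by move=> ir; apply: leq_trans ir (r_le r0). Qed.

Lemma gen_inverse_safe s G : ready s -> (forall e, (e < r * r)%N -> rd s sAll e = G e) ->
  safe W gen_inverse s (1000 * r ^ 3) (fun s' =>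
    forall e, (e < r * r)%N -> rd s' sInv e = ginv_iter G r e).
Proof.
move=> rs GE; have es := ready_env rs.
apply: safe_time.
  apply: (safe_Seq (Q1 := fun s' => forall e, (e < r * r)%N -> rd s' sInv e = 0)).
    apply: safe_post.
      apply: (@safe_fill R W 0 _ _ s sInv 0 (r * r) (fun=> 0)).
      - by rewrite !evalE (env_r es).
      - exact: qW.
      move=> e s1 er f1 e1 _; have rs1 := ready_frame r0 f1 isT rs.
      apply: safe_RStore; rewrite !evalE e1; split.
        by rewrite rd_set_rmem !eqxx !andTb (sizeS rs1) // small.
      by move=> k kn; rewrite rd_set_rmem (negbTE kn) andbF.
    by move=> s' H e er; rewrite H /= add0n er.
  move=> s1 I1 f1; have rs1 := ready_frame r0 f1 isT rs.
  have es1 := ready_env rs1.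
  have G1 e : (e < r * r)%N -> rd s1 sAll e = G e by move=> er; rewrite (frame_rd f1) // GE.
  apply: (@safe_loop R W 16 _ _ s1 r (fun=> 400 * (r * r))%N
    (fun x s' => forall e, (e < r * r)%N -> rd s' sInv e = ginv_iter G x e)).
  - by rewrite !evalE (env_r es1).
  - exact: rW.
  - exact: I1.
  - by [].
  move=> c s2 cr f2 c2 I2; have rs2 := ready_frame r0 f2 isT rs1.
  have es2 := ready_env rs2.
  have G2 e : (e < r * r)%N -> rd s2 sAll e = G e by move=> er; rewrite (frame_rd f2) // G1.
  set X := ginv_iter G c in I2.
  pose S a := \sum_(b < r) X (a * r + b)%N * G (b * r + c)%N.
  apply: safe_time.
    apply: (safe_Seq (Q1 := fun s' => forall a, (a < r)%N -> rd s' sDir a = 0 - S a)).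
      apply: safe_post.
        apply: (@safe_fill R W 3 _ _ s2 sDir 0 r (fun a => 0 - S a)).
        - by rewrite !evalE (env_r es2).
        - exact: rW.
        move=> a s3 ar f3 a3 _; have rs3 := ready_frame r0 f3 isT rs2.
        have es3 := ready_env rs3.
        apply: safe_Seq.
          apply: (safe_sum_into (i0 := a) (n := r) (F := fun b => X (a * r + b)%N * G (b * r + c)%N)).
          + by rewrite !evalE (env_r es3).
          + exact: rW.
          + by rewrite (sizeS rs3) // smallr.
          + by rewrite !evalE a3.
          move=> b s4 br f4 b4 _; have es4 := env_frame f4 isT es3.
          rewrite !evalE b4 (env_r es4) !(frame_reg f4) // a3 (frame_reg f3) // c2.
          by rewrite !(frame_rd f4) // !(frame_rd f3) // I2 ?G2 // flat_lt.
        move=> s4 [h1 h2] f4; have rs4 := ready_frame r0 f4 isT rs3.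
        apply: safe_RStore; rewrite !evalE (frame_reg f4) // a3; split.
          by rewrite rd_set_rmem !eqxx !andTb (sizeS rs4) ?smallr // h1.
        by move=> k kn; rewrite rd_set_rmem (negbTE kn) andbF h2.
      by move=> s' H a ar; rewrite H /= add0n ar subn0.
    move=> s3 I3 f3; have rs3 := ready_frame r0 f3 isT rs2.
    apply: (safe_Seq (Q1 := fun s' => forall a, (a < r)%N -> rd s' sDir a = inv_dir X G c a)).
      apply: safe_RStore; rewrite !evalE (frame_reg f3) // c2 => a ar.
      rewrite rd_set_rmem_add eqxx andTb (sizeS rs3) ?smallr // andbT I3 //.
      by rewrite /inv_dir sub0r addrC.
    move=> s4 I4 f4; have rs4 := ready_frame r0 f4 isT rs3.
    have es4 := ready_env rs4.
    apply: safe_Seq.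
      apply: (safe_sum_into (i0 := 0%N) (n := r) (F := fun t => inv_dir X G c t * G (t * r + c)%N)).
      + by rewrite !evalE (env_r es4).
      + exact: rW.
      + exact: (sizeS rs4).
      + by [].
      move=> t s5 tr f5 t5 _; have es5 := env_frame f5 isT es4.
      rewrite !evalE t5 (env_r es5) (frame_reg f5) // (frame_reg f4) // (frame_reg f3) // c2.
      by rewrite !(frame_rd f5) // I4 // (frame_rd f4) // (frame_rd f3) // G2 ?flat_lt.
    move=> s5 [d5 _] f5; have rs5 := ready_frame r0 f5 isT rs4.
    have es5 := ready_env rs5.
    apply: safe_post.
      apply: (@safe_fill R W 0 _ _ s5 sInv 0 (r * r) (inv_step X G c)).
      - by rewrite !evalE (env_r es5).
      - exact: qW.
      move=> e s6 er f6 e6 I6; have rs6 := ready_frame r0 f6 isT rs5.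
      have es6 := ready_env rs6.
      apply: safe_RStore; rewrite !evalE e6 (env_r es6) mod_sub; split; last first.
        by move=> k kn; rewrite rd_set_rmem (negbTE kn) andbF.
      rewrite rd_set_rmem !eqxx !andTb (sizeS rs6) ?small // I6 add0n ltnn andbF.
      rewrite !(frame_rd f6) // d5 (frame_rd f5) // !(frame_rd f5) //.
      rewrite !I4 ?ltn_mod ?ltn_divLR // (frame_rd f4) // (frame_rd f3) // I2 //.
    by move=> s6 H e er; rewrite H /= add0n er subn0.
  by rewrite /=; have := r0; clear; nia.
rewrite sum_nat_const card_ord /=; have -> : (r ^ 3 = r * (r * r))%N by rewrite !expnS expn0 muln1.
have : (r <= r * r)%N by rewrite leq_pmulr.
have : (r * r <= r * (r * r))%N by rewrite leq_pmull.
by have : (0 < r)%N := r0; move: (r * r)%N => q; clear; nia.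
Qed.

Lemma conditional_matrix_safe s k0 X : ready s -> (k0 < m)%N ->
  (forall e, (e < r * r)%N -> [/\ rd s sGram e = gram_entry r n u (f k0) e, rd s sInv e = X e,
     rd s sProd e = nonzero_prod r n u m f k0 e & rd s sZero e = zero_count r n u m f k0 e]) ->
  safe W conditional_matrix s (100 * r ^ 3) (fun s' => forall e, (e < r * r)%N ->
    [/\ rd s' sProd e = nonzero_prod r n u m f k0.+1 e,
        rd s' sZero e = zero_count r n u m f k0.+1 e &
        rd s' sMat e = X e * gram_suffix r n u m f k0.+1 e]).
Proof.
move=> rs k0m H; have es := ready_env rs.
have PS e : nonzero_prod r n u m f k0 e =
    (if gram_entry r n u (f k0) e == 0 then 1 else gram_entry r n u (f k0) e) * nonzero_prod r n u m f k0.+1 e.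
  by rewrite /nonzero_prod big_ltn.
have ZS e : zero_count r n u m f k0 e =
    (if gram_entry r n u (f k0) e == 0 then 1 else 0) + zero_count r n u m f k0.+1 e.
  by rewrite /zero_count big_ltn.
apply: safe_mono.
- apply: (@safe_loop R W 0 _ _ s (r * r) (fun=> 80)%N (fun x s' => forall e, (e < r * r)%N ->
    [/\ rd s' sProd e = nonzero_prod r n u m f (if (e < x)%N then k0.+1 else k0) e,
        rd s' sZero e = zero_count r n u m f (if (e < x)%N then k0.+1 else k0) e &
        (e < x)%N -> rd s' sMat e = X e * gram_suffix r n u m f k0.+1 e])).
  - by rewrite !evalE (env_r es).
  - exact: qW.
  - by move=> e er; have [] := H e er; split.
  - by [].
  move=> e s1 er f1 e1 I1; have rs1 := ready_frame r0 f1 isT rs.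
  have [gE xE _ _] := H e er; have [pE zE _] := I1 e er; rewrite ltnn in pE zE.
  have Ge : rd s1 sGram e = gram_entry r n u (f k0) e by rewrite (frame_rd f1).
  apply: safe_time.
    apply: (safe_Seq (Q1 := fun s' => forall e', (e' < r * r)%N ->
      [/\ rd s' sProd e' = nonzero_prod r n u m f (if (e' < e.+1)%N then k0.+1 else k0) e',
          rd s' sZero e' = zero_count r n u m f (if (e' < e.+1)%N then k0.+1 else k0) e' &
          (e' < e)%N -> rd s' sMat e' = X e' * gram_suffix r n u m f k0.+1 e'])).
      apply: safe_if_zero => g0; apply: safe_RStore; rewrite !evalE e1 Ge in g0 *;
        move=> e' e'r; rewrite !rd_set_rmem /= !(sizeS rs1) ?small // ?andbT;
        have [i1 i2 i3] := I1 e' e'r; have [ee|ne] := eqVneq e' e.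
      - rewrite ee ltnn in i1 i2 i3 *; rewrite ltnSn i1 i2 PS ZS g0 eqxx mul1r.
        by split=> //; ring.
      - by have -> : (e' < e.+1)%N = (e' < e)%N by lia.
      - rewrite ee ltnn in i1 i2 i3 *; rewrite ltnSn i1 i2 PS ZS (negbTE g0) add0r.
        by split=> //; field.
      - by have -> : (e' < e.+1)%N = (e' < e)%N by lia.
    move=> s2 I2 f2; have rs2 := ready_frame r0 f2 isT rs1.
    have [p2 z2 _] := I2 e er; rewrite ltnSn in p2 z2.
    have x2 : rd s2 sInv e = X e by rewrite (frame_rd f2) // (frame_rd f1).
    have e2 : reg s2 0 = e by rewrite (frame_reg f2).
    have fin v : v = X e * gram_suffix r n u m f k0.+1 e -> forall e', (e' < r * r)%N ->
      [/\ rd (set_rmem s2 sMat e v) sProd e' = nonzero_prod r n u m f (if (e' < e.+1)%N then k0.+1 else k0) e',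
          rd (set_rmem s2 sMat e v) sZero e' = zero_count r n u m f (if (e' < e.+1)%N then k0.+1 else k0) e' &
          (e' < e.+1)%N -> rd (set_rmem s2 sMat e v) sMat e' = X e' * gram_suffix r n u m f k0.+1 e'].
      move=> vE e' e'r; have [i1 i2 i3] := I2 e' e'r; rewrite !rd_set_rmem /=; split=> // e'e.
      rewrite (sizeS rs2) ?small // andbT; have [->|ne] := eqVneq e' e; first by rewrite vE.
      by apply: i3; lia.
    apply: safe_IfR; rewrite !evalE e2 z2 => cmp; apply: safe_RStore; rewrite !evalE e2;
      apply: fin.
      by rewrite x2 p2 -suffix_prodE cmp.
    by rewrite -suffix_prodE ifF ?mulr0 //; apply/negbTE; rewrite -ltNge.
  by [].
- by rewrite sum_nat_const card_ord /=; have := rr_le r0; have := small0; lia.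
by move=> s' Hs e er; have [h1 h2 h3] := Hs e er; rewrite er in h1 h2 h3; split=> //; apply: h3.
Qed.

Lemma factorize_safe s G M : ready s ->
  (forall e, (e < r * r)%N -> rd s sGram e = G e /\ rd s sMat e = M e) ->
  safe W factorize s (1000 * r ^ 3) (fun s' =>
    [/\ forall v a, (v < r)%N -> (a < r)%N -> rd s' sFac (v * r + a) = ldl_iter M v (a * r + v)%N,
        forall v e, (v < r)%N -> (e < r * r)%N ->
          node r s' sTree 0 (r + v) e = ldl_term (ldl_iter M v) v e * G e &
        heap r s' sTree 0 r]).
Proof.
move=> rs H; have es := ready_env rs.
pose I x s' := [/\ forall e, (e < r * r)%N -> rd s' sMat e = ldl_iter M x e,
  forall v a, (v < x)%N -> (a < r)%N -> rd s' sFac (v * r + a) = ldl_iter M v (a * r + v)%N &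
  forall v e, (v < x)%N -> (e < r * r)%N ->
          node r s' sTree 0 (r + v) e = ldl_term (ldl_iter M v) v e * G e].
apply: safe_time.
  apply: (safe_Seq (Q1 := I r)).
    apply: (@safe_loop R W 9 _ _ s r (fun=> 300 * (r * r))%N I).
    - by rewrite !evalE (env_r es).
    - exact: rW.
    - by split=> // e er; have [] := H e er.
    - by [].
    move=> v s1 vr f1 v1 [h1 h2 h3]; have rs1 := ready_frame r0 f1 isT rs.
    have es1 := ready_env rs1.
    set Mv := ldl_iter M v in h1.
    apply: safe_time.
      apply: safe_Seq.
        apply: (@safe_fill R W 16 _ _ s1 sFac (v * r) r (fun a => Mv (a * r + v)%N)).
        - by rewrite !evalE (env_r es1).
        - exact: rW.
        move=> a s2 ar f2 a2 _; have rs2 := ready_frame r0 f2 isT rs1.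
        have es2 := ready_env rs2.
        apply: safe_RStore; rewrite !evalE a2 (env_r es2) (frame_reg f2) // v1; split; last first.
          by move=> k kn; rewrite rd_set_rmem (negbTE kn) andbF.
        rewrite rd_set_rmem !eqxx !andTb (sizeS rs2) //; last by rewrite small ?flat_lt.
        by rewrite (frame_rd f2) // h1 ?flat_lt.
      move=> s2 I2 f2; have rs2 := ready_frame r0 f2 isT rs1.
      have es2 := ready_env rs2.
      have fac a : (a < r)%N -> rd s2 sFac (v * r + a) = Mv (a * r + v)%N.
        by move=> ar; rewrite I2 ifT ?addKn //; lia.
      have term s3 e : reg s3 9 = v -> ird s3 Inp 1 = r ->
          (forall a, rd s3 sFac a = rd s2 sFac a) -> (e < r * r)%N -> reg s3 0 = e ->
          reval s3 eTerm = ldl_term Mv v e.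
        move=> v3 r3 fac3 er e3; rewrite /eTerm !evalE e3 v3 r3 mod_sub !fac3.
        by rewrite !fac ?ltn_mod ?ltn_divLR.
      apply: safe_Seq.
        apply: (@safe_fill R W 0 _ _ s2 sTree ((r + v) * (r * r)) (r * r)
          (fun e => ldl_term Mv v e * G e)).
        - by rewrite !evalE (env_r es2).
        - exact: qW.
        move=> e s3 er f3 e3 _; have rs3 := ready_frame r0 f3 isT rs2.
        have es3 := ready_env rs3.
        have T3 : reval s3 eTerm = ldl_term Mv v e.
          apply: term => //; last by move=> a; rewrite (frame_rd f3).
            by rewrite (frame_reg f3) // (frame_reg f2).
          exact: env_r es3.
        apply: safe_RStore; rewrite reval_mul T3 !evalE e3 (env_r es3).
        rewrite (frame_reg f3) // (frame_reg f2) // v1; split; last first.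
          by move=> k kn; rewrite rd_set_rmem (negbTE kn) andbF.
        rewrite rd_set_rmem !eqxx !andTb ifT; last first.
          have := ready_size rs3 (isT : 11 < 14)%N; apply: leq_trans.
          have -> : (2 * r ^ 3 = r * (r * r) + r * (r * r))%N by rewrite !expnS expn0 muln1; lia.
          have : (v.+1 * (r * r) <= r * (r * r))%N by rewrite leq_mul2r vr orbT.
          by rewrite mulSn mulnDl; lia.
        rewrite (frame_rd f3) // (frame_rd f2) // (frame_rd f1) //.
        by have [-> _] := H e er.
      move=> s3 I3 f3; have rs3 := ready_frame r0 f3 isT rs2.
      have es3 := ready_env rs3.
      apply: safe_post; first apply: safe_frame.
        apply: (@safe_fill R W 0 _ _ s3 sMat 0 (r * r) (ldl_iter M v.+1)).
        - by rewrite !evalE (env_r es3).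
        - exact: qW.
        move=> e s4 er f4 e4 I4; have rs4 := ready_frame r0 f4 isT rs3.
        have T4 : reval s4 eTerm = ldl_term Mv v e.
          apply: term => //; last by move=> a; rewrite (frame_rd f4) // (frame_rd f3).
            by rewrite (frame_reg f4) // (frame_reg f3) // (frame_reg f2).
          exact: env_r (ready_env rs4).
        apply: safe_RStore; rewrite reval_sub T4 !evalE e4; split; last first.
          by move=> k kn; rewrite rd_set_rmem (negbTE kn) andbF.
        rewrite rd_set_rmem !eqxx !andTb (sizeS rs4) ?small // I4 add0n ltnn andbF.
        by rewrite (frame_rd f3) // (frame_rd f2) // h1.
      move=> s4 [I4 f4]; split.
      - by move=> e er; rewrite I4 /= add0n er subn0.
      - move=> v' a v'v ar; rewrite (frame_rd f4) // (frame_rd f3) // I2.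
        have [->|ne] := eqVneq v' v; first by rewrite ifT ?addKn //; lia.
        have lt : (v'.+1 * r <= v * r)%N by rewrite leq_mul2r; lia.
        by rewrite ifF ?h2 //; [lia|apply/negP; rewrite mulSn in lt; lia].
      - move=> v' e v'v er; rewrite /node (frame_rd f4) // I3 (node_in 0) // eqn_add2l.
        case: eqP => [->|ne]; first by rewrite add0n addKn.
        by rewrite (frame_rd f2) // -/(node r s1 sTree 0 _ _) h3 //; lia.
    by rewrite /=; have := r0; clear; nia.
  move=> s1 [h1 h2 h3] f1; have rs1 := ready_frame r0 f1 isT rs.
  apply: (safe_Seq_SetReg (v := 0%N)) => //; first exact: (lt_W r0 hW).
  move=> s2 f2 b2; have rs2 := ready_frame r0 f2 isT rs1.
  apply: (safe_Seq_SetReg (v := r)).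
  - by rewrite !evalE (env_r (ready_env rs2)).
  - by apply: (lt_W r0 hW); have := r_le r0; lia.
  move=> s3 f3 B3; have rs3 := ready_frame r0 f3 isT rs2.
  apply: safe_post; first apply: safe_frame.
    apply: (@add_nodes_safe R W N r n r0 hW sTree s3 0 r) => //.
    - exact: ready_env rs3.
    - by rewrite (frame_reg f3).
    - by apply: (lt_W r0 hW); have := r_le r0; lia.
    - have := ready_size rs3 (isT : 11 < 14)%N; apply: leq_trans.
      by rewrite !expnS expn0 muln1; lia.
  move=> s4 [[Hh Hk] f4]; split=> //.
    by move=> v a vr ar; rewrite (frame_rd f4) // (frame_rd f3) // (frame_rd f2) // h2.
  move=> v e vr er; rewrite -h3 // /node Hk.
    by rewrite (frame_rd f3) // (frame_rd f2).
  by rewrite mulnDl; lia.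
rewrite sum_nat_const card_ord /=; have -> : (r ^ 3 = r * (r * r))%N by rewrite !expnS expn0 muln1.
have : (r <= r * r)%N by rewrite leq_pmulr.
have : (r * r <= r * (r * r))%N by rewrite leq_pmull.
by have : (0 < r)%N := r0; move: (r * r)%N => q; clear; nia.
Qed.

End Elimination.

(** * Drawing one index *)

Section TreeSum.
Variables (R : realType) (B : nat) (F : nat -> R).

(** The sum of F over the leaves below [i], where [l] is the number of iterations that the descent
    has left. *)
Fixpoint tree_sum l i : R :=
  if l is l'.+1 then
    if (B <= i)%N then F i else tree_sum l' (2 * i)%N + tree_sum l' (2 * i + 1)%N
  else F i.

Lemma tree_sum_leaf l i : (B <= i)%N -> tree_sum l i = F i.
Proof. by case: l => //= l ->. Qed.

(** The leftmost descendant of [i] at distance [l] is [i * 2 ^ l] and has the least number; if it is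
    a leaf, more depth adds nothing. *)
Lemma tree_sumS l i : (B <= i * 2 ^ l)%N -> tree_sum l.+1 i = tree_sum l i.
Proof.
elim: l i => [|l IH] i Bi; first by rewrite /= ifT //; lia.
rewrite [LHS]/= [RHS]/=; case: ifP => // _.
by rewrite -[tree_sum l (2 * i)%N]IH -?[tree_sum l (2 * i + 1)%N]IH //; rewrite expnS in Bi; nia.
Qed.

Lemma tree_sum_root l : (0 < B)%N -> (B <= 2 ^ l)%N ->
  tree_sum l 1 = \sum_(b < B) F (B + b)%N.
Proof.
move=> B0 Bl; rewrite (heap_root B0 (S := tree_sum l)) => [|i /andP [i0 iB]].
  by apply: eq_bigr => b _; rewrite tree_sum_leaf // leq_addr.
transitivity (tree_sum l.+1 i); last by rewrite /= leqNgt iB.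
by rewrite tree_sumS // (leq_trans Bl) // leq_pmull.
Qed.

End TreeSum.

Section Random.
Variables (R : realType) (W N r : nat) (n : nat -> nat).
Implicit Types s : state R.
Hypothesis r0 : (0 < r)%N.
Local Notation off := (row_offset r n).
Local Notation env := (env N r n).

Definition quad_form (z Q : nat -> R) : R :=
  \sum_(e < r * r) z (e %/ r)%N * z (e %% r)%N * Q e.

Hypothesis hW : (16 * (off N + r ^ 3) <= W)%N.

Lemma quad_safe a node dst s base nd z : env s -> reg s 11 = base ->
  (forall s', reg s' 4 = reg s 4 -> ieval s' node = nd) -> (icost node <= 10)%N ->
  (forall c, (c < r)%N -> rd s sVec c = z c) -> (0 < size (rmem s dst))%N ->
  dst != a -> dst != sVec ->
  safe W (quad a node dst) s (100 * (r * r)) (fun s' =>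
    rd s' dst 0 = quad_form z (fun e => rd s a (base + nd * (r * r) + e))).
Proof.
move=> es rb ndE nc zE sz da dv.
have qW : (r * r <= W)%N by apply/ltnW/(lt_W r0 hW); have := rr_le r0; lia.
apply: safe_mono.
- apply: (safe_sum_into (i0 := 0%N) (n := (r * r)%N)
    (F := fun e => z (e %/ r)%N * z (e %% r)%N * rd s a (base + nd * (r * r) + e))).
  + by rewrite !evalE (env_r es).
  + exact: qW.
  + exact: sz.
  + by [].
  move=> e s1 er f1 e1 _; have es1 := env_frame f1 isT es.
  have nE : ieval s1 node = nd by apply: ndE; rewrite (frame_reg f1).
  rewrite !evalE nE e1 (env_r es1) mod_sub (frame_reg f1) // rb; split=> //.
  rewrite !(frame_rd f1) /= ?inE ?orbb 1?eq_sym // 1?eq_sym //.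
  by rewrite !zE ?ltn_mod ?ltn_divLR.
- have q0 : (0 < r * r)%N by rewrite muln_gt0 r0.
  by rewrite /=; move: (icost node) nc (r * r)%N q0 => k nc q q0; nia.
by move=> s' [].
Qed.

Section Descend.
(* The weight of the root is not read from the memory, so that a tree with a
   single leaf need not be stored. *)
Variables (a : region) (s : state R) (base B : nat) (z w : nat -> R).
Hypothesis aAcc : a != sAcc.
Hypothesis aAcc2 : a != sAcc2.
Hypothesis es : env s.
Hypothesis rb : reg s 11 = base.
Hypothesis rB : reg s 12 = B.
Hypothesis B0 : (0 < B)%N.
Hypothesis BN : (B <= off N)%N.
Hypothesis zE : forall c, (c < r)%N -> rd s sVec c = z c.
Hypothesis wE : forall i, (1 < i < 2 * B)%N -> quad_form z (node r s a base i) = w i.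
Hypothesis wS : forall i, (0 < i < B)%N -> w i = w (2 * i)%N + w (2 * i + 1)%N.
Hypothesis sz1 : (0 < size (rmem s sAcc))%N.
Hypothesis sz2 : (0 < size (rmem s sAcc2))%N.
Hypothesis leaf_ge0 : forall b, (b < B)%N -> 0 <= w (B + b)%N.
Hypothesis root_gt0 : 0 < w 1%N.

Let L := (trunc_log 2 B + 1)%N.

Let w_ge0 i : (0 < i < 2 * B)%N -> 0 <= w i.
Proof.
move: {2}(2 * B - i)%N (leqnn (2 * B - i)) => k; elim: k i => [|k IH] i ik iB; first by lia.
have [Bi|iB'] := leqP B i; first by rewrite -(subnKC Bi) leaf_ge0 //; lia.
by rewrite wS ?addr_ge0 ?IH //; lia.
Qed.

(** An inner node reached after [l] iterations has depth at least [l], so that after [L] of them, as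
    B < 2^L, the walk is at a leaf. Its weight stays positive since branches of probability zero are
    not followed, and so the next quotient is a probability. *)
Let inv l (s' : state R) := [/\ (0 < reg s' 4 < 2 * B)%N,
  (reg s' 4 < B)%N -> (2 ^ l <= reg s' 4)%N & 0 < w (reg s' 4)].

Let LB : (B < 2 ^ L)%N.
Proof. by rewrite /L addn1; exact: trunc_log_ltn. Qed.

Let LW : (L <= W)%N.
Proof.
apply/ltnW/(lt_W r0 hW); have := trunc_logP (isT : 1 < 2)%N B0.
by have := ltn_expl (trunc_log 2 B) (isT : 1 < 2)%N; rewrite /L; move: (2 ^ _)%N => p; lia.
Qed.

Let BW : (2 * B < W)%N. Proof. by apply: (lt_W r0 hW); lia. Qed.

Let loop_body := (IfI vBn vNode Skip
       (quad a (#2 * vNode)%ie sAcc ;;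
        quad a (#2 * vNode + #1)%ie sAcc2 ;;
        Flip (sAcc![#0] / (sAcc![#0] + sAcc2![#0]))%re
          (SetReg 4 (#2 * vNode)%ie) (SetReg 4 (#2 * vNode + #1)%ie))).
Let loop_cmd := For 5 (eLg vBn + #1)%ie loop_body.

Let init_state := set_reg W s 4 1.

Let frame_fact s1 : frame loop_cmd init_state s1 ->
  [/\ env s1, reg s1 11 = base, reg s1 12 = B, forall c, (c < r)%N -> rd s1 sVec c = z c &
   (forall k, rd s1 a k = rd s a k) /\ forall x, size (rmem s1 x) = size (rmem s x)].
Proof.
move=> f1; split.
- apply: (env_frame f1) => //; exact: env_eq es.
- by rewrite (frame_reg f1).
- by rewrite (frame_reg f1).
- by move=> c cr; rewrite (frame_rd f1) // -zE.
split=> [k|x]; last by rewrite (frame_rsize _ f1).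
by rewrite (frame_rd f1) // !inE /= (negbTE aAcc) (negbTE aAcc2).
Qed.

Let split_weights s1 : frame loop_cmd init_state s1 -> (0 < reg s1 4 < B)%N ->
  let nd := reg s1 4 in
  safe W (quad a (#2 * vNode)%ie sAcc) s1 (100 * (r * r)) (fun s2 =>
    rd s2 sAcc 0 = w (2 * nd)%N /\ frame (quad a (#2 * vNode)%ie sAcc) s1 s2) /\
  forall s2, rd s2 sAcc 0 = w (2 * nd)%N -> frame (quad a (#2 * vNode)%ie sAcc) s1 s2 ->
  safe W (quad a (#2 * vNode + #1)%ie sAcc2) s2 (100 * (r * r)) (fun s3 =>
    [/\ rd s3 sAcc 0 = w (2 * nd)%N, rd s3 sAcc2 0 = w (2 * nd + 1)%N & reg s3 4 = nd]).
Proof.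
move=> f1 nB nd; have [e1 b1 B1 z1 [a1 s1E]] := frame_fact f1.
have wE1 i : (1 < i < 2 * B)%N -> quad_form z (fun e => rd s1 a (base + i * (r * r) + e)) = w i.
  by move=> iB; rewrite -wE //; apply: eq_bigr => e _; rewrite a1.
split.
  apply: safe_post; first apply: safe_frame.
    apply: (@quad_safe a (#2 * vNode)%ie sAcc s1 base (2 * nd)%N z) => //.
    - by move=> s' e'; rewrite !evalE e'.
    - by rewrite s1E.
    - by rewrite eq_sym.
  by move=> s2 [h f2]; split=> //; rewrite h wE1 //; lia.
move=> s2 l2 f2; have e2 := env_frame f2 isT e1.
apply: safe_post; first apply: safe_frame.
  apply: (@quad_safe a (#2 * vNode + #1)%ie sAcc2 s2 base (2 * nd + 1)%N z) => //.
  - by rewrite (frame_reg f2).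
  - by move=> s' e'; rewrite !evalE e' (frame_reg f2).
  - by move=> c cr; rewrite (frame_rd f2) // z1.
  - by rewrite (frame_rsize _ f2) s1E.
  - by rewrite eq_sym.
move=> s3 [h f3]; split.
- by rewrite (frame_rd f3).
- rewrite h -wE1; last by lia.
  apply: eq_bigr => e _; rewrite (frame_rd f2) //.
  by rewrite /= !inE orbb (negbTE aAcc).
- by rewrite (frame_reg f3) // (frame_reg f2).
Qed.

Let prob nd : 0 < w nd -> (0 < nd < B)%N ->
  clamp (w (2 * nd)%N / (w (2 * nd)%N + w (2 * nd + 1)%N)) = w (2 * nd)%N / w nd.
Proof.
move=> w0 nB; rewrite -(wS nB); apply: clamp_id.
have l0 : 0 <= w (2 * nd)%N by apply: w_ge0; lia.
have r0' : 0 <= w (2 * nd + 1)%N by apply: w_ge0; lia.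
by rewrite divr_ge0 ?(ltW w0) //= ler_pdivrMr // mul1r (wS nB) lerDl.
Qed.

Let body_safe l s1 : (l < L)%N -> frame loop_cmd init_state s1 -> inv l s1 ->
  safe W loop_body s1 (250 * (r * r)) (inv l.+1).
Proof.
move=> lL f1 [n1 n2 n3]; have [e1 b1 B1 z1 [a1 s1E]] := frame_fact f1.
have q0 : (0 < r * r)%N by rewrite muln_gt0 r0.
have [Bn|nB] := leqP B (reg s1 4).
  apply: safe_time.
    apply: safe_IfI_then; first by rewrite !evalE B1.
    by apply: safe_Skip; split=> //; lia.
  by rewrite /=; lia.
have nB' : (0 < reg s1 4 < B)%N by lia.
have [h1 h2] := split_weights f1 nB'.
apply: safe_time.
  apply: safe_IfI_else; first by rewrite !evalE B1.
  apply: (safe_Seq0 h1) => s2 [l2 f2]; apply: (safe_Seq0 (h2 s2 l2 f2)) => s3 [l3 r3 n4].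
  have pE : clamp (reval s3 (sAcc![#0] / (sAcc![#0] + sAcc2![#0]))%re) =
      w (2 * reg s1 4)%N / w (reg s1 4) by rewrite !evalE l3 r3 prob.
  have w1 : w (reg s1 4) != 0 by rewrite gt_eqF.
  apply: safe_Flip; rewrite pE => p01; apply: safe_SetReg;
    rewrite /inv reg_set_reg eqxx !evalE n4 modn_small; try lia.
    split; [by lia|by rewrite expnS; have := n2 nB; lia|].
    rewrite lt_neqAle w_ge0 ?andbT; last by lia.
    by apply: contra p01 => /eqP <-; rewrite mul0r.
  split; [by lia|by rewrite expnS; have := n2 nB; lia|].
  rewrite lt_neqAle w_ge0 ?andbT; last by lia.
  apply: contra p01 => /eqP w0.
  have := wS nB'; rewrite -w0 addr0 => ->; rewrite divff //.
  by rewrite (wS nB') -w0 addr0 in w1.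
by rewrite /=; lia.
Qed.

Let inv0 : inv 0 init_state.
Proof. by rewrite /inv /init_state reg_set_reg eqxx modn_small; [split; [lia|lia|]|lia]. Qed.

Let eL : ieval init_state (eLg vBn + #1)%ie = L.
Proof.
by rewrite !evalE /init_state reg_set_reg /= rB ird_set_reg (env_lg es).
Qed.

Let step_safe l s1 : (l < ieval init_state (eLg vBn + #1)%ie)%N ->
  frame loop_cmd init_state s1 /\ inv l s1 ->
  safe W loop_body (set_reg W s1 5 l) (250 * (r * r))
    (fun s' => frame loop_cmd init_state s' /\ inv l.+1 s').
Proof.
rewrite eL => lL [f1 i1]; have f1' := @frame_For _ W _ _ _ _ _ l f1.
apply: safe_post; first exact: safe_frame (body_safe lL f1' i1).
move=> s2 [i2 f2]; split=> //; apply: framed_trans f1' _.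
by apply: framed_sub f2 => // y yc; rewrite inE yc orbT.
Qed.

Let loop_safe : safe W loop_cmd init_state (5 + \sum_(l < L) (250 * (r * r)).+1)
  (fun s' => frame loop_cmd init_state s' /\ inv L s').
Proof.
have H : safe W loop_cmd init_state _ _ := @safe_For0 R W 5 _ _ init_state (fun=> 250 * (r * r))%N
  (fun l s' => frame loop_cmd init_state s' /\ inv l s')
  (conj (framed_refl _ _ _ _) inv0) step_safe.
by rewrite eL in H.
Qed.

Let final s' : inv L s' -> [/\ (B <= reg s' 4)%N, (reg s' 4 < 2 * B)%N & 0 < w (reg s' 4)].
Proof.
case=> h1 h2 h3; split=> //; last by lia.
by rewrite leqNgt; apply/negP => lt; have := h2 lt; have := LB; lia.
Qed.

Lemma descend_safe : safe W (descend a) s (300 * (r * r * (trunc_log 2 B + 1)))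
  (fun s' => exists2 b, (b < B)%N & reg s' 4 = (B + b)%N /\ 0 < w (B + b)%N).
Proof.
have q0 : (0 < r * r)%N by rewrite muln_gt0 r0.
apply: safe_time.
  apply: (safe_Seq0 (Q1 := fun s' => s' = init_state)).
    by apply: safe_SetReg.
  move=> _ ->; apply: safe_post loop_safe _ => s' [_ /final [h1 h2 h3]].
  by exists (reg s' 4 - B)%N; [lia|rewrite subnKC].
rewrite sum_nat_const card_ord /= /L; move: (trunc_log 2 B) (r * r)%N q0; clear; nia.
Qed.

Lemma wp_descend phi g :
  (forall b s', (b < B)%N -> reg s' 4 = (B + b)%N -> 0 < w (B + b)%N ->
     frame (descend a) s s' -> phi s' = g (B + b)%N) ->
  wp W (descend a) s phi = \sum_(b < B) w (B + b)%N / w 1%N * g (B + b)%N.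
Proof.
move=> phiE.
(* Below a node of weight zero all weights vanish. This covers the child whose weight cannot be
   cancelled in the quotients. *)
have F0 l i : (0 < i < 2 * B)%N -> w i = 0 -> tree_sum B (fun p => w p * g p) l i = 0.
  elim: l i => [|l IH] i iB wi; first by rewrite /= wi mul0r.
  rewrite /=; case: leqP => Bi; first by rewrite wi mul0r.
  have iB' : (0 < i < B)%N by lia.
  have := wS iB'; rewrite wi => /esym/eqP.
  rewrite paddr_eq0; [|by apply: w_ge0; lia|by apply: w_ge0; lia].
  by case/andP => /eqP w1 /eqP w2; rewrite !IH ?addr0 //; lia.
(* The conditional expectation of [g] at the final leaf given the current node: the weighted mean of
   [g] over the leaves below it. *)
pose psi l (s' : state R) := tree_sum B (fun p => w p * g p) (L - l) (reg s' 4) / w (reg s' 4).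
have -> : wp W (descend a) s phi = wp W loop_cmd init_state phi by rewrite wp_Seq wp_SetReg.
rewrite (eq_wp (g := psi L) loop_safe); last first.
  move=> s' [f' /final [h1 h2 h3]].
  rewrite /psi subnn /= [_ * g _]mulrC mulfK ?gt_eqF //.
  rewrite -(subnKC h1); apply: phiE; rewrite ?subnKC //; first by lia.
  apply: (@framed_trans _ _ _ _ _ init_state).
    by apply: framed_set_reg; rewrite inE.
  by apply: framed_sub f' => // y yc; rewrite inE yc orbT.
rewrite -eL (@wp_For R W 5 _ _ init_state (fun=> 250 * (r * r))%N
  (fun l s' => frame loop_cmd init_state s' /\ inv l s') psi).
- rewrite /psi subn0 /init_state reg_set_reg eqxx modn_small; last by lia.
  rewrite tree_sum_root //; last by apply: ltnW.
  by rewrite big_distrl /=; apply: eq_bigr => b _; rewrite mulrAC.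
- by split; [exact: framed_refl|exact: inv0].
- exact: step_safe.
move=> l s1; rewrite eL => lL [f1 [n1 n2 n3]].
set s1' := set_reg W s1 5 l.
have f1' : frame loop_cmd init_state s1' := @frame_For _ W _ _ _ _ _ l f1.
have [e1 b1 B1 z1 _] := frame_fact f1'.
have LE : (L - l = (L - l.+1).+1)%N by lia.
rewrite /loop_body wp_IfI !evalE B1 (_ : reg s1' 4 = reg s1 4) //.
rewrite [RHS]/psi LE /=; have [Bn|nB] := leqP B (reg s1 4).
  by rewrite wp_Skip /psi /= tree_sum_leaf.
have nB' : (0 < reg s1' 4 < B)%N by rewrite /=; lia.
have [h1 h2] := split_weights f1' nB'.
apply: (wp_Seq_safe h1) => s2 [l2 f2]; apply: (wp_Seq_safe (h2 s2 l2 f2)) => s3 [l3 r3 n4].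
have {}n4 : reg s3 4 = reg s1 4 := n4.
have {}l3 : rd s3 sAcc 0 = w (2 * reg s1 4)%N := l3.
have {}r3 : rd s3 sAcc2 0 = w (2 * reg s1 4 + 1)%N := r3.
have {}nB' : (0 < reg s1 4 < B)%N := nB'.
rewrite wp_Flip !wp_SetReg !evalE l3 r3 n4 prob //.
rewrite /psi !reg_set_reg !eqxx !modn_small; try lia.
set nd := reg s1 4 in n1 n3 nB nB' *.
have w1 : w nd != 0 by rewrite gt_eqF.
have -> : 1 - w (2 * nd)%N / w nd = w (2 * nd + 1)%N / w nd.
  by rewrite -(divff w1) -mulrBl {1}(wS nB') addrC addKr.
(* The probability of moving to a child times the mean over its leaves is the share of this child in
   the sum at the parent. *)
have half i : (0 < i < 2 * B)%N ->
   w i / w nd * (tree_sum B (fun p => w p * g p) (L - l.+1) i / w i) =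
   tree_sum B (fun p => w p * g p) (L - l.+1) i / w nd.
  move=> iB; have [wi|wi] := eqVneq (w i) 0; first by rewrite F0 // !mul0r mulr0.
  by field; rewrite wi w1.
by rewrite !half ?mulrDl //; lia.
Qed.

End Descend.

(** * Expectation of reservoir sampling in a block *)

Section Scan.
Variables (s : state R) (src cnt : nat) (z : nat -> R) (row : nat -> nat -> R).
Hypothesis es : env s.
Hypothesis rs : reg s 14 = src.
Hypothesis rc : reg s 15 = cnt.
Hypothesis cW : (cnt <= W)%N.
Hypothesis zE : forall c, (c < r)%N -> rd s sVec c = z c.
Hypothesis rowE : forall t c, (t < cnt)%N -> (c < r)%N ->
  rd s Inp (src + t * r + c) = row t c.
Hypothesis sz1 : (0 < size (rmem s sAcc))%N.
Hypothesis sz2 : (0 < size (rmem s sTot))%N.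
Let w t := (\sum_(c < r) z c * row t c) ^+ 2.
Let tot x := \sum_(t < x) w t.
Hypothesis tot_gt0 : 0 < tot cnt.

Let w_ge0 t : 0 <= w t. Proof. exact: sqr_ge0. Qed.
Let tot_ge0 x : 0 <= tot x. Proof. by apply: sumr_ge0 => t _. Qed.
Let totS x : tot x.+1 = tot x + w x. Proof. by rewrite /tot big_ord_recr. Qed.

Let scan_loop := For 3 vCnt
  (scan_weight ;; Flip (sAcc![#0] / sTot![#0])%re (SetReg 10 vX) Skip).

Let within s1 s2 c : frame scan s s1 -> frame c s1 s2 -> {subset wregs c <= wregs scan} ->
  {subset wwords c <= wwords scan} -> {subset wreals c <= wreals scan} -> frame scan s s2.
Proof. by move=> h1 h2 h3 h4 h5; apply: framed_trans h1 _; apply: framed_sub h2. Qed.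

(** As long as only rows of weight zero have been seen the reservoir is arbitrary; the first row of
    positive weight enters with probability 1. *)
Let inv x (s' : state R) := [/\ frame scan s s', rd s' sTot 0 = tot x &
  0 < tot x -> (reg s' 10 < x)%N /\ 0 < w (reg s' 10)].

Let weight_safe x s1 : (x < cnt)%N -> frame scan s s1 -> rd s1 sTot 0 = tot x -> reg s1 3 = x ->
  safe W scan_weight s1 (80 * r) (fun s2 => [/\ frame scan s s2, rd s2 sAcc 0 = w x,
    rd s2 sTot 0 = tot x.+1, reg s2 10 = reg s1 10 & reg s2 3 = x]).
Proof.
move=> xc f1 t1 x1; have e1 := env_frame f1 isT es.
have sc s2 : frame scan_weight s1 s2 -> frame scan s s2.
  by move=> f2; apply: (within f1 f2); apply/allP.
apply: safe_mono; first apply: safe_frame.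
- apply: safe_Seq.
    apply: (safe_sum_into (i0 := 0%N) (n := r) (F := fun c => z c * row x c)).
    + by rewrite evalE (env_r e1).
    + by apply/ltnW/(lt_W r0 hW); have := r_le r0; lia.
    + by rewrite (frame_rsize _ f1).
    + by [].
    move=> c s2 cr f2 c2 _; have e2 := env_frame f2 isT e1.
    rewrite !evalE c2 (env_r e2) !(frame_reg f2) // x1 (frame_reg f1) // rs.
    by rewrite !(frame_rd f2) // !(frame_rd f1) // zE // rowE.
  move=> s2 [a2 _] f2.
  apply: (safe_Seq (Q1 := fun s3 => rd s3 sAcc 0 = w x)).
    apply: safe_RStore; rewrite !evalE a2 rd_set_rmem !eqxx !andTb.
    by rewrite (frame_rsize _ f2) (frame_rsize _ f1) sz1 /w expr2.
  move=> s3 a3 f3.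
  apply: (@safe_RStore R W _ _ _ _ (fun s4 => rd s4 sAcc 0 = w x /\ rd s4 sTot 0 = tot x.+1)).
  rewrite !evalE a3 !rd_set_rmem !eqxx !andTb (frame_rsize _ f3) (frame_rsize _ f2) (frame_rsize _ f1) sz2.
  by rewrite /= a3 (frame_rd f3) // (frame_rd f2) // t1 totS.
- by rewrite /=; have := r0; clear; lia.
move=> s2 [[a2 t2] f2]; split=> //; first exact: sc.
  by rewrite (frame_reg f2).
by rewrite (frame_reg f2).
Qed.

Let pE x : clamp (w x / tot x.+1) = w x / tot x.+1.
Proof.
apply: clamp_id; rewrite divr_ge0 //=.
have [t0|t0] := eqVneq (tot x.+1) 0; first by rewrite t0 invr0 mulr0 ler01.
by rewrite ler_pdivrMr ?lt_neqAle 1?eq_sym ?t0 ?tot_ge0 // mul1r totS lerDr.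
Qed.

Let cnt_lt x : (x < cnt)%N -> (x < W)%N. Proof. by move=> xc; apply: leq_trans cW. Qed.

Let body_safe x s1 : (x < cnt)%N -> inv x s1 ->
  safe W (scan_weight ;; Flip (sAcc![#0] / sTot![#0])%re (SetReg 10 vX) Skip)
    (set_reg W s1 3 x) (100 * r) (inv x.+1).
Proof.
move=> xc [f1 t1 n1]; have f1' : frame scan s (set_reg W s1 3 x).
  by apply: framed_trans f1 _; apply: framed_set_reg.
apply: safe_time.
  apply: safe_Seq0.
    by apply: (weight_safe xc f1') => //; rewrite reg_set_reg eqxx modn_small // cnt_lt.
  move=> s2 [f2 a2 t2 n2 x2].
  apply: safe_Flip; rewrite !evalE a2 t2 pE => p01.
    apply: safe_SetReg; rewrite !evalE x2; split=> //.
      by apply: framed_trans f2 _; apply: framed_set_reg.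
    move=> _; rewrite reg_set_reg eqxx modn_small ?cnt_lt // ltnSn; split=> //.
    by rewrite lt_neqAle w_ge0 andbT; apply: contra p01 => /eqP <-; rewrite mul0r.
  apply: safe_Skip; split=> // t0; rewrite n2.
  have tx : 0 < tot x.
    rewrite lt_neqAle tot_ge0 andbT; apply: contra p01 => /eqP tx0.
    by rewrite totS -tx0 add0r divff //; move: t0; rewrite totS -tx0 add0r => /lt0r_neq0.
  by have [h1 h2] := n1 tx; split=> //; rewrite ltnS ltnW.
by rewrite /=; have := r0; clear; lia.
Qed.

Let init_safe : safe W (RStore sTot #0%ie RZero) (set_reg W s 10 0) 3 (inv 0).
Proof.
apply: safe_RStore; split.
- apply: (@framed_trans _ _ _ _ _ (set_reg W s 10 0)).
    exact: framed_set_reg.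
  exact: framed_set_rmem.
- by rewrite rd_set_rmem !eqxx !andTb sz2 /tot big_ord0.
by rewrite /tot big_ord0 ltxx.
Qed.

Let inv_cnt s0 : inv 0 s0 -> ieval s0 vCnt = cnt.
Proof. by case=> f0 _ _; rewrite evalE (frame_reg f0). Qed.

Let loop_safe s0 : inv 0 s0 -> safe W scan_loop s0 (2 + \sum_(t < cnt) (100 * r).+1) (inv cnt).
Proof.
move=> i0.
have H : safe W scan_loop s0 _ _ := @safe_For0 R W 3 vCnt _ s0 (fun=> 100 * r)%N inv i0 _.
rewrite (inv_cnt i0) in H; apply: H => x s1 xc; exact: body_safe.
Qed.

Lemma scan_safe : safe W scan s (200 * (r * cnt.+1))
  (fun s' => (reg s' 10 < cnt)%N /\ 0 < w (reg s' 10)).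
Proof.
apply: safe_mono.
- apply: (safe_Seq0 (T1 := 2) (Q1 := fun s' => s' = set_reg W s 10 0)).
    exact: safe_SetReg.
  by move=> _ ->; apply: (safe_Seq0 init_safe) => s0; exact: loop_safe.
- by rewrite sum_nat_const card_ord; have := r0; clear; nia.
by move=> s' [_ _ H]; exact: H.
Qed.

Lemma wp_scan phi g :
  (forall t s', (t < cnt)%N -> reg s' 10 = t -> 0 < w t -> frame scan s s' -> phi s' = g t) ->
  wp W scan s phi = \sum_(t < cnt) w t / tot cnt * g t.
Proof.
move=> phiE; have totn : tot cnt != 0 by rewrite gt_eqF.
(* The conditional expectation of the result: the row in the reservoir carries the weight of all
   rows scanned so far, and the later rows carry their own. *)
pose psi x (s' : state R) := (tot x * g (reg s' 10) + \sum_(x <= t < cnt) w t * g t) / tot cnt.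
rewrite /scan wp_Seq wp_SetReg.
apply: (wp_Seq_safe init_safe) => s0 i0; rewrite -/scan_loop.
rewrite (eq_wp (g := psi cnt) (loop_safe i0)); last first.
  move=> s' [f' _ n']; have [h1 h2] := n' tot_gt0.
  by rewrite /psi big_geq // addr0 mulrC mulKf //; apply: phiE.
have := @wp_For R W 3 vCnt (scan_weight ;; Flip (sAcc![#0] / sTot![#0])%re (SetReg 10 vX) Skip) s0
  (fun=> 100 * r)%N inv psi i0; rewrite inv_cnt // => -> //.
- rewrite /psi /tot big_ord0 mul0r add0r big_mkord big_distrl /=.
  by apply: eq_bigr => t _; rewrite mulrAC.
move=> x s1 xc [f1 t1 n1]; have f1' : frame scan s (set_reg W s1 3 x).
  by apply: framed_trans f1 _; apply: framed_set_reg.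
have x1 : reg (set_reg W s1 3 x) 3 = x by rewrite reg_set_reg eqxx modn_small // cnt_lt.
have wsafe := weight_safe xc f1' t1 x1.
apply: (wp_Seq_safe wsafe) => s2 [f2 a2 t2 n2 x2].
rewrite wp_Flip wp_SetReg wp_Skip !evalE a2 t2 pE x2 /psi n2 (_ : reg (set_reg W s1 3 x) 10 = reg s1 10) //.
rewrite reg_set_reg eqxx modn_small ?cnt_lt // [in RHS]big_ltn //.
set r1 := \sum_(x.+1 <= t < cnt) _.
(* While the total is 0 the toss is meaningless, but the reservoir counts with weight 0 on both
   sides. *)
have [t0|t0] := eqVneq (tot x.+1) 0.
  have : tot x + w x == 0 by rewrite -totS t0.
  rewrite paddr_eq0 // => /andP [/eqP -> /eqP ->].
  by rewrite t0 !mul0r !add0r subr0 mul1r.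
by rewrite totS in t0 *; field; rewrite totn t0.
Qed.

End Scan.

End Random.

(** * Composition of random draws *)

Section Draws.
Variables (R : realType) (W : nat).
Implicit Types s : state R.

(* [c] produces a random value [t] such that [post t] holds in the final state
   and the expectation of [g t] is [E g]. *)
Definition draws c s (T : nat) (post : nat -> state R -> Prop) (E : (nat -> R) -> R) :=
  safe W c s T (fun s' => exists t, post t s') /\
  forall phi g, (forall t s', post t s' -> phi s' = g t) -> wp W c s phi = E g.

Lemma draws_after c1 c2 s T1 T2 Q post E :
  safe W c1 s T1 Q -> (forall s1, Q s1 -> frame c1 s s1 -> draws c2 s1 T2 post E) ->
  draws (c1 ;; c2) s (T1 + T2) post E.
Proof.
move=> h1 h2; split.
  by apply: safe_Seq h1 _ => s1 Qs f1; have [] := h2 s1 Qs f1.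
move=> phi g H; apply: (wp_Seq_safe (safe_frame h1)) => s1 [Qs f1].
by have [_ e2] := h2 s1 Qs f1; exact: e2 H.
Qed.

Lemma draws_bind c1 c2 s T1 T2 post1 post E1 E2 :
  draws c1 s T1 post1 E1 ->
  (forall v s1, post1 v s1 -> draws c2 s1 T2 post (E2 v)) ->
  draws (c1 ;; c2) s (T1 + T2) post (fun g => E1 (fun v => E2 v g)).
Proof.
move=> [h1 e1] h2; split.
  by apply: safe_Seq0 h1 _ => s1 [v pv]; have [] := h2 v s1 pv.
move=> phi g H; rewrite wp_Seq; apply: e1 => v s1 pv.
by have [_ e2] := h2 v s1 pv; exact: e2 H.
Qed.

Lemma draws_then c1 c2 s T1 T2 post1 post E :
  draws c1 s T1 post1 E ->
  (forall t s1, post1 t s1 -> safe W c2 s1 T2 (post t)) ->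
  draws (c1 ;; c2) s (T1 + T2) post E.
Proof.
move=> [h1 e1] h2; split.
  apply: safe_Seq0 h1 _ => s1 [v pv]; apply: safe_post (h2 v s1 pv) _ => s2 p2.
  by exists v.
move=> phi g H; rewrite wp_Seq; apply: e1 => v s1 pv.
exact: wp_const (h2 v s1 pv) (H v).
Qed.

Lemma draws_time c s T T' post E : (T <= T')%N -> draws c s T post E -> draws c s T' post E.
Proof. by move=> TT [h e]; split=> //; apply: safe_time h TT. Qed.

Lemma draws_ext c s T post E E' : (forall g, E g = E' g) ->
  draws c s T post E -> draws c s T post E'.
Proof. by move=> EE [h e]; split=> // phi g H; rewrite -EE; exact: e. Qed.

Lemma draws_SetReg x e c s v T post E :
  ieval s e = v -> (v < W)%N ->
  (forall s1, frame (SetReg x e) s s1 -> reg s1 x = v -> draws c s1 T post E) ->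
  draws (SetReg x e ;; c) s ((icost e).+1 + T) post E.
Proof.
move=> ev vW H; apply: (draws_after (Q := fun s1 => reg s1 x = v)).
  by apply: safe_SetReg; rewrite /= eqxx ev modn_small.
by move=> s1 s1v f1; apply: H.
Qed.

End Draws.

(** * Quadratic forms of flattened matrices *)

Section QuadForm.
Variables (R : realType) (r : nat).
Hypothesis r0 : (0 < r)%N.

Lemma sum_flat (g : nat -> nat -> R) :
  \sum_(e < r * r) g (e %/ r)%N (e %% r)%N = \sum_(a < r) \sum_(b < r) g a b.
Proof.
rewrite -(sum_rows r (fun e => g (e %/ r)%N (e %% r)%N) r).
by apply: eq_bigr => a _; apply: eq_bigr => b _; rewrite flat_div ?flat_mod.
Qed.

Lemma quad_form_rank1 (z x : nat -> R) :
  quad_form r z (fun e => x (e %/ r)%N * x (e %% r)%N) = (\sum_(c < r) z c * x c) ^+ 2.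
Proof.
rewrite /quad_form (sum_flat (fun a b => z a * z b * (x a * x b))) expr2 big_distrl /=.
apply: eq_bigr => a _; rewrite big_distrr /=; apply: eq_bigr => b _; ring.
Qed.

Lemma quad_form_sum (z : nat -> R) k (Q : nat -> nat -> R) :
  quad_form r z (fun e => \sum_(t < k) Q t e) = \sum_(t < k) quad_form r z (Q t).
Proof.
rewrite /quad_form exchange_big /=; apply: eq_bigr => e _.
by rewrite big_distrr.
Qed.

Lemma quad_formZ (z Q : nat -> R) a : quad_form r z (fun e => a * Q e) = a * quad_form r z Q.
Proof. by rewrite /quad_form big_distrr /=; apply: eq_bigr => e _; ring. Qed.

Lemma eq_quad_form (z Q Q' : nat -> R) : (forall e, (e < r * r)%N -> Q e = Q' e) ->
  quad_form r z Q = quad_form r z Q'.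
Proof. by move=> QQ; apply: eq_bigr => e _; rewrite QQ. Qed.

(** Since a rank one factor can be absorbed into the vector, the stored Gram heaps serve every
    pivot: the second descent only replaces [h] by [h * w]. *)
Lemma quad_form_scale (z y Q : nat -> R) :
  quad_form r z (fun e => y (e %/ r)%N * y (e %% r)%N * Q e) =
  quad_form r (fun c => z c * y c) Q.
Proof. by apply: eq_bigr => e _; ring. Qed.

End QuadForm.

(** * One index: pivot, block, row *)

Section SampleIndex.
Variables (R : realType) (W N r : nat) (n : nat -> nat) (u : nat -> nat -> nat -> R).
Implicit Types s : state R.
Hypothesis r0 : (0 < r)%N.
Hypothesis n0 : forall j, (j < N)%N -> (0 < n j)%N.
Local Notation off := (row_offset r n).
Local Notation env := (env N r n).
Local Notation nblk := (block_count r n).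
Local Notation bcnt := (block_height r n).
Variables (m : nat) (f : nat -> nat).
Local Notation ready := (ready N r n u m f).
Hypothesis hW : (16 * (off N + r ^ 3) <= W)%N.

Variables (s : state R) (k b d : nat) (h : nat -> R) (fac : nat -> nat -> R).
Let j := f k.
Hypothesis km : (k < m)%N.
Hypothesis rs : ready s.
Hypothesis jE : reg s 2 = j.
Hypothesis kE : reg s 6 = k.
Hypothesis bE : reg s 7 = b.
Hypothesis dE : reg s 8 = d.
Hypothesis dq : (d < r * r)%N.
Hypothesis histE : forall c, (c < r)%N -> rd s sHist (d * r + c) = h c.
Hypothesis facE : forall v c, (v < r)%N -> (c < r)%N -> rd s sFac (v * r + c) = fac v c.
Hypothesis leafE : forall v e, (v < r)%N -> (e < r * r)%N ->
  node r s sTree 0 (r + v) e =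
  fac v (e %/ r)%N * fac v (e %% r)%N / fac v v * gram_entry r n u j e.
Hypothesis heapE : heap r s sTree 0 r.
Hypothesis diag_ge0 : forall v, (v < r)%N -> 0 <= fac v v.
Let slot := ((b * (r * r) + d) * m + k)%N.
Hypothesis slot_lt : (slot < size (imem s Out))%N.

Let wt v t := (\sum_(c < r) (h c * fac v c) * u j t c) ^+ 2.

Definition index_weight t : R := \sum_(v < r) wt v t / fac v v.
Let total := \sum_(t < n j) index_weight t.
Hypothesis total_gt0 : 0 < total.

Definition index_post t (s' : state R) := [/\ frame sample_index s s', (t < n j)%N,
  0 < index_weight t, ird s' Out slot = t /\ (forall i, i != slot -> ird s' Out i = ird s Out i) &
  (forall c, (c < r)%N -> rd s' sHist (d * r + c) = h c * u j t c) /\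
  forall i, ~~ (d * r <= i < d * r + r)%N -> rd s' sHist i = rd s sHist i].

Let jN : (j < N)%N. Proof. by case: (ready_picks rs) => _ _; exact. Qed.

(* A command with the write sets of the part of [sample_index] that precedes
   the final stores. *)
Let prefix : cmd :=
  For 0 eR (RStore sVec vE RZero) ;; SetReg 11 eR ;; SetReg 12 eR ;; descend sTree ;;
  SetReg 9 eR ;; SetReg 17 eR ;; SetReg 14 eR ;; SetReg 15 eR ;; scan.

Let within s1 s2 c : frame prefix s s1 -> frame c s1 s2 ->
  all (mem (wregs prefix)) (wregs c) -> all (mem (wwords prefix)) (wwords c) ->
  all (mem (wreals prefix)) (wreals c) -> frame prefix s s2.
Proof.
move=> h1 h2 /allP h3 /allP h4 /allP h5; apply: framed_trans h1 _.
exact: framed_sub h2.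
Qed.

Let rdy s1 : frame prefix s s1 -> ready s1.
Proof. by move=> f1; exact: (ready_frame r0 f1 isT rs). Qed.

Let wt_ge0 v t : 0 <= wt v t. Proof. exact: sqr_ge0. Qed.

Let pivot_weight v := (\sum_(t < n j) wt v t) / fac v v.

(** Summing the squares (h * w . a)^2 over all rows [a] replaces the rank one matrices of the rows
    by the Gram matrix, so the weight of a pivot is known without visiting a row. *)
Let gram_weight v : (v < r)%N -> quad_form r h (fun e =>
  fac v (e %/ r)%N * fac v (e %% r)%N / fac v v * gram_entry r n u j e) = pivot_weight v.
Proof.
move=> vr; pose Q t e := u j t (e %/ r)%N * u j t (e %% r)%N.
have wtE t : wt v t = quad_form r (fun c => h c * fac v c) (Q t) by rewrite quad_form_rank1.
have -> : pivot_weight v = (fac v v)^-1 *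
    \sum_(t < n j) quad_form r (fun c => h c * fac v c) (Q t).
  by rewrite /pivot_weight mulrC; congr (_ * _); apply: eq_bigr => t _.
rewrite -quad_form_sum -quad_formZ -quad_form_scale; apply: eq_bigr => e _.
by rewrite /gram_entry /Q; ring.
Qed.

Let total_pivot : \sum_(v < r) pivot_weight v = total.
Proof.
rewrite /total /index_weight exchange_big /=; apply: eq_bigr => v _.
by rewrite /pivot_weight big_distrl.
Qed.

Let sixteen x : (x <= 2 * off N + 2 * r)%N -> (x < W)%N.
Proof. by move=> xs; apply: (lt_W r0 hW); have := r_le r0; lia. Qed.

Let rN : (r <= off N)%N.
Proof.
have := off_le r n jN; have := n0 jN => nj.
have : (r <= n j * r)%N by rewrite leq_pmull.
by lia.
Qed.

Let pivot_descend s1 : frame prefix s s1 -> reg s1 11 = 0%N -> reg s1 12 = r ->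
  (forall c, (c < r)%N -> rd s1 sVec c = h c) ->
  draws W (descend sTree) s1 (300 * (r * r * (trunc_log 2 r + 1)))
    (fun v s2 => [/\ frame prefix s s2, (v < r)%N, reg s2 4 = (r + v)%N,
       reg s2 12 = r /\ (forall c, (c < r)%N -> rd s2 sVec c = h c) & 0 < pivot_weight v])
    (fun g => \sum_(v < r) pivot_weight v / total * g v).
Proof.
move=> f1 b1 B1 z1; have rs1 := rdy f1; have es1 := ready_env rs1.
have nodeE i e : node r s1 sTree 0 i e = node r s sTree 0 i e by rewrite /node (frame_rd f1).
pose w i := quad_form r h (node r s1 sTree 0 i).
have wS i : (0 < i < r)%N -> w i = w (2 * i)%N + w (2 * i + 1)%N.
  move=> ir; rewrite /w /quad_form -big_split /=; apply: eq_bigr => e _.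
  by rewrite !nodeE heapE // mulrDr.
have wleaf v : (v < r)%N -> w (r + v)%N = pivot_weight v.
  move=> vr; rewrite /w -gram_weight //; apply: eq_quad_form => e er.
  by rewrite nodeE leafE.
have wl0 v : (v < r)%N -> 0 <= w (r + v)%N.
  move=> vr; rewrite wleaf // /pivot_weight divr_ge0 ?diag_ge0 //.
  by apply: sumr_ge0 => t _.
have w1 : w 1%N = total.
  rewrite (heap_root r0 wS) -total_pivot; apply: eq_bigr => v _; exact: wleaf.
have sz1 : (0 < size (rmem s1 sAcc))%N by apply: (sizeS rs1) => //; rewrite expn_gt0 r0.
have sz2 : (0 < size (rmem s1 sAcc2))%N by apply: (sizeS rs1) => //; rewrite expn_gt0 r0.
split.
  apply: safe_post; first apply: safe_frame.
    apply: (@descend_safe R W N r n r0 hW sTree s1 0 r h w) => //; rewrite ?w1 //.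
  move=> s2 [[v vr [n2 w2]] f2]; exists v; split=> //.
  - by apply: (within f1 f2).
  - by split=> [|c cr]; rewrite ?(frame_reg f2) // (frame_rd f2) // z1.
  - by rewrite -wleaf.
move=> phi g H.
rewrite (@wp_descend R W N r n r0 hW sTree s1 0 r h w _ _ es1 b1 B1 r0 rN z1 _ wS sz1 sz2 wl0 _
  phi (fun p => g (p - r)%N)) //.
- by apply: eq_bigr => v _; rewrite wleaf // w1 addKn.
- by rewrite w1.
move=> v s2 vr n2 w2 f2; rewrite addKn; apply: H; split=> //.
- by apply: (within f1 f2).
- by split=> [|c cr]; rewrite ?(frame_reg f2) // (frame_rd f2) // z1.
- by rewrite -wleaf.
Qed.

Let block_weight v q := \sum_(t < bcnt j q) wt v (q * r + t)%N.

Let total_block v : \sum_(q < nblk j) block_weight v q = \sum_(t < n j) wt v t.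
Proof. exact: sum_blocks. Qed.

Let block_descend s1 v : frame prefix s s1 -> reg s1 11 = (2 * off j)%N ->
  reg s1 12 = nblk j -> (forall c, (c < r)%N -> rd s1 sVec c = h c * fac v c) ->
  0 < \sum_(t < n j) wt v t ->
  draws W (descend (Data 0)) s1 (300 * (r * r * (trunc_log 2 (nblk j) + 1)))
    (fun q s2 => [/\ frame prefix s s2, (q < nblk j)%N /\ reg s2 4 = (nblk j + q)%N,
       reg s2 12 = nblk j, 0 < block_weight v q &
       forall c, (c < r)%N -> rd s2 sVec c = h c * fac v c])
    (fun g => \sum_(q < nblk j) block_weight v q / (\sum_(t < n j) wt v t) * g q).
Proof.
move=> f1 b1 B1 z1 tot0; have rs1 := rdy f1; have es1 := ready_env rs1.
have B0 := nblk_gt0 r n j; have BN := nblk_off r0 n0 jN.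
pose z c := h c * fac v c.
(* With fewer than r rows there is one block and no stored heap. The node where the descent starts
   is then already the leaf, and its weight can be prescribed because no memory is read. *)
pose w i := if (r <= n j)%N then quad_form r z (node r s1 (Data 0) (2 * off j) i)
  else \sum_(t < n j) wt v t.
have small : (n j < r)%N -> nblk j = 1%N.
  by move=> lt; rewrite /block_count divn_small.
have wE i : (1 < i < 2 * nblk j)%N -> quad_form r z (node r s1 (Data 0) (2 * off j) i) = w i.
  by rewrite /w; case: (leqP r (n j)) => // /small ->; lia.
have wS i : (0 < i < nblk j)%N -> w i = w (2 * i)%N + w (2 * i + 1)%N.
  rewrite /w; case: (leqP r (n j)) => [rn|/small ->]; last by lia.
  move=> iB; rewrite /quad_form -big_split /=; apply: eq_bigr => e _.
  by have [_ hp] := ready_tree rs1 jN rn; rewrite hp // mulrDr.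
have wleaf q : (q < nblk j)%N -> w (nblk j + q)%N = block_weight v q.
  rewrite /w; case: (leqP r (n j)) => [rn|lt] qB.
    have [lf _] := ready_tree rs1 jN rn.
    transitivity (quad_form r z (leaf_gram r n u j q)).
      by apply: eq_quad_form => e er; exact: lf.
    pose Q t e := u j (q * r + t)%N (e %/ r)%N * u j (q * r + t)%N (e %% r)%N.
    transitivity (\sum_(t < bcnt j q) quad_form r z (Q t)); first exact: (quad_form_sum r z _ Q).
    apply: eq_bigr => t _.
    exact: (quad_form_rank1 r0 z (u j (q * r + t)%N)).
  have := total_block v; rewrite (small lt) big_ord1 => <-.
  by have -> : q = 0%N by rewrite (small lt) in qB; lia.
have wl0 q : (q < nblk j)%N -> 0 <= w (nblk j + q)%N.
  by move=> qB; rewrite wleaf //; apply: sumr_ge0 => t _.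
have w1 : w 1%N = \sum_(t < n j) wt v t.
  rewrite (heap_root B0 wS) -total_block; apply: eq_bigr => q _; exact: wleaf.
have sz1 : (0 < size (rmem s1 sAcc))%N by apply: (sizeS rs1) => //; rewrite expn_gt0 r0.
have sz2 : (0 < size (rmem s1 sAcc2))%N by apply: (sizeS rs1) => //; rewrite expn_gt0 r0.
split.
  apply: safe_post; first apply: safe_frame.
    apply: (@descend_safe R W N r n r0 hW (Data 0) s1 (2 * off j) (nblk j) z w) => //; rewrite ?w1 //.
  move=> s2 [[q qB [n2 w2]] f2]; exists q; split=> //.
  - by apply: (within f1 f2).
  - by rewrite (frame_reg f2).
  - by rewrite -wleaf.
  - by move=> c cr; rewrite (frame_rd f2) // z1.
move=> phi g H.
rewrite (@wp_descend R W N r n r0 hW (Data 0) s1 (2 * off j) (nblk j) z w _ _ es1 b1 B1 B0 BN z1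
  wE wS sz1 sz2 wl0 _ phi (fun p => g (p - nblk j)%N)) //.
- by apply: eq_bigr => q _; rewrite wleaf // w1 addKn.
- by rewrite w1.
move=> q s2 qB n2 w2 f2; rewrite addKn; apply: H; split=> //.
- by apply: (within f1 f2).
- by rewrite (frame_reg f2).
- by rewrite -wleaf.
- by move=> c cr; rewrite (frame_rd f2) // z1.
Qed.

Let row_scan s1 v q : frame prefix s s1 -> (q < nblk j)%N ->
  reg s1 14 = (off j + q * (r * r))%N -> reg s1 15 = bcnt j q ->
  (forall c, (c < r)%N -> rd s1 sVec c = h c * fac v c) -> 0 < block_weight v q ->
  draws W scan s1 (200 * (r * (2 * r).+1))
    (fun t s2 => exists t', [/\ t = (q * r + t')%N, frame prefix s s2, (t' < bcnt j q)%N,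
       reg s2 10 = t' /\ reg s2 17 = reg s1 17 & 0 < wt v t])
    (fun g => \sum_(t < bcnt j q) wt v (q * r + t)%N / block_weight v q * g (q * r + t)%N).
Proof.
move=> f1 qB src1 cnt1 z1 tot0; have rs1 := rdy f1; have es1 := ready_env rs1.
have [b1 b2] := bcnt_le r0 qB.
have sz1 : (0 < size (rmem s1 sAcc))%N by apply: (sizeS rs1) => //; rewrite expn_gt0 r0.
have sz2 : (0 < size (rmem s1 sTot))%N by apply: (sizeS rs1) => //; rewrite expn_gt0 r0.
have cW : (bcnt j q <= W)%N by apply/ltnW/sixteen; lia.
pose z c := h c * fac v c; pose row t c := u j (q * r + t)%N c.
have rowE t c : (t < bcnt j q)%N -> (c < r)%N ->
    rd s1 Inp (off j + q * (r * r) + t * r + c) = row t c.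
  move=> tb cr; rewrite /row -(ready_rows rs1 jN) //; last by lia.
  by congr rd; rewrite mulnDl mulnA; lia.
split.
  apply: safe_mono; first apply: safe_frame.
  - by apply: (@scan_safe R W N r n r0 hW s1 (off j + q * (r * r)) (bcnt j q) z row).
  - by rewrite leq_mul2l leq_mul2l /= ltnS b2 orbT.
  move=> s2 [[t2 w2] f2]; exists (q * r + reg s2 10)%N; exists (reg s2 10); split=> //.
  - by apply: (within f1 f2).
  - by rewrite [reg s2 17](frame_reg f2).
move=> phi g H.
rewrite (@wp_scan R W N r n r0 hW s1 (off j + q * (r * r)) (bcnt j q) z row _ _ _ _ _ _ _ _ _
  phi (fun t => g (q * r + t)%N)) // => t s2 tb t2 w2 f2.
apply: H; exists t; split=> //.
- by apply: (within f1 f2).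
- by rewrite [reg s2 17](frame_reg f2).
Qed.

(** The conditional probabilities of pivot, block and row telescope to [wt v t / fac v v / total],
    and summing over the pivots gives the weight of the row. A vanishing denominator is a sum of
    nonnegative weights, so the numerators above it vanish too. *)
Let drawsE g :
  \sum_(v < r) pivot_weight v / total *
    \sum_(q < nblk j) block_weight v q / (\sum_(t < n j) wt v t) *
      \sum_(t < bcnt j q) wt v (q * r + t)%N / block_weight v q * g (q * r + t)%N =
  \sum_(t < n j) index_weight t / total * g t.
Proof.
transitivity (\sum_(v < r) \sum_(t < n j) wt v t / fac v v / total * g t); last first.
  rewrite exchange_big /=; apply: eq_bigr => t _.
  by rewrite /index_weight !big_distrl.
apply: eq_bigr => v _; set S := \sum_(t < n j) wt v t.
have -> : \sum_(q < nblk j) block_weight v q / S *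
    \sum_(t < bcnt j q) wt v (q * r + t)%N / block_weight v q * g (q * r + t)%N =
    \sum_(t < n j) wt v t / S * g t.
  rewrite -(sum_blocks n r0 (fun t => wt v t / S * g t)); apply: eq_bigr => q _.
  rewrite big_distrr /=; apply: eq_bigr => t _.
  have [b0|b0] := eqVneq (block_weight v q) 0; last first.
    transitivity (block_weight v q / block_weight v q * (wt v (q * r + t)%N / S * g (q * r + t)%N)).
      by ring.
    by rewrite divff // mul1r.
  have /eqP := b0; rewrite psumr_eq0 // => /allP /(_ t (mem_index_enum t)) /eqP ->.
  by rewrite b0 !mul0r.
rewrite big_distrr /=; apply: eq_bigr => t _; rewrite /pivot_weight -/S.
have [S0|S0] := eqVneq S 0.
  have /eqP := S0; rewrite psumr_eq0 // => /allP /(_ t (mem_index_enum t)) /eqP ->.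
  by rewrite S0 !mul0r.
transitivity (S / S * (wt v t / fac v v / total * g t)); first by ring.
by rewrite divff // mul1r.
Qed.

Let prefix_sub s1 c s2 : frame prefix s s1 -> frame c s1 s2 ->
  all (mem (wregs sample_index)) (wregs c) -> all (mem (wwords sample_index)) (wwords c) ->
  all (mem (wreals sample_index)) (wreals c) -> frame sample_index s s2.
Proof.
move=> h1 h2 /allP h3 /allP h4 /allP h5.
apply: (framed_trans (s2 := s1)); last exact: framed_sub h2.
by apply: framed_sub h1; apply/allP.
Qed.

Let store_index s1 v q t' : frame prefix s s1 -> (q < nblk j)%N -> reg s1 17 = q ->
  (t' < bcnt j q)%N -> reg s1 10 = t' -> 0 < pivot_weight v -> (v < r)%N ->
  0 < wt v (q * r + t')%N ->
  safe W (SetReg 10 (vBlk * eR + vRow)%ie ;;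
    IStore Out ((vB * eRR + vD) * eMats + vK)%ie vRow ;;
    For 0 eR (RStore sHist (vD * eR + vE)%ie
      (sHist![vD * eR + vE] * Inp![eOff vJ + vRow * eR + vE])%re)) s1
    (100 * r) (index_post (q * r + t')%N).
Proof.
move=> f1 qB q1 tb t1 pv vr w1; have rs1 := rdy f1; have es1 := ready_env rs1.
have [b1 b2] := bcnt_le r0 qB; set t := (q * r + t')%N in w1 *.
have tn : (t < n j)%N by rewrite /t; lia.
have tW : (t < W)%N.
  apply: sixteen; have := off_le r n jN; have := leq_pmulr (n j) r0; lia.
apply: safe_time.
  apply: (safe_Seq_SetReg (v := t)).
  - by rewrite !evalE q1 t1 (env_r es1).
  - exact: tW.
  move=> s2 f2 t2; have f2' : frame prefix s s2 by exact: (within f1 f2).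
  have rs2 := rdy f2'; have es2 := ready_env rs2.
  apply: (safe_Seq (Q1 := fun s3 => ird s3 Out slot = t /\
      forall i, i != slot -> ird s3 Out i = ird s Out i)).
    apply: safe_IStore.
    have -> : ieval s2 ((vB * eRR + vD) * eMats + vK)%ie = slot.
      rewrite !evalE !(frame_reg f2') // bE dE kE (env_r es2).
      by rewrite (pick_m (ready_picks rs2)).
    rewrite evalE t2; split.
      rewrite ird_set_imem !eqxx !andTb (fr_wsize f2') slot_lt.
      by rewrite modn_small.
    by move=> i ni; rewrite ird_set_imem (negbTE ni) andbF (frame_ird f2').
  move=> s3 [w3 w3'] f3.
  have f3' : frame sample_index s s3 by exact: (prefix_sub f2' f3).
  have rs3 : ready s3 := ready_frame r0 f3' isT rs.
  have es3 := ready_env rs3.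
  apply: safe_post; first apply: safe_frame.
    apply: (@safe_fill R W 0 _ _ s3 sHist (d * r) r (fun c => h c * u j t c)).
    - by rewrite !evalE (env_r es3).
    - by apply/ltnW/sixteen; lia.
    move=> c s4 cr f4 c4 I4.
    have rs4 : ready s4 := ready_frame r0 f4 isT rs3.
    have es4 := ready_env rs4.
    have j4 : reg s4 2 = j by rewrite (frame_reg f4) // (frame_reg f3').
    have d4 : reg s4 8 = d by rewrite (frame_reg f4) // (frame_reg f3').
    apply: safe_RStore.
    have -> : ieval s4 (vD * eR + vE)%ie = (d * r + c)%N by rewrite !evalE c4 (env_r es4) d4.
    split; last by move=> i ni; rewrite rd_set_rmem (negbTE ni) andbF.
    rewrite rd_set_rmem !eqxx !andTb (sizeS rs4) //; last first.
      have : (d.+1 * r <= r * r * r)%N by rewrite leq_mul2r dq orbT.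
      by rewrite mulSn !expnS expn0 muln1 mulnA; lia.
    rewrite !evalE c4 (env_r es4) d4 I4 ltnn andbF j4 (env_off es4) 1?ltnW //.
    rewrite (frame_reg f4) // (frame_reg f3) // t2 (ready_rows rs4) //; congr (_ * _).
    by rewrite (frame_rd f3) // (frame_rd f2') // histE.
  move=> s4 [I4 f4].
  have f4' : frame sample_index s s4.
    apply: (framed_trans f3'); apply: framed_sub f4; exact/allP.
  split=> //.
  (* The pivot drawn has positive weight, hence a nonzero diagonal entry, and its own term already
     makes the weight of the row positive. *)
  - apply: lt_le_trans (_ : wt v t / fac v v <= _).
      rewrite divr_gt0 // lt_neqAle diag_ge0 // andbT eq_sym.
      by apply/eqP => d0; move: pv; rewrite /pivot_weight d0 invr0 mulr0 ltxx.
    rewrite /index_weight (bigD1 (Ordinal vr)) //= lerDl; apply: sumr_ge0 => v' _.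
    by rewrite divr_ge0 ?diag_ge0.
  - by split=> [|i ni]; rewrite (frame_ird f4) // w3'.
  split.
    by move=> c cr; rewrite I4 ifT ?addKn //; lia.
  by move=> i ni; rewrite I4 (negbTE ni) (frame_rd f3) // (frame_rd f2').
by rewrite /=; have := r0; clear; lia.
Qed.

Lemma sample_index_draws :
  draws W sample_index s (2000 * (r * r * (trunc_log 2 r + trunc_log 2 (nblk j) + 1)))
    index_post (fun g => \sum_(t < n j) index_weight t / total * g t).
Proof.
apply: (draws_ext drawsE).
pose T1 := (300 * (r * r * (trunc_log 2 r + 1)))%N.
pose T2 := (300 * (r * r * (trunc_log 2 (nblk j) + 1)))%N.
have BN := nblk_off r0 n0 jN.
have es := ready_env rs.
have zsz s1 : ready s1 -> forall c, (c < r)%N -> (c < size (rmem s1 sVec))%N.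
  by move=> rs1 c cr; apply: (sizeS rs1) => //; apply: leq_trans cr (r_le r0).
apply: draws_time; last first.
  apply: draws_after.
    apply: (@safe_fill R W 0 _ _ s sVec 0 r h).
    - by rewrite !evalE (env_r es).
    - by apply/ltnW/sixteen; lia.
    move=> c s1 cr f1 c1 _; have f1' : frame prefix s s1.
      by apply: framed_sub f1; exact/allP.
    apply: safe_RStore; rewrite !evalE c1; split; last first.
      by move=> i ni; rewrite rd_set_rmem (negbTE ni) andbF.
    rewrite rd_set_rmem !eqxx !andTb (zsz _ (rdy f1')) // (frame_rd f1') //.
    by rewrite (frame_reg f1') // dE (env_r (ready_env (rdy f1'))) histE.
  move=> s1 z1 fr1; have f1 : frame prefix s s1 by apply: framed_sub fr1; exact/allP.
  have {}z1 c : (c < r)%N -> rd s1 sVec c = h c by move=> cr; rewrite z1 /= add0n cr subn0.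
  apply: (draws_SetReg (v := 0%N)) => //; first exact: sixteen.
  move=> s2 fr2 b2; have f2 : frame prefix s s2 by exact: (within f1 fr2).
  apply: (draws_SetReg (v := r)).
  - by rewrite evalE (env_r (ready_env (rdy f2))).
  - by apply: sixteen; lia.
  move=> s3 fr3 B3; have f3 : frame prefix s s3 by exact: (within f2 fr3).
  apply: (draws_bind (E2 := fun v g =>
    \sum_(q < nblk j) block_weight v q / (\sum_(t < n j) wt v t) *
      \sum_(t < bcnt j q) wt v (q * r + t)%N / block_weight v q * g (q * r + t)%N)
    (pivot_descend f3 _ B3 _)).
  - by rewrite (frame_reg fr3).
  - by move=> c cr; rewrite (frame_rd fr3) // (frame_rd fr2) // z1.
  move=> v s4 [f4 vr n4 [B4 z4] pv].
  have tot0 : 0 < \sum_(t < n j) wt v t.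
    have d0 : 0 < fac v v.
      rewrite lt_neqAle diag_ge0 // andbT eq_sym; apply/eqP => d0.
      by move: pv; rewrite /pivot_weight d0 invr0 mulr0 ltxx.
    by move: pv; rewrite /pivot_weight pmulr_lgt0 ?invr_gt0.
  apply: (draws_SetReg (v := v)).
  - by rewrite !evalE n4 B4 addKn.
  - by apply: sixteen; lia.
  move=> s5 fr5 u5; have f5 : frame prefix s s5 by exact: (within f4 fr5).
  have es5 := ready_env (rdy f5).
  apply: draws_after.
    apply: (@safe_fill R W 0 _ _ s5 sVec 0 r (fun c => h c * fac v c)).
    - by rewrite !evalE (env_r es5).
    - by apply/ltnW/sixteen; lia.
    move=> c s6 cr f6 c6 I6; have f6' : frame prefix s s6.
      by apply: framed_trans f5 _; apply: framed_sub f6; exact/allP.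
    apply: safe_RStore; rewrite !evalE c6; split; last first.
      by move=> i ni; rewrite rd_set_rmem (negbTE ni) andbF.
    rewrite rd_set_rmem !eqxx !andTb (zsz _ (rdy f6')) // I6 add0n ltnn andbF.
    rewrite (frame_reg f6) // u5 (env_r (ready_env (rdy f6'))) (frame_rd f6') // facE //.
    by rewrite (frame_rd fr5) // z4.
  move=> s6 z6 fr6; have f6 : frame prefix s s6.
    by apply: framed_trans f5 _; apply: framed_sub fr6; exact/allP.
  have {}z6 c : (c < r)%N -> rd s6 sVec c = h c * fac v c.
    by move=> cr; rewrite z6 /= add0n cr subn0.
  apply: (draws_SetReg (v := (2 * off j)%N)).
  - by rewrite !evalE (frame_reg f6) // jE (env_off (ready_env (rdy f6))) // ltnW.
  - by apply: sixteen; have := off_le r n jN; lia.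
  move=> s7 fr7 b7; have f7 : frame prefix s s7 by exact: (within f6 fr7).
  apply: (draws_SetReg (v := nblk j)).
  - have j7 : reg s7 2 = j by rewrite (frame_reg f7).
    exact: eval_blocks (ready_env (rdy f7)) j7 jN.
  - by apply: sixteen; lia.
  move=> s8 fr8 B8; have f8 : frame prefix s s8 by exact: (within f7 fr8).
  apply: (draws_bind (E2 := fun q g =>
      \sum_(t < bcnt j q) wt v (q * r + t)%N / block_weight v q * g (q * r + t)%N)
    (block_descend f8 _ B8 _ tot0)).
  - by rewrite (frame_reg fr8).
  - by move=> c cr; rewrite (frame_rd fr8) // (frame_rd fr7) // z6.
  move=> q s9 [f9 [qB n9] B9 bw z9]; have [c1 c2] := bcnt_le r0 qB.
  have qr : (q * (r * r) <= n j * r)%N by rewrite mulnA leq_mul2r; lia.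
  have oN := off_le r n jN.
  apply: (draws_SetReg (v := q)).
  - by rewrite !evalE n9 B9 addKn.
  - by apply: sixteen; lia.
  move=> s10 fr10 q10; have f10 : frame prefix s s10 by exact: (within f9 fr10).
  apply: (draws_SetReg (v := (off j + q * (r * r))%N)).
  - rewrite !evalE (frame_reg f10) // jE (env_off (ready_env (rdy f10))) 1?ltnW //.
    by rewrite (env_r (ready_env (rdy f10))) q10.
  - by apply: sixteen; lia.
  move=> s11 fr11 src11; have f11 : frame prefix s s11 by exact: (within f10 fr11).
  apply: draws_after.
    apply: (@block_size_safe R W N r n r0 hW s11 j 17 q) => //.
    - exact: ready_env (rdy f11).
    - by rewrite (frame_reg f11).
    - by rewrite (frame_reg fr11) // (frame_reg fr10).
    - by rewrite (frame_reg fr11).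
  move=> s12 cnt12 fr12; have f12 : frame prefix s s12.
    by apply: (within f11 fr12).
  apply: (draws_then (T2 := 100 * r)).
    apply: (row_scan f12 qB _ cnt12 _ bw).
    - by rewrite (frame_reg fr12).
    - move=> c cr; rewrite (frame_rd fr12) // (frame_rd fr11) // (frame_rd fr10) //.
      exact: z9.
  move=> t s13 [t' [-> f13 tb [t13 q13] w13]].
  apply: (@store_index s13 v q t') => //.
  by rewrite q13 (frame_reg fr12) // (frame_reg fr11).
have q0 : (0 < r * r)%N by rewrite muln_gt0 r0.
have rq : (r <= r * r)%N by rewrite leq_pmulr.
rewrite /= (_ : r * (2 * r).+1 = 2 * (r * r) + r)%N; last by lia.
move: (trunc_log 2 r) (trunc_log 2 (nblk j)) (r * r)%N q0 rq; clear; nia.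
Qed.

End SampleIndex.

(** * Gram forms and leverage scores *)

Section GramForms.
Variables (R : realType) (r : nat).
Hypothesis r0 : (0 < r)%N.

(** Positive semidefiniteness, stated by a family of vectors instead of by the sign of the quadratic
    form. The index set is an arbitrary finite type so that families can be multiplied. *)
Definition gram_form (M : nat -> R) := exists (T : finType) (Y : T -> nat -> R),
  forall e, (e < r * r)%N -> M e = \sum_i Y i (e %/ r)%N * Y i (e %% r)%N.

Lemma eq_gram_form M M' : (forall e, (e < r * r)%N -> M e = M' e) -> gram_form M -> gram_form M'.
Proof. by move=> MM [T [Y YE]]; exists T, Y => e er; rewrite -MM // YE. Qed.

Lemma gram_form1 : gram_form (fun=> 1).
Proof. by exists 'I_1, (fun _ _ => 1) => e _; rewrite big_ord1 mulr1. Qed.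

(** The Schur product theorem: the entrywise product is the Gram matrix of the products of vectors,
    indexed by pairs. *)
Lemma gram_formM M M' : gram_form M -> gram_form M' -> gram_form (fun e => M e * M' e).
Proof.
move=> [T [Y YE]] [T' [Y' YE']]; exists (T * T')%type, (fun i a => Y i.1 a * Y' i.2 a) => e er.
rewrite YE // YE' // big_distrlr pair_bigA /=; apply: eq_bigr => i _; ring.
Qed.

Lemma quad_form_ge0 M z : gram_form M -> 0 <= quad_form r z M.
Proof.
move=> [T [Y YE]].
have -> : quad_form r z M = \sum_i (\sum_(c < r) z c * Y i c) ^+ 2.
  transitivity (\sum_i quad_form r z (fun e => Y i (e %/ r)%N * Y i (e %% r)%N)).
    rewrite /quad_form exchange_big /=; apply: eq_bigr => e _.
    by rewrite YE // big_distrr.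
  by apply: eq_bigr => i _; rewrite quad_form_rank1.
by apply: sumr_ge0 => i _; exact: sqr_ge0.
Qed.

Lemma gram_form_flat M : gram_form M -> exists (T : finType) (Y : T -> nat -> R),
  forall a b, (a < r)%N -> (b < r)%N -> M (a * r + b)%N = \sum_i Y i a * Y i b.
Proof.
move=> [T [Y YE]]; exists T, Y => a b ar br.
by rewrite YE ?flat_lt // flat_div ?flat_mod.
Qed.

(* Eliminating a pivot projects the vectors of the Gram form; a zero pivot is
   harmless because then the corresponding coordinates all vanish. *)
Lemma ldl_step M v : (v < r)%N -> gram_form M ->
  (forall a c, (a < r)%N -> (c < v)%N -> M (a * r + c)%N = 0) ->
  let M' := fun e => M e - ldl_term r M v e in
  gram_form M' /\ forall a c, (a < r)%N -> (c < v.+1)%N -> M' (a * r + c)%N = 0.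
Proof.
move=> vr gM Mz M'; have [T [Y YE]] := gram_form_flat gM.
have sym a b : (a < r)%N -> (b < r)%N -> M (a * r + b)%N = M (b * r + a)%N.
  by move=> ar br; rewrite !YE //; apply: eq_bigr => i _; rewrite mulrC.
set d := M (v * r + v)%N.
have d0 : d = 0 -> forall a, (a < r)%N -> M (a * r + v)%N = 0.
  rewrite /d YE // => /eqP; rewrite psumr_eq0 => [/allP Yv|i _]; last by rewrite -expr2 sqr_ge0.
  move=> a ar; rewrite YE // big1 // => i _.
  by have := Yv i (mem_index_enum i); rewrite /= mulf_eq0 orbb => /eqP ->; rewrite mulr0.
split; last first.
  move=> a c ar; rewrite ltnS leq_eqVlt /M' /ldl_term => /orP [/eqP ->|cv].
    rewrite flat_div // flat_mod // -/d; have [dz|dz] := eqVneq d 0.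
      by rewrite d0 // !mul0r subr0.
    by field.
  have cr : (c < r)%N by apply: ltn_trans vr.
  rewrite flat_div // flat_mod // (Mz a c) // (sym c v) // (Mz v c) //.
  by rewrite mulr0 mul0r subrr.
exists T, (fun i a => Y i a - M (a * r + v)%N / d * Y i v) => e er.
have [ar br] : (e %/ r < r)%N /\ (e %% r < r)%N by rewrite ltn_mod ltn_divLR.
set a := (e %/ r)%N in ar *; set b := (e %% r)%N in br *.
have -> : M' e = M (a * r + b)%N - M (a * r + v)%N * M (b * r + v)%N / d.
  by rewrite /M' /ldl_term -/a -/b -/d {1}(divn_eq e r).
set p := M (a * r + v)%N; set q := M (b * r + v)%N.
transitivity (\sum_i (Y i a * Y i b - q / d * (Y i a * Y i v) - p / d * (Y i b * Y i v)
   + p / d * (q / d) * (Y i v * Y i v))); last by apply: eq_bigr => i _; ring.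
rewrite !big_split /= !sumrN -!big_distrr /= -!YE // -/p -/q -/d.
have [dz|dz] := eqVneq d 0; last by field.
by rewrite /p /q !d0 //; ring.
Qed.

Lemma ldl_iter_gram M v : (v <= r)%N -> gram_form M -> gram_form (ldl_iter r M v) /\
  forall a c, (a < r)%N -> (c < v)%N -> ldl_iter r M v (a * r + c)%N = 0.
Proof.
move=> + gM; elim: v => [|v IH] vr //; have [gv zv] := IH (ltnW vr).
exact: (ldl_step vr gv zv).
Qed.

Lemma ldl_diag_ge0 M v : (v < r)%N -> gram_form M -> 0 <= ldl_iter r M v (v * r + v)%N.
Proof.
move=> vr gM; have [gv _] := ldl_iter_gram (ltnW vr) gM.
have [T [Y YE]] := gram_form_flat gv; rewrite YE //.
by apply: sumr_ge0 => i _; rewrite -expr2 sqr_ge0.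
Qed.

(** After r steps every column has been eliminated, so the terms subtracted add up to M. *)
Lemma ldl_sum M e : gram_form M -> (e < r * r)%N ->
  M e = \sum_(v < r) ldl_term r (ldl_iter r M v) v e.
Proof.
move=> gM er; have [_ z] := ldl_iter_gram (leqnn r) gM.
have E k : ldl_iter r M k e = M e - \sum_(v < k) ldl_term r (ldl_iter r M v) v e.
  elim: k => [|k IH]; first by rewrite big_ord0 subr0.
  by rewrite /= IH big_ord_recr /= opprD addrA.
have [ar br] : (e %/ r < r)%N /\ (e %% r < r)%N by rewrite ltn_mod ltn_divLR.
have := z _ _ ar br; rewrite -divn_eq E => /eqP.
by rewrite subr_eq0 => /eqP.
Qed.

(** This identifies the weight with which a row is drawn, computed pivot by pivot, with the
    quadratic form of M at the extended product [h * w]. *)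
Lemma ldl_index_weight M (h w : nat -> R) : gram_form M ->
  \sum_(v < r) (\sum_(c < r) (h c * ldl_iter r M v (c * r + v)%N) * w c) ^+ 2 /
     ldl_iter r M v (v * r + v)%N = quad_form r (fun c => h c * w c) M.
Proof.
move=> gM; transitivity (\sum_(v < r) quad_form r (fun c => h c * w c)
    (fun e => ldl_term r (ldl_iter r M v) v e)); last first.
  rewrite /quad_form exchange_big /=; apply: eq_bigr => e _.
  by rewrite -big_distrr /= -ldl_sum.
apply: eq_bigr => v _; set d := ldl_iter r M v (v * r + v)%N.
transitivity (d^-1 * quad_form r (fun c => h c * w c) (fun e =>
   ldl_iter r M v (e %/ r * r + v)%N * ldl_iter r M v (e %% r * r + v)%N)).
  rewrite (quad_form_rank1 r0 _ (fun a => ldl_iter r M v (a * r + v)%N)) mulrC.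
  by congr (_ * _ ^+ 2); apply: eq_bigr => c _; ring.
rewrite -quad_formZ; apply: eq_bigr => e _; rewrite /ldl_term -/d; ring.
Qed.

End GramForms.

(** * Generalized inverses and leverage scores *)

Section GeneralizedInverse.
Variable R : realType.

Lemma col_mulmx (m n p : nat) (i : 'I_p) (B : 'M[R]_(m, n)) (C : 'M[R]_(n, p)) : col i (B *m C) = B *m col i C.
Proof. by rewrite !colE mulmxA. Qed.

Lemma col_outer (n : nat) (g : 'cV[R]_n) j : col j (g *m g^T) = g j 0 *: g.
Proof. by apply/matrixP => i k; rewrite !mxE big_ord1 !mxE (ord1 k) mulrC. Qed.

Lemma mulmxT_eq0 m n (D : 'M[R]_(m, n)) : D^T *m D = 0 -> D = 0.
Proof.
move=> D0; apply/matrixP => i j; rewrite mxE; have /matrixP /(_ j j) := D0.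
rewrite !mxE => /eqP; rewrite psumr_eq0 => [/allP /(_ i (mem_index_enum i))|k _].
  by rewrite mxE mulf_eq0 orbb => /eqP.
by rewrite mxE -expr2 sqr_ge0.
Qed.

Section Step.
Variables (q r : nat) (A : 'M[R]_(q, r)).
Variable G : 'M[R]_r.
Hypothesis GE : G = A^T *m A.

Let Gsym : G^T = G. Proof. by rewrite GE trmx_mul trmxK. Qed.

(** Let [g = G p], the column [c] of G - G X G. Then X g = 0, p^T G p = d and g_c = d. The update
    adds g g^T / d to G X G; its column [c] is [g], exactly the defect, and its columns j < c vanish
    because g_j = 0 by symmetry. If d = 0 then A p = 0, so [g = 0] and there is no defect to
    repair. *)
Lemma inverse_step (X : 'M[R]_r) (c : 'I_r) :
  let p := col c (1%:M - X *m G) in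
  let d := (p^T *m G) 0 c in
  let X' := X + d^-1 *: (p *m p^T) in
  X^T = X -> X *m G *m X = X ->
  (forall j : 'I_r, (j < c)%N -> col j (G *m X *m G) = col j G) ->
  [/\ X'^T = X', X' *m G *m X' = X' &
    forall j : 'I_r, (j < c.+1)%N -> col j (G *m X' *m G) = col j G].
Proof.
move=> p d X' Xsym XGX GXG.
pose g := G *m p.
have gE : g = col c (G - G *m X *m G).
  by rewrite /g /p -col_mulmx mulmxBr mulmx1 mulmxA.
have Xg : X *m g = 0.
  by rewrite gE -col_mulmx mulmxBr !mulmxA XGX subrr; apply/matrixP => i k; rewrite !mxE.
have gT : g^T = p^T *m G by rewrite /g trmx_mul Gsym.
have gX : p^T *m G *m X = 0 by rewrite -gT -Xsym -trmx_mul Xg trmx0.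
have pE : p = col c 1%:M - X *m col c G.
  by rewrite /p -col_mulmx; apply/matrixP => i k; rewrite !mxE.
have pGp : p^T *m G *m p = d%:M.
  rewrite {2}pE mulmxBr mulmxA gX mul0mx subr0 -col_mulmx mulmx1.
  by apply/matrixP => i k; rewrite !ord1 [in LHS]mxE [in RHS]mxE eqxx mulr1n.
have gd0 : d = 0 -> g = 0.
  move=> d0; have : (A *m p)^T *m (A *m p) = 0.
    rewrite trmx_mul mulmxA -(mulmxA p^T) -GE pGp d0; apply/matrixP => i k.
    by rewrite !mxE mul0rn.
  by move=> /mulmxT_eq0 Ap; rewrite /g GE -mulmxA Ap mulmx0.
have gc : g c 0 = d.
  by rewrite /d -gT [RHS]mxE.
split.
- by rewrite /X' linearD /= linearZ /= trmx_mul trmxK Xsym.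
- rewrite /X' !mulmxDl !mulmxDr XGX -!scalemxAl -!scalemxAr.
  have -> : X *m G *m (p *m p^T) = 0.
    by rewrite mulmxA -(mulmxA X) -/g Xg mul0mx.
  have -> : p *m p^T *m G *m X = 0 by rewrite -!mulmxA (mulmxA p^T) gX mulmx0.
  have -> : p *m p^T *m G *m (p *m p^T) = d *: (p *m p^T).
    by rewrite !mulmxA -!(mulmxA p) -(mulmxA p^T G) (mulmxA p^T) pGp mul_scalar_mx -scalemxAr.
  rewrite !scaler0 add0r addr0 !scalerA; congr (_ + _ *: _).
  by have [->|dn] := eqVneq d 0; [rewrite invr0 !mul0r|field].
move=> j; rewrite ltnS leq_eqVlt => jc.
have gj : (j < c)%N -> g j 0 = 0.
  move=> jc'; have E : (G *m X *m G) c j = G c j.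
    by have /matrixP/(_ c 0) := GXG j jc'; rewrite [LHS]mxE [RHS]mxE.
  have sym : (G *m X *m G) j c = (G *m X *m G) c j.
    by rewrite -[in LHS](trmxK (G *m X *m G)) mxE !trmx_mul Gsym Xsym mulmxA.
  have symG : G j c = G c j by rewrite -[in LHS]Gsym mxE.
  have -> : g j 0 = G j c - (G *m X *m G) j c.
    by rewrite gE [LHS]mxE [LHS]mxE; congr (_ + _); rewrite [LHS]mxE.
  by rewrite sym symG E subrr.
have expand : G *m X' *m G = G *m X *m G + d^-1 *: (g *m g^T).
  rewrite /X' mulmxDr mulmxDl -scalemxAr -scalemxAl; congr (_ + _ *: _).
  by rewrite gT /g !mulmxA.
rewrite expand linearD /= linearZ /= col_outer.
case/orP: jc => [/eqP jc|jc]; last by rewrite gj // scale0r scaler0 addr0 GXG.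
have -> : j = c by apply: val_inj.
rewrite gc scalerA; have [dz|dn] := eqVneq d 0.
  rewrite dz mulr0 scale0r addr0; have := gd0 dz; rewrite gE.
  by move/eqP; rewrite linearB /= subr_eq0 => /eqP.
by rewrite mulVf // scale1r gE linearB /= addrC subrK.
Qed.

End Step.

Section Leverage.
Variables (q r : nat) (A : 'M[R]_(q, r)) (X : 'M[R]_r).
Variable G : 'M[R]_r.
Hypothesis GE : G = A^T *m A.
Hypothesis Xsym : X^T = X.
Hypothesis XGX : X *m G *m X = X.
Hypothesis GXG : G *m X *m G = G.

(** The matrix A (Y G - 1) is killed by A^T, hence D^T D = 0 for this difference D. *)
Lemma mulmx_ginv (Y : 'M[R]_r) : G *m Y *m G = G -> A *m Y *m G = A.
Proof.
move=> GYG; apply/eqP; rewrite -subr_eq0; apply/eqP/mulmxT_eq0.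
have -> : A *m Y *m G - A = A *m (Y *m G - 1%:M) by rewrite mulmxBr mulmx1 mulmxA.
by rewrite trmx_mul -mulmxA (mulmxA A^T) -GE mulmxBr mulmxA GYG mulmx1 subrr mulmx0.
Qed.

(** Leverage scores do not see which inner inverse is taken: with P the pseudoinverse, A P G = A and
    G P A^T = A^T, so A X A^T = (A P) (G X G) (P A^T) = A P A^T. *)
Lemma leverageE i : leverage A i = (A *m X *m A^T) i i.
Proof.
have Gsym : G^T = G by rewrite GE trmx_mul trmxK.
set P := Defs.pinv G; have [P1 P2 P3 P4] : penrose G P := pinvP G.
have Psym : P^T = P.
  apply: (@penrose_uniq _ _ _ G); last by split.
  split.
  - by rewrite -[RHS]Gsym -[in RHS]P1 !trmx_mul Gsym mulmxA.
  - by rewrite -[in RHS]P2 !trmx_mul Gsym mulmxA.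
  - by rewrite trmx_mul trmxK Gsym -P4 trmx_mul Gsym.
  - by rewrite trmx_mul trmxK Gsym -P3 trmx_mul Gsym.
have AP := mulmx_ginv P1.
have APt : G *m P *m A^T = A^T.
  by rewrite -[RHS](congr1 trmx AP) !trmx_mul Gsym Psym mulmxA.
have -> : A *m X *m A^T = A *m P *m A^T.
  transitivity ((A *m P) *m (G *m X *m G) *m (P *m A^T)).
    by rewrite !mulmxA AP -!mulmxA (mulmxA G P) APt.
  by rewrite GXG -mulmxA (mulmxA G P) APt.
rewrite /leverage -GE -/P tr_row -row_mul !mxE.
by apply: eq_bigr => k _; rewrite !mxE.
Qed.

Lemma leverage_ge0 i : 0 <= leverage A i.
Proof.
rewrite leverageE -{1}XGX -[X in _ <= (A *m (_ *m X) *m _) _ _]Xsym.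
have -> : A *m (X *m G *m X^T) *m A^T = (A *m X *m A^T) *m (A *m X *m A^T)^T.
  by rewrite GE !trmx_mul trmxK !mulmxA.
by rewrite mxE sumr_ge0 // => k _; rewrite [X in _ * X]mxE -expr2 sqr_ge0.
Qed.

(** The matrix H = A X A^T is a symmetric idempotent, so H_ii is the squared norm of row i. If all
    scores vanish then H = 0, and A = A X G = H A = 0. *)
Lemma sum_leverage_gt0 : A != 0 -> 0 < \sum_i leverage A i.
Proof.
move=> A0; rewrite lt_neqAle sumr_ge0 ?andbT => [|i _]; last exact: leverage_ge0.
apply: contra A0 => /eqP /esym /eqP; rewrite psumr_eq0 => [/allP l0|i _]; last exact: leverage_ge0.
have sq : (A *m X *m A^T) *m (A *m X *m A^T)^T = A *m X *m A^T.
  transitivity (A *m (X *m G *m X) *m A^T); last by rewrite XGX.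
  by rewrite GE !trmx_mul trmxK Xsym !mulmxA.
have AXA : A *m X *m A^T = 0.
  apply: trmx_inj; rewrite trmx0; apply: mulmxT_eq0; rewrite trmxK sq.
  apply/matrixP => i k; rewrite [RHS]mxE.
  have rowi : row i (A *m X *m A^T) = 0.
    apply: trmx_inj; rewrite trmx0; apply: mulmxT_eq0; rewrite trmxK.
    apply/matrixP => a b; rewrite !ord1 [RHS]mxE.
    have /eqP := l0 i (mem_index_enum i); rewrite leverageE -{1}sq => <-.
    by rewrite !mxE; apply: eq_bigr => t _; rewrite !mxE.
  by have /matrixP /(_ 0 k) := rowi; rewrite !mxE.
by rewrite -(mulmx_ginv GXG) GE mulmxA AXA mul0mx.
Qed.

Lemma leverage_sum : \sum_i leverage A i = \sum_a \sum_b X a b * G a b.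
Proof.
transitivity (\tr (X *m G)).
  rewrite GE mulmxA mxtrace_mulC mulmxA /mxtrace.
  by apply: eq_bigr => i _; rewrite leverageE.
rewrite /mxtrace; apply: eq_bigr => a _; rewrite mxE; apply: eq_bigr => b _.
by congr (_ * _); rewrite -[in LHS](_ : G^T = G) ?mxE // GE trmx_mul trmxK.
Qed.

End Leverage.
End GeneralizedInverse.

(** * Leverage mass of the extensions of a partial index *)

Section Chain.
Variables (R : realType) (r : nat) (n : nat -> nat) (u : nat -> nat -> nat -> R).
Variables (m : nat) (f : nat -> nat) (q : nat) (A : 'M[R]_(q, r)).
Hypothesis r0 : (0 < r)%N.
Local Notation suffix_prod := (gram_suffix r n u m f).

Definition mxflat (Q : nat -> R) : 'M[R]_r := \matrix_(a, b) Q (a * r + b)%N.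

Hypothesis GA : mxflat (suffix_prod 0) = A^T *m A.

Definition ginv : nat -> R := ginv_iter r (suffix_prod 0) r.

Lemma mxflat_inv_step X G (c : 'I_r) :
  let p := col c (1%:M - mxflat X *m mxflat G) in
  mxflat (inv_step r X G c) =
  mxflat X + ((p^T *m mxflat G) 0 c)^-1 *: (p *m p^T).
Proof.
move=> p; have pE (a : 'I_r) : p a 0 = inv_dir r X G c a.
  rewrite /inv_dir !mxE -val_eqE /=; congr (_ - _); first by case: eqP.
  by apply: eq_bigr => b _; rewrite !mxE.
apply/matrixP => a b; rewrite [LHS]mxE [RHS]mxE [X in X + _]mxE [X in _ + X]mxE.
rewrite /inv_step flat_div // flat_mod //; congr (_ + _); rewrite mulrC; congr (_ * _).
  by congr (_^-1); rewrite [RHS]mxE; apply: eq_bigr => t _; rewrite -pE [in RHS]mxE [X in _ = _ * X]mxE.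
by rewrite [RHS]mxE big_ord1 [X in _ = _ * X]mxE !pE.
Qed.

Lemma inv_iter_spec c : (c <= r)%N ->
  let X := mxflat (ginv_iter r (suffix_prod 0) c) in
  let G := mxflat (suffix_prod 0) in
  [/\ X^T = X, X *m G *m X = X & forall j : 'I_r, (j < c)%N -> col j (G *m X *m G) = col j G].
Proof.
elim: c => [|c IH] cr.
  have X0 : mxflat (fun=> 0) = 0 by apply/matrixP => a b; rewrite !mxE.
  by rewrite /= X0; split; rewrite ?trmx0 ?mul0mx.
have [h1 h2 h3] := IH (ltnW cr).
rewrite [ginv_iter _ _ _]/= (mxflat_inv_step _ _ (Ordinal cr)).
exact: (inverse_step (c := Ordinal cr) GA h1 h2 h3).
Qed.

Let X := mxflat ginv.
Let G := mxflat (suffix_prod 0).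

Lemma ginv_sym : X^T = X. Proof. by have [] := inv_iter_spec (leqnn r). Qed.

Lemma ginv_reflexive : X *m G *m X = X. Proof. by have [] := inv_iter_spec (leqnn r). Qed.

Lemma ginv_inner : G *m X *m G = G.
Proof.
have [_ _ h] := inv_iter_spec (leqnn r).
by apply/matrixP => a b; have /matrixP /(_ a 0) := h b (ltn_ord b); rewrite [LHS]mxE [RHS]mxE.
Qed.

Lemma ginv_gram_form : gram_form r ginv.
Proof.
(* The vectors are the rows of A X, since X = X G X = (A X)^T (A X). *)
exists 'I_q, (fun i a => if insub a is Some a' then (A *m X) i a' else 0) => e er.
have [ar br] : (e %/ r < r)%N /\ (e %% r < r)%N by rewrite ltn_mod ltn_divLR.
have -> : ginv e = X (Ordinal ar) (Ordinal br) by rewrite /X mxE /= -divn_eq.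
have XE : X = (A *m X)^T *m (A *m X).
  by rewrite trmx_mul ginv_sym -mulmxA (mulmxA A^T) -GA mulmxA ginv_reflexive.
rewrite {1}XE mxE; apply: eq_bigr => i _; rewrite !insubT mxE.
by congr (_ * _); congr (_ i _); apply: val_inj.
Qed.

Lemma suffix_prod_gram_form k : gram_form r (suffix_prod k).
Proof.
rewrite /gram_suffix; elim: {k}(m - k)%N {-2}k (erefl (m - k)%N) => [|l IH] k kl.
  apply: eq_gram_form (gram_form1 R r) => e _.
  by rewrite big_geq //; lia.
have km : (k < m)%N by lia.
apply: eq_gram_form; last apply: (gram_formM (M := gram_entry r n u (f k))); last first.
- by apply: (IH k.+1); lia.
- by exists 'I_(n (f k)), (fun (i : 'I_(n (f k))) => u (f k) i).
by move=> e _ /=; rewrite [in RHS]big_ltn.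
Qed.

Definition cond k e : R := ginv e * suffix_prod k e.

Lemma cond_gram_form k : gram_form r (cond k).
Proof. exact: gram_formM ginv_gram_form (suffix_prod_gram_form k). Qed.

(* The total leverage score of the rows that extend a partial index, where
   [h] is the entrywise product of the rows chosen so far. *)
Definition level k h : R := quad_form r h (cond k).

Lemma level_ge0 k h : 0 <= level k h.
Proof. exact: quad_form_ge0 (cond_gram_form k). Qed.

(** Conservation of mass: summing over the rows of the next matrix rebuilds its Gram matrix, the
    factor by which the suffix products for [k] and [k.+1] differ. *)
Lemma level_step k h : (k < m)%N ->
  \sum_(t < n (f k)) level k.+1 (fun c => h c * u (f k) t c) = level k h.
Proof.
move=> km; rewrite /level /quad_form exchange_big /=; apply: eq_bigr => e _.
rewrite /cond /gram_suffix [in RHS]big_ltn //.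
set P := \prod_(_ <= _ < _) _; set S := gram_entry _ _ _ _ _.
have -> : h (e %/ r)%N * h (e %% r)%N * (ginv e * (S * P)) =
  S * (h (e %/ r)%N * h (e %% r)%N * ginv e * P) by ring.
rewrite /S /gram_entry [RHS]big_distrl /=.
by apply: eq_bigr => t _; ring.
Qed.

Lemma eq_level k h h' : (forall c, (c < r)%N -> h c = h' c) -> level k h = level k h'.
Proof.
move=> hh; apply: eq_bigr => e _.
by rewrite !hh // ?ltn_mod // ltn_divLR.
Qed.

Lemma level_le k h t : (k < m)%N -> (t < n (f k))%N ->
  level k.+1 (fun c => h c * u (f k) t c) <= level k h.
Proof.
move=> km tn; rewrite -(level_step h km) (bigD1 (Ordinal tn)) //= lerDl.
by apply: sumr_ge0 => t' _; exact: level_ge0.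
Qed.

Definition partial_row (o : nat -> nat) k c : R := \prod_(i < k) u (f i) (o i) c.

Lemma partial_rowS o k c : partial_row o k.+1 c = partial_row o k c * u (f k) (o k) c.
Proof. by rewrite /partial_row big_ord_recr. Qed.

Lemma level_row_anti o k : (forall i, (i < m)%N -> (o i < n (f i))%N) -> (k < m)%N ->
  level k.+1 (partial_row o k.+1) <= level k (partial_row o k).
Proof.
move=> oN km; apply: le_trans (level_le (partial_row o k) km (oN k km)).
by rewrite (@eq_level _ _ (fun c => partial_row o k c * u (f k) (o k) c)) // => c _; exact: partial_rowS.
Qed.

(** If the mass of a prefix vanishes, so does the score of every row that extends it; this settles
    the divisions by zero in conditional probabilities. *)
Lemma level_row_le o k : (forall i, (i < m)%N -> (o i < n (f i))%N) -> (k <= m)%N ->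
  level m (partial_row o m) <= level k (partial_row o k).
Proof.
move=> oN; elim: {k}(m - k)%N {-2}k (erefl (m - k)%N) => [|l IH] k kl km.
  by have -> : k = m by lia.
apply: le_trans (level_row_anti oN _); last by lia.
by apply: IH; lia.
Qed.

(** At the all-one vector the form of X * G is the sum of its entries, the trace of X G. *)
Lemma level0 : level 0 (fun=> 1) = \sum_i leverage A i.
Proof.
rewrite (leverage_sum GA ginv_inner).
transitivity (\sum_(a < r) \sum_(b < r) ginv (a * r + b)%N * suffix_prod 0 (a * r + b)%N).
  rewrite -(sum_flat r0 (fun a b => ginv (a * r + b)%N * suffix_prod 0 (a * r + b)%N)) /level.
  by apply: eq_bigr => e _; rewrite !mul1r -divn_eq.
by apply: eq_bigr => a _; apply: eq_bigr => b _; rewrite !mxE.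
Qed.

Lemma levelm (h : nat -> R) i : (forall c : 'I_r, A i c = h c) -> level m h = leverage A i.
Proof.
move=> Ah; rewrite (leverageE GA ginv_inner).
transitivity (\sum_(e < r * r) h (e %/ r)%N * h (e %% r)%N * ginv (e %/ r * r + e %% r)%N).
  apply: eq_bigr => e _; rewrite /cond /gram_suffix big_geq // mulr1 -divn_eq //.
rewrite (sum_flat r0 (fun a b => h a * h b * ginv (a * r + b)%N)) exchange_big /=.
rewrite mxE; apply: eq_bigr => b _; rewrite !mxE big_distrl /=.
by apply: eq_bigr => a _; rewrite !Ah mxE; ring.
Qed.

Lemma level0_gt0 : A != 0 -> 0 < level 0 (fun=> 1).
Proof.
by rewrite level0; exact: (sum_leverage_gt0 GA ginv_sym ginv_reflexive ginv_inner).
Qed.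

End Chain.

(** * Drawing all the samples *)

Section Steps.
Variables (R : realType) (W : nat).
Implicit Types s : state R.

(** Time, invariant and expectation are carried together, because each step of the expectation
    argument relies on the invariant. *)
Definition steps c s (T : nat) (Q : state R -> Prop) (phi : state R -> R) (v : R) :=
  safe W c s T Q /\ wp W c s phi = v.

Lemma steps_after c1 c2 s T1 T2 Q1 Q phi v :
  safe W c1 s T1 Q1 -> (forall s1, Q1 s1 -> frame c1 s s1 -> steps c2 s1 T2 Q phi v) ->
  steps (c1 ;; c2) s (T1 + T2) Q phi v.
Proof.
move=> h1 h2; split; first by apply: safe_Seq h1 _ => s1 Qs f1; have [] := h2 s1 Qs f1.
by apply: (wp_Seq_safe (safe_frame h1)) => s1 [Qs f1]; have [] := h2 s1 Qs f1.
Qed.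

Lemma steps_mono c s T T' (Q Q' : state R -> Prop) phi phi' v :
  steps c s T Q phi v -> (T <= T')%N -> (forall s', Q s' -> Q' s') ->
  (forall s', phi s' = phi' s') -> steps c s T' Q' phi' v.
Proof.
move=> [h <-] TT QQ pp; split; first exact: safe_mono h TT QQ.
by apply: (eq_wp h) => s' _.
Qed.

Lemma steps_frame c s T Q phi v :
  steps c s T Q phi v -> steps c s T (fun s' => Q s' /\ frame c s s') phi v.
Proof. by move=> [h1 h2]; split=> //; exact: safe_frame. Qed.

Lemma steps_loop x e c s n (T : nat -> nat) (I : nat -> state R -> Prop) phi :
  ieval s e = n -> (n <= W)%N -> I 0%N s ->
  (forall i s' v, I i s' -> I i (set_reg W s' x v)) ->
  (forall i s' v, phi i (set_reg W s' x v) = phi i s') ->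
  (forall i s', (i < n)%N -> frame (For x e c) s s' -> reg s' x = i -> I i s' ->
     steps c s' (T i) (I i.+1) (phi i.+1) (phi i s')) ->
  steps (For x e c) s ((icost e).+1 + \sum_(i < n) (T i).+1) (I n) (phi n) (phi 0%N s).
Proof.
move=> en nW I0 Ireg phireg H; split.
  by apply: safe_loop => // i s' il fs xi Is; have [] := H i s' il fs xi Is.
have H' i s' : (i < n)%N -> I i s' /\ frame (For x e c) s s' ->
    steps c (set_reg W s' x i) (T i) (I i.+1) (phi i.+1) (phi i s').
  move=> il [Is fs]; rewrite -(phireg i s' i); apply: H => //; first exact: frame_For.
    by rewrite /= eqxx modn_small // (leq_trans il).
  exact: Ireg.
rewrite -en; apply: (@wp_For R W x e c s T (fun i s' => I i s' /\ frame (For x e c) s s')).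
- by split=> //; exact: framed_refl.
- move=> i s' il IF; rewrite en in il; have [/safe_frame h _] := H' i s' il IF.
  apply: safe_post h _ => s2 [Is2 f2]; split=> //; apply: framed_trans IF.2 _.
  apply: (framed_trans (s2 := set_reg W s' x i)).
    by apply: framed_set_reg; rewrite inE eqxx.
  by apply: framed_sub f2 => // y yc; rewrite inE yc orbT.
- by move=> i s' il IF; rewrite en in il; have [] := H' i s' il IF.
Qed.

End Steps.

Section Sampling.
Variables (R : realType) (W N r : nat) (n : nat -> nat) (u : nat -> nat -> nat -> R).
Implicit Types s : state R.
Hypothesis r0 : (0 < r)%N.
Hypothesis n0 : forall j, (j < N)%N -> (0 < n j)%N.
Local Notation off := (row_offset r n).
Local Notation nblk := (block_count r n).
Variables (m : nat) (f : nat -> nat).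
Local Notation ready := (ready N r n u m f).
Hypothesis hW : (16 * (off N + r ^ 3) <= W)%N.
Variables (p : nat) (A : 'M[R]_(p, r)).
Local Notation suffix_prod := (gram_suffix r n u m f).
Local Notation level := (level r n u m f).
Local Notation row_prod := (partial_row u f).
Local Notation cond := (cond r n u m f).
Hypothesis GA : mxflat r (suffix_prod 0) = A^T *m A.
Variables (J : nat) (target : nat -> nat -> nat).
Hypothesis target_lt : forall d k, (d < J)%N -> (k < m)%N -> (target d k < n (f k))%N.
Local Notation q := (r * r)%N.

Lemma eq_row_prod o o' k c : (forall i, (i < k)%N -> o i = o' i) ->
  row_prod o k c = row_prod o' k c.
Proof. by move=> oo; apply: eq_bigr => i _; rewrite oo. Qed.

Definition out_row s d i : nat := ird s Out (d * m + i).

Definition score d : R := level m (row_prod (target d) m).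

(* The probability that a sample agrees with its target, given that its first
   [k] indices do. *)
Definition chance d k : R :=
  if k == m then 1 else score d / level k (row_prod (target d) k).

Definition agree d k (o : nat -> nat) : bool := [forall i : 'I_k, o i == target d i].

Definition term d k o : R := if agree d k o then chance d k else 0.

(** A product over the samples, as these are independent given the input. Each sample has its own
    progress because a batch advances all its samples by one index before the next index is
    drawn. *)
Definition potential (kappa : nat -> nat) s : R :=
  \prod_(d < J) term d (kappa d) (out_row s d).

(* The number of indices of sample [d] that are known when batch [b] has
   reached index [k] and has drawn this index for its first [x] samples. *)
Definition progress b k x d : nat :=
  if (d < b * q)%N then m else if (d < b * q + x)%N then k.+1
  else if (d < b.+1 * q)%N then k else 0%N.

Lemma eq_potential kappa kappa' s : (forall d, (d < J)%N -> kappa d = kappa' d) ->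
  potential kappa s = potential kappa' s.
Proof. by move=> kk; apply: eq_bigr => d _; rewrite kk. Qed.

Lemma potential_frame c s s' kappa : frame c s s' -> Out \notin wwords c ->
  potential kappa s' = potential kappa s.
Proof.
move=> fs nc; apply: eq_bigr => d _; congr (term _ _ _); apply/funext => i.
exact: frame_ird fs nc _.
Qed.

Lemma eq_term d k o o' : (forall i, (i < k)%N -> o i = o' i) -> term d k o = term d k o'.
Proof.
move=> oo; rewrite /term; have -> // : agree d k o = agree d k o'.
by apply: eq_forallb => i; rewrite oo.
Qed.

Lemma agreeS d k o : agree d k.+1 o = agree d k o && (o k == target d k).
Proof.
apply/forallP/andP => [H|[/forallP H /eqP ok] i].
  by split; [apply/forallP => i; exact: H (widen_ord (leqnSn k) i)|exact: H ord_max].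
have := ltn_ord i; rewrite ltnS leq_eqVlt => /orP [/eqP ->|ik]; first by rewrite ok.
exact: H (Ordinal ik).
Qed.

(** The quotient of consecutive levels is the probability of hitting the target at index [k]. If the
    numerator vanishes, the score of the target, which is at most that numerator, is 0 and both
    sides vanish. *)
Lemma chance_step d k : (d < J)%N -> (k < m)%N ->
  level k.+1 (row_prod (target d) k.+1) / level k (row_prod (target d) k) * chance d k.+1 =
  chance d k.
Proof.
move=> dJ km; rewrite /chance [k == m]ltn_eqF //; case: eqP => [->|/eqP km1].
  by rewrite mulr1.
set l := level k.+1 _; set l' := level k _.
have [l0|l0] := eqVneq l 0; last first.
  by transitivity (l / l * (score d / l')); [ring|rewrite divff ?mul1r].
suff -> : score d = 0 by rewrite !mul0r mulr0.
apply/eqP; rewrite eq_le (level_ge0 r0 GA) andbT -l0.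
by apply: (level_row_le r0 GA) => // i im; exact: target_lt.
Qed.

Record prepared s : Prop := Prepared {
  prepared_ready : ready s;
  prepared_count : ird s Arg 0 = J;
  prepared_out : size (imem s Out) = (J * m)%N }.

Lemma prepared_frame c s s' : frame c s s' ->
  spares [:: Arg; Inp; Data 0; Data 1] [:: Inp; Data 0] c -> prepared s -> prepared s'.
Proof.
move=> fs fc [h1 h2 h3]; split; first exact: (ready_frame r0 fs fc h1).
- by move: fc => /andP [/andP [a1 _] _]; rewrite (frame_ird fs).
- by rewrite (fr_wsize fs).
Qed.

Definition batch_size b := (q - (q - (J - b * q)))%N.

(** The positive mass of the prefix is part of the invariant: it makes the total weight of the next
    draw positive. *)
Definition hist_ok s b d k := let o := out_row s (b * q + d) in
  (forall c, (c < r)%N -> rd s sHist (d * r + c) = row_prod o k c) /\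
  0 < level k (row_prod o k).

Lemma hist_ok_eq s s' b d k : (forall i, (i < k)%N -> out_row s' (b * q + d) i = out_row s (b * q + d) i) ->
  (forall c, (c < r)%N -> rd s' sHist (d * r + c) = rd s sHist (d * r + c)) ->
  hist_ok s b d k -> hist_ok s' b d k.
Proof.
move=> oo hh [h1 h2].
have E c : row_prod (out_row s' (b * q + d)) k c = row_prod (out_row s (b * q + d)) k c.
  exact: eq_row_prod.
split=> [c cr|]; first by rewrite E hh // h1.
by rewrite (@eq_level _ _ n u m f r0 k _ (row_prod (out_row s (b * q + d)) k)).
Qed.

Definition drawn b k x s := prepared s /\ forall d, (d < batch_size b)%N ->
  hist_ok s b d (if (d < x)%N then k.+1 else k).

Definition factored k s := [/\
  forall v c, (v < r)%N -> (c < r)%N ->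
    rd s sFac (v * r + c) = ldl_iter r (cond k.+1) v (c * r + v)%N,
  forall v e, (v < r)%N -> (e < q)%N ->
    node r s sTree 0 (r + v) e =
      ldl_term r (ldl_iter r (cond k.+1) v) v e * gram_entry r n u (f k) e &
  heap r s sTree 0 r].

Definition index_time k := (2000 * (q * (trunc_log 2 r + trunc_log 2 (nblk (f k)) + 1)))%N.

Lemma sample_index_steps s b k d : (k < m)%N -> (d < batch_size b)%N ->
  reg s 2 = f k -> reg s 6 = k -> reg s 7 = b -> reg s 8 = d ->
  factored k s -> drawn b k d s ->
  steps W sample_index s (index_time k) (drawn b k d.+1)
    (potential (progress b k d.+1)) (potential (progress b k d) s).
Proof.
move=> km db j2 k6 b7 d8 [facE leafE heapE] [ps hs]; have rs := prepared_ready ps.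
have dq : (d < q)%N by move: db; rewrite /batch_size; lia.
set D := (b * q + d)%N; have DJ : (D < J)%N by move: db; rewrite /batch_size /D; lia.
have [hE l0] := hs d db; rewrite ltnn -/D in hE l0.
set h := row_prod (out_row s D) k in hE l0.
pose fac v c := ldl_iter r (cond k.+1) v (c * r + v)%N.
have gf := cond_gram_form r0 GA k.+1.
have wE t : index_weight r u f k h fac t = level k.+1 (fun c => h c * u (f k) t c).
  exact: ldl_index_weight.
have totE : \sum_(t < n (f k)) index_weight r u f k h fac t = level k h.
  by rewrite -level_step //; apply: eq_bigr => t _; exact: wE.
have slot_lt : ((b * q + d) * m + k < size (imem s Out))%N.
  rewrite (prepared_out ps); apply: (@leq_trans (D.+1 * m)); last by rewrite leq_mul2r DJ orbT.
  by rewrite mulSn addnC ltn_add2r.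
have [sf wpf] := sample_index_draws r0 n0 hW km rs j2 k6 b7 d8 dq hE facE leafE heapE
  (fun v vr => ldl_diag_ge0 r0 vr gf) slot_lt (eq_ind_r (fun x => 0 < x) l0 totE).
have out_other s' t : index_post r n u m f s k b d h fac t s' ->
    forall D' i, (i < m)%N -> out_row s' D' i = if (D' == D) && (i == k) then t else out_row s D' i.
  move=> [fs _ _ [ o1 o2] _] D' i im; rewrite /out_row; case: ifP => [/andP [/eqP -> /eqP ->]|ne].
    exact: o1.
  apply: o2; apply/eqP => E; move/negP: ne; apply.
  have E1 := congr1 (divn^~ m) E; have E2 := congr1 (modn^~ m) E.
  have m0 : (0 < m)%N by apply: leq_ltn_trans km.
  rewrite /= !divnMDl // !(divn_small, addn0) // in E1.
  by rewrite /= !modnMDl !modn_small // in E2; rewrite E1 E2 !eqxx.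
split.
  apply: safe_post sf _ => s' [t post]; have oo := out_other s' t post.
  have [fs tn w0 _ [h1 h2]] := post.
  split; first exact: (prepared_frame fs isT ps).
  move=> d' db'; have [->|ne] := eqVneq d' d; last first.
    have -> : (d' < d.+1)%N = (d' < d)%N by lia.
    apply: hist_ok_eq (hs d' db') => [i ik|c cr].
      rewrite oo; last by move: ik; case: ifP; lia.
      by rewrite ifF //; apply/negP => /andP [/eqP]; rewrite /D; lia.
    apply: h2; apply/negP; have [lt|lt] : (d' < d)%N \/ (d < d')%N by lia.
      have : (d'.+1 * r <= d * r)%N by rewrite leq_mul2r lt orbT.
      by rewrite mulSn; lia.
    have : (d.+1 * r <= d' * r)%N by rewrite leq_mul2r lt orbT.
    by rewrite mulSn; lia.
  rewrite ltnSn; have E c : row_prod (out_row s' D) k.+1 c = h c * u (f k) t c.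
    rewrite partial_rowS oo // !eqxx; congr (_ * _); apply: eq_row_prod => i ik.
    by rewrite oo ?(ltn_trans ik) // (ltn_eqF ik) andbF.
  split=> [c cr|]; first by rewrite E h1.
  by rewrite (@eq_level _ _ n u m f r0 _ _ (fun c => h c * u (f k) t c)) -?wE // => c _; exact: E.
(* Only sample D moves in this step; the factors of all other samples are constant. *)
pose P := \prod_(D' < J | D' != Ordinal DJ) term D' (progress b k d D') (out_row s D').
have progD' (D' : 'I_J) : D' != Ordinal DJ -> progress b k d.+1 D' = progress b k d D'.
  rewrite -val_eqE /= /progress => ne.
  by have -> : (D' < b * q + d.+1)%N = (D' < b * q + d)%N by move: ne; rewrite /D; lia.
have progDS : progress b k d.+1 D = k.+1.
  by rewrite /progress ifF ?ifT // /D; lia.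
have progD : progress b k d D = k.
  by rewrite /progress ifF 1?ifF ?ifT // ?mulSn; move: dq; rewrite /D; clear; lia.
have prog_le x D' : (progress b k x D' <= m)%N by rewrite /progress; do !case: ifP => // _; exact: ltnW.
rewrite (wpf _ (fun t => P * (if agree D k (out_row s D) && (t == target D k)
   then chance D k.+1 else 0))); last first.
  move=> t s' post; have oo := out_other s' t post.
  rewrite /potential (bigD1 (Ordinal DJ)) //= mulrC; congr (_ * _).
    apply: eq_bigr => D' ne; rewrite progD' //; apply: eq_term => i ik.
    rewrite oo; last by apply: leq_trans ik (prog_le _ _).
    by move: ne; rewrite -val_eqE /= => /negbTE ->.
  rewrite progDS /term agreeS oo // !eqxx; congr (if _ && _ then _ else _).
  apply: eq_forallb => i; rewrite oo ?(ltn_trans (ltn_ord i)) // (ltn_eqF (ltn_ord i)) andbF //.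
rewrite totE /potential [in RHS](bigD1 (Ordinal DJ)) //= progD [in RHS]mulrC -/P.
transitivity (P * \sum_(t < n (f k)) index_weight r u f k h fac t / level k h *
   (if agree D k (out_row s D) && (t == target D k :> nat) then chance D k.+1 else 0)).
  by rewrite big_distrr /=; apply: eq_bigr => t _; ring.
congr (_ * _); rewrite /term; case: ifP => [ag|_]; last first.
  by rewrite big1 // => t _; rewrite mulr0.
have tn := target_lt DJ km.
(* Of all rows that may be drawn, only the target keeps the factor of sample D from being 0. *)
rewrite (bigD1 (Ordinal tn)) //= eqxx [X in _ + X]big1 ?addr0 => [|t]; last first.
  by rewrite -val_eqE /= => /negbTE ->; rewrite mulr0.
have hT c : h c = row_prod (target D) k c.
  by apply: eq_row_prod => i ik; have /forallP /(_ (Ordinal ik)) /eqP := ag.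
rewrite wE -(chance_step DJ km); congr (_ / _ * _); apply: eq_level => // c _.
by rewrite partial_rowS hT.
Qed.

Lemma drawn_frame c s s' b k x : frame c s s' ->
  spares [:: Arg; Inp; Data 0; Data 1] [:: Inp; Data 0] c -> spares [:: Out] [:: sHist] c ->
  drawn b k x s -> drawn b k x s'.
Proof.
move=> fs fc /andP [/andP [a7 _] /andP [a8 _]] [h1 h2]; split; first exact: prepared_frame fs fc h1.
move=> d db; apply: hist_ok_eq (h2 d db) => [i _|c' _]; first exact: frame_ird fs a7 _.
exact: frame_rd fs a8 _.
Qed.

Lemma frame_set_reg x s v : frame (SetReg x (IConst 0)) s (set_reg W s x v).
Proof. by apply: framed_set_reg; rewrite inE. Qed.

Lemma prepared_set_reg s x v : prepared s -> prepared (set_reg W s x v).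
Proof. exact: (prepared_frame (frame_set_reg x s v) isT). Qed.

Lemma drawn_set_reg b k i s x v : drawn b k i s -> drawn b k i (set_reg W s x v).
Proof. exact: (drawn_frame (frame_set_reg x s v) isT isT). Qed.

Definition precomputed k s := forall e, (e < q)%N ->
  [/\ rd s sInv e = ginv r n u m f e, rd s sProd e = nonzero_prod r n u m f k e &
      rd s sZero e = zero_count r n u m f k e].

Lemma sample_step_steps s b k : (k < m)%N -> reg s 6 = k -> reg s 7 = b ->
  drawn b k 0 s -> precomputed k s ->
  steps W sample_step s (1600 * r ^ 3 + batch_size b * (index_time k).+1)
    (fun s' => drawn b k.+1 0 s' /\ precomputed k.+1 s')
    (potential (progress b k.+1 0)) (potential (progress b k 0) s).
Proof.
move=> km k6 b7 ds pre; have [ps _] := ds; have rs := prepared_ready ps.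
have [pm pf pN] := ready_picks rs; have jN := pN k km.
have rr3 := rr_le r0; have r3 : (0 < r ^ 3)%N by rewrite expn_gt0 r0.
apply: (steps_mono (Q := fun s' => drawn b k (batch_size b) s' /\ precomputed k.+1 s')
  (phi := potential (progress b k (batch_size b)))).
- apply: steps_after.
    apply: (@safe_SetReg R W 2 (ePick vK) s (fun s' => reg s' 2 = f k)).
    rewrite /= -/(ird _ _ _) k6 pf // modn_small //.
    by apply: (lt_W r0 hW); have := off_geN r0 n0 (leqnn N); lia.
  move=> s1 j1 f1; have ds1 := drawn_frame f1 isT isT ds.
  have rs1 := prepared_ready ds1.1; have es1 := ready_env rs1.
  apply: steps_after.
    apply: (gram_matrix_safe r0 n0 hW (j := f k) es1 (ready_rows rs1) j1 jN).
      exact: (ready_tree rs1).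
    by have := ready_size rs1 (isT : 7 < 14)%N; lia.
  move=> s2 G2 f2; have ds2 := drawn_frame f2 isT isT ds1.
  have rs2 := prepared_ready ds2.1.
  apply: steps_after.
    apply: (conditional_matrix_safe r0 hW (k0 := k) (X := ginv r n u m f) rs2 km) => e er.
    rewrite G2 // !(frame_rd f2) // !(frame_rd f1) //.
    by have [] := pre e er.
  move=> s3 M3 f3; have ds3 := drawn_frame f3 isT isT ds2.
  have rs3 := prepared_ready ds3.1.
  apply: steps_after.
    apply: (factorize_safe r0 hW (G := gram_entry r n u (f k)) (M := cond k.+1) rs3) => e er.
    by rewrite (frame_rd f3) // G2 //; have [_ _ ->] := M3 e er.
  move=> s4 fac4 f4; have ds4 := drawn_frame f4 isT isT ds3.
  rewrite -(potential_frame (progress b k 0) f1) // -(potential_frame (progress b k 0) f2) //.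
  rewrite -(potential_frame (progress b k 0) f3) // -(potential_frame (progress b k 0) f4) //.
  have es4 := ready_env (prepared_ready ds4.1).
  have b4 : reg s4 7 = b by rewrite (frame_reg f4) // (frame_reg f3) // (frame_reg f2) // (frame_reg f1).
  have j4 : reg s4 2 = f k by rewrite (frame_reg f4) // (frame_reg f3) // (frame_reg f2).
  have k4 : reg s4 6 = k by rewrite (frame_reg f4) // (frame_reg f3) // (frame_reg f2) // (frame_reg f1).
  apply: steps_mono; first apply: steps_frame.
  + apply: (@steps_loop R W 8 _ _ s4 (batch_size b) (fun=> index_time k) (fun x => drawn b k x)
      (fun x => potential (progress b k x))).
    * by rewrite /eLeft !evalE (env_r es4) b4 (prepared_count ds4.1).
    * by apply/ltnW/(lt_W r0 hW); rewrite /batch_size; lia.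
    * exact: ds4.
    * by move=> d s5 v; exact: drawn_set_reg.
    * by [].
    move=> d s5 db f5 d5 ds5; apply: sample_index_steps => //; rewrite ?(frame_reg f5) //.
    have [h1 h2 h3] := fac4; split.
    * by move=> v c vr cr; rewrite (frame_rd f5) // h1.
    * by move=> v e vr er; rewrite /node (frame_rd f5) //; exact: h2.
    * by move=> i e ir er; rewrite /node !(frame_rd f5) //; exact: h3.
  + exact: leqnn.
  + move=> s5 [ds5 f5]; split=> // e er; have [h1 _ _] := pre e er; have [h2 h3 _] := M3 e er.
    by split; rewrite !(frame_rd f5) // !(frame_rd f4) // (frame_rd f3) // (frame_rd f2) // (frame_rd f1).
  + by [].
- by rewrite sum_nat_const card_ord /=; lia.
- move=> s5 [[ps5 hs5] pre5]; split; last exact: pre5.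
  by split=> // d db; have := hs5 d db; rewrite db.
(* The two progress functions differ at most beyond the last sample, when the final batch is
   incomplete. *)
- move=> s5; apply: eq_potential => d dJ; rewrite /progress /batch_size mulSn.
  by repeat case: ifP; lia.
Qed.

Hypothesis m0 : (0 < m)%N.
Hypothesis mW : (m <= W)%N.
Hypothesis JW : (J * m <= W)%N.
Hypothesis A0 : A != 0.

Let J_le : (J <= W)%N. Proof. by apply: leq_trans JW; rewrite leq_pmulr. Qed.

Lemma batch_steps s b : reg s 7 = b -> prepared s ->
  steps W batch s (5000 * (m * r ^ 3) + batch_size b * \sum_(k < m) (index_time k).+1)
    prepared (potential (progress b.+1 0 0)) (potential (progress b 0 0) s).
Proof.
move=> b7 ps; have rs := prepared_ready ps.
have rr3 := rr_le r0; have r3 : (0 < r ^ 3)%N by rewrite expn_gt0 r0.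
have r3E : (q * r = r ^ 3)%N by rewrite !expnS expn0 muln1 mulnA.
apply: (steps_mono (Q := fun s' => drawn b m 0 s' /\ precomputed m s')
  (phi := potential (progress b m 0))).
- apply: steps_after; first exact: (products_safe r0 n0 hW rs mW).
  move=> s1 I1 f1; have ps1 := prepared_frame f1 isT ps.
  have rs1 := prepared_ready ps1.
  apply: steps_after.
    apply: (gen_inverse_safe r0 hW (G := suffix_prod 0) rs1) => e er.
    by have [_ _ ->] := I1 e er.
  move=> s2 I2 f2; have ps2 := prepared_frame f2 isT ps1.
  have rs2 := prepared_ready ps2.
  apply: steps_after.
    apply: (@safe_fill R W 0 _ _ s2 sHist 0 (q * r) (fun=> 1)).
    + by rewrite !evalE (env_r (ready_env rs2)).
    + by apply/ltnW/(lt_W r0 hW); lia.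
    move=> i s3 iq f3 i3 _; have rs3 := prepared_ready (prepared_frame f3 isT ps2).
    apply: safe_RStore; rewrite !evalE i3; split; last first.
      by move=> i' ni; rewrite rd_set_rmem (negbTE ni) andbF.
    by rewrite rd_set_rmem !eqxx !andTb (sizeS rs3) // -r3E.
  move=> s3 I3 f3; have ps3 := prepared_frame f3 isT ps2.
  have [pm _ _] := ready_picks (prepared_ready ps3).
  rewrite -(potential_frame (progress b 0 0) f1) // -(potential_frame (progress b 0 0) f2) //.
  rewrite -(potential_frame (progress b 0 0) f3) //.
  apply: (@steps_loop R W 6 _ _ s3 m (fun k => 1600 * r ^ 3 + batch_size b * (index_time k).+1)%N
    (fun k s' => drawn b k 0 s' /\ precomputed k s') (fun k => potential (progress b k 0))).
  + by rewrite !evalE pm.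
  + exact: mW.
  + split.
      split=> // d db; have dq : (d < q)%N by move: db; rewrite /batch_size; lia.
      split=> [c cr|].
        rewrite I3 /= add0n ifT; first by rewrite /partial_row big_ord0.
        have : (d.+1 * r <= q * r)%N by rewrite leq_mul2r dq orbT.
        by rewrite mulSn; lia.
      rewrite (@eq_level _ _ n u m f r0 _ _ (fun=> 1)) ?(level0_gt0 r0 GA) // => c _.
      by rewrite /partial_row big_ord0.
    move=> e er; have [i1 i2 _] := I1 e er; split.
    * by rewrite (frame_rd f3) // I2.
    * by rewrite (frame_rd f3) // (frame_rd f2).
    * by rewrite (frame_rd f3) // (frame_rd f2).
  + by move=> k s4 v [h1 h2]; split=> //; exact: drawn_set_reg.
  + by [].
  move=> k s4 km f4 k4 [h1 h2]; apply: sample_step_steps => //.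
  by rewrite (frame_reg f4) // (frame_reg f3) // (frame_reg f2) // (frame_reg f1).
- have -> : (\sum_(k < m) (1600 * r ^ 3 + batch_size b * (index_time k).+1).+1 =
    m * (1600 * r ^ 3).+1 + batch_size b * \sum_(k < m) (index_time k).+1)%N.
    rewrite big_distrr /= -[X in (X + _)%N](_ : \sum_(k < m) (1600 * r ^ 3).+1 = _)%N.
      by rewrite -big_split.
    by rewrite sum_nat_const card_ord.
  have : (r ^ 3 <= m * r ^ 3)%N by rewrite leq_pmull.
  have : (m <= m * r ^ 3)%N by rewrite leq_pmulr.
  rewrite /= r3E mulnS mulnCA; move: (batch_size b * _)%N (m * r ^ 3)%N (r ^ 3)%N r3; clear; lia.
- by move=> s' [[]].
- move=> s'; apply: eq_potential => d dJ; rewrite /progress !mulSn.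
  by repeat case: ifP; lia.
Qed.

Lemma sum_batch_size : (\sum_(b < (J + (q - 1)) %/ q) batch_size b <= J)%N.
Proof.
have E k : (\sum_(b < k) batch_size b <= J)%N /\
    (\sum_(b < k) batch_size b <= k * q)%N /\ (\sum_(b < k) batch_size b = minn J (k * q))%N.
  elim: k => [|k [_ [_ IH]]]; first by rewrite big_ord0 mul0n minn0.
  rewrite big_ord_recr /= IH /batch_size mulSn; lia.
by have [] := E ((J + (q - 1)) %/ q)%N.
Qed.

Definition sample_time := (100 * 60 * (m * r ^ 3) +
  100 * 80 * (J * \sum_(k < m) q * (trunc_log 2 r + trunc_log 2 (nblk (f k)) + 1)))%N.

Lemma sample_prog_steps s : prepared s ->
  steps W sample_prog s sample_time (fun _ => True)
    (fun s' => if [forall d : 'I_J, agree d m (out_row s' d)] then 1 else 0)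
    (\prod_(d < J) (score d / level 0 (fun=> 1))).
Proof.
move=> ps; have q0 : (0 < q)%N by rewrite muln_gt0 r0.
set nb := ((J + (q - 1)) %/ q)%N.
have nbJ : (nb <= J)%N.
  have [Jz|J0] := posnP J; first by rewrite /nb Jz add0n divn_small; lia.
  rewrite /nb -ltnS ltn_divLR // mulSn; have := leq_pmulr J q0; lia.
have nbq : (J <= nb * q)%N.
  have := divn_eq (J + (q - 1)) q; have := ltn_pmod (J + (q - 1)) q0; rewrite -/nb; lia.
have nbq' : (nb * q <= J + (q - 1))%N by exact: leq_trunc_div.
(* Before anything is drawn every sample agrees vacuously with its target, so the potential does not
   depend on the uninitialized output. *)
have -> : \prod_(d < J) (score d / level 0 (fun=> 1)) = potential (progress 0 0 0) s.
  apply: eq_bigr => d _.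
  have -> : progress 0 0 0 d = 0%N by rewrite /progress !mul0n addn0 !ltn0; case: ifP.
  rewrite /term ifT; last by apply/forallP => -[].
  rewrite /chance ltn_eqF //; congr (_ / _); apply: eq_level => // c _.
  by rewrite /partial_row big_ord0.
apply: steps_mono.
- apply: (@steps_loop R W 7 _ _ s nb (fun b => 5000 * (m * r ^ 3) +
     batch_size b * \sum_(k < m) (index_time k).+1)%N (fun=> prepared)
     (fun b => potential (progress b 0 0))).
  + by rewrite !evalE (env_r (ready_env (prepared_ready ps))) (prepared_count ps).
  + exact: leq_trans J_le.
  + exact: ps.
  + by move=> b s' v; exact: prepared_set_reg.
  + by [].
  by move=> b s' bn fs b7 ps'; exact: batch_steps.
- set S := \sum_(k < m) (index_time k).+1.
  have -> : (\sum_(b < nb) (5000 * (m * r ^ 3) + batch_size b * S).+1 =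
      nb * (5000 * (m * r ^ 3)).+1 + (\sum_(b < nb) batch_size b) * S)%N.
    rewrite big_distrl /= -[X in (X + _)%N](_ : \sum_(k < nb) (5000 * (m * r ^ 3)).+1 = _)%N.
      by rewrite -big_split.
    by rewrite sum_nat_const card_ord.
  have := leq_mul sum_batch_size (leqnn S); rewrite -/nb.
  set B := (_ * S)%N.
  set L := \sum_(k < m) q * (trunc_log 2 r + trunc_log 2 (nblk (f k)) + 1).
  have SL : (S <= 2001 * L)%N.
    rewrite /S /L big_distrr /=; apply: leq_sum => k _; rewrite /index_time.
    move: (trunc_log _ _) (trunc_log _ _) => x y.
    have : (0 < q * (x + y + 1))%N by rewrite muln_gt0 q0 addn1.
    lia.
  have JS : (J * S <= 2001 * (J * L))%N by rewrite mulnCA leq_mul2l SL orbT.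
  have mL : (m * q <= L)%N.
    rewrite /L -[X in (X <= _)%N](_ : \sum_(k < m) q = _)%N; last first.
      by rewrite sum_nat_const card_ord.
    by apply: leq_sum => k _; rewrite leq_pmulr // addn_gt0 orbT.
  have r3E : (q * r = r ^ 3)%N by rewrite !expnS expn0 muln1 mulnA.
  (* There are at most (J + r^2) / r^2 batches. Their precomputation costs m r^3 once, plus m r per
     sample, which the time of the draws absorbs. *)
  have nbr : (nb * (m * r ^ 3) <= m * r ^ 3 + J * L)%N.
    have h1 : (nb * q * (m * r) <= (J + q) * (m * r))%N by rewrite leq_mul2r; lia.
    have h2 : (J * (m * r) <= J * L)%N.
      rewrite leq_mul2l; apply/orP; right; apply: leq_trans mL.
      by rewrite leq_mul2l leq_pmulr ?orbT.
    have h3 : (nb * (m * r ^ 3) = nb * q * (m * r))%N by rewrite -r3E; ring.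
    have h4 : (q * (m * r) = m * r ^ 3)%N by rewrite -r3E; ring.
    by rewrite h3 -h4; lia.
  have mr0 : (0 < m * r ^ 3)%N by rewrite muln_gt0 m0 expn_gt0 r0.
  have nb1 : (nb <= nb * (m * r ^ 3))%N by rewrite leq_pmulr.
  rewrite /sample_time -/L /= mulnS mulnCA.
  move: (nb * (m * r ^ 3))%N (m * r ^ 3)%N (J * L)%N (J * S)%N B nb1 mr0 nbr JS; clear; lia.
- by [].
move=> s'; case: forallP => [H|H].
  rewrite /potential big1 // => d _.
  have -> : progress nb 0 0 d = m by rewrite /progress ifT //; exact: leq_trans nbq.
  by rewrite /term H /chance eqxx.
have [d /negbTE Hd] : exists d : 'I_J, ~~ agree d m (out_row s' d).
  by apply/existsP; rewrite -negb_forall; apply/negP => /forallP.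
rewrite /potential (bigD1 d) //= /term.
have -> : progress nb 0 0 d = m by rewrite /progress ifT //; exact: leq_trans nbq.
by rewrite Hd mul0r.
Qed.

End Sampling.

(** * Correctness of the data structure *)

(** Distributivity over choice functions with dependent codomains. It makes the Gram matrix of a
    Khatri-Rao product, a sum over multi-indices, the entrywise product of the Gram matrices. *)
Lemma prod_sum_dffun (R : comNzRingType) (I : finType) (T : I -> finType)
    (F : forall i, T i -> R) :
  \prod_i \sum_(t : T i) F i t = \sum_(g : {dffun forall i, T i}) \prod_i F i (g i).
Proof.
rewrite (reindex (@dffun_of_fprod I T)) /=; last exact/onW_bij/dffun_of_fprod_bij.
transitivity (\sum_(t : fprod T) \prod_(i in I) [ffun x => F i x] (t i)); last first.
  by apply: eq_bigr => t _; apply: eq_bigr => i _; rewrite !ffunE.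
rewrite (big_fprod _ _ (fun i => [ffun x => F i x])).
rewrite -(bigA_distr_big_dep _ (fun i j => untag 0 [ffun x => F i x] j)); apply: eq_bigr => i _.
rewrite -(big_tag (fun i => [ffun x => F i x])).
by apply: eq_bigr => t _; rewrite ffunE.
Qed.

(** * Integer and natural logarithms *)

Section Logarithms.
Variable R : realType.

Lemma ln2_ge_half : 2^-1 <= ln 2 :> R.
Proof.
rewrite -[leLHS]expRK ler_ln ?posrE ?expR_gt0 //.
have := expR_ge1Dx (- 2^-1 : R); rewrite expRN => h.
rewrite -[expR _]invrK -[leRHS]invrK lef_pV2 ?posrE ?invr_gt0 ?expR_gt0 //.
by apply: le_trans h; lra.
Qed.

Lemma log1_ge1 (x : R) : 1 <= log1 x. Proof. by rewrite le_max lexx. Qed.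

(** The factor 2 comes from ln 2 >= 1/2. The bound on [k] involves max 1 x because a matrix has at
    least one block even if I_j / r < 1. *)
Lemma trunc_log_le_log1 k (x : R) : (0 < k)%N -> k%:R <= Num.max 1 x ->
  (trunc_log 2 k)%:R <= 2 * log1 x.
Proof.
move=> k0 kx; have h := trunc_logP (isT : 1 < 2)%N k0; set l := trunc_log 2 k in h *.
have [x1|x1] := leP x 1.
  rewrite max_l // lern1 in kx; suff -> : l = 0%N by rewrite mulr_ge0 // (le_trans ler01 (log1_ge1 x)).
  by have k1 : k = 1%N by [lia]; rewrite /l k1 trunc_log1.
rewrite max_r in kx; last exact: ltW.
have x0 : 0 < x by apply: lt_trans x1.
apply: (@le_trans _ _ (2 * ln x)); last by rewrite ler_pM2l // le_max lexx orbT.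
have : ln (2 ^+ l) <= ln x :> R.
  rewrite ler_ln ?posrE ?exprn_gt0 //; apply: le_trans kx.
  by rewrite -natrX ler_nat.
rewrite lnXn // -[_ *+ l]mulr_natl => hl; have l2 := ln2_ge_half.
have h2 : l%:R * 2^-1 <= l%:R * ln 2 :> R by rewrite ler_wpM2l.
by have := le_trans h2 hl; rewrite ler_pdivrMr // [ln x * 2]mulrC.
Qed.
End Logarithms.

(** * Matrices and samples as flat arrays *)

Section Flatten.
Variables (T : Type) (x0 : T).

Lemma nth_flatten_index (ss : seq (seq T)) i k : (k < size (nth [::] ss i))%N ->
  nth x0 (flatten ss) (sumn (take i (shape ss)) + k) = nth x0 (nth [::] ss i) k.
Proof.
move=> ki; have ki' : (k < nth 0 (shape ss) i)%N.
  have [il|il] := ltnP i (size ss); first by rewrite (nth_map [::]).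
  by rewrite nth_default in ki.
by rewrite nth_flatten -/(flatten_index _ _ _) flatten_indexKl // flatten_indexKr.
Qed.

Lemma nth_allpairs_ord m n (F : 'I_m -> 'I_n -> T) (i : 'I_m) (j : 'I_n) :
  nth x0 [seq F i j | i <- enum 'I_m, j <- enum 'I_n] (i * n + j) = F i j.
Proof.
set ss := [seq [seq F i j | j <- enum 'I_n] | i <- enum 'I_m].
have sh : shape ss = nseq m n.
  rewrite /shape -map_comp (eq_map (g := fun=> n)) => [|a]; last by rewrite /= size_map size_enum_ord.
  by rewrite -[m in RHS]size_enum_ord; elim: (enum 'I_m) => //= a l ->.
have -> : (i * n = sumn (take i (shape ss)))%N.
  by rewrite sh take_nseq ?sumn_nseq 1?mulnC // ltnW.
have E : nth [::] ss i = [seq F i j | j <- enum 'I_n].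
  by rewrite (nth_map i) ?size_enum_ord ?nth_ord_enum.
rewrite -[nth _ _ _]/(nth x0 (flatten ss) _) nth_flatten_index E; last first.
  by rewrite size_map size_enum_ord.
by rewrite (nth_map j); [rewrite nth_ord_enum|rewrite size_enum_ord].
Qed.

Lemma size_allpairs_ord m n (F : 'I_m -> 'I_n -> T) :
  size [seq F i j | i <- enum 'I_m, j <- enum 'I_n] = (m * n)%N.
Proof. by rewrite size_allpairs !size_enum_ord. Qed.

End Flatten.

Section Encoding.
Variables (R : realType) (N r : nat) (I : 'I_N -> nat).
Hypothesis r0 : (0 < r)%N.
Implicit Types (U : forall k, 'M[R]_(I k, r)) (s : state R).

(** Like [entry] below, a total function on natural numbers with default 0, so that the analysis of
    the programs is free of dependent types. *)
Definition height (j : nat) : nat := if insub j is Some j' then I j' else 0%N.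

Definition entry U (j t c : nat) : R :=
  if insub j is Some j' then
    if insub t is Some t' then if insub c is Some c' then U j' t' c' else 0 else 0
  else 0.

Lemma height_ord (j : 'I_N) : height j = I j.
Proof. by rewrite /height valK. Qed.

Lemma entry_ord U (j : 'I_N) (t : 'I_(I j)) (c : 'I_r) : entry U j t c = U j t c.
Proof. by rewrite /entry !valK. Qed.

Lemma heights_nth j : (j < N)%N -> nth 0%N [seq I j | j <- enum 'I_N] j = height j.
Proof.
move=> jN; rewrite (nth_map (Ordinal jN)) ?size_enum_ord //.
by rewrite -[X in nth _ _ X]/(val (Ordinal jN)) nth_ord_enum -height_ord.
Qed.

Local Notation off := (row_offset r height).

Lemma off_total : off N = (\sum_(j < N) I j * r)%N.
Proof. by apply: eq_bigr => j _; rewrite height_ord. Qed.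

Definition inputs U : seq R := flatten [seq entries (U j) | j <- enum 'I_N].

Lemma shape_inputs U : shape [seq entries (U j) | j <- enum 'I_N] = [seq (I j * r)%N | j <- enum 'I_N].
Proof. by rewrite /shape -map_comp; apply: eq_map => j /=; rewrite size_allpairs_ord. Qed.

Lemma sumn_shape_inputs U k : (k <= N)%N ->
  sumn (take k (shape [seq entries (U j) | j <- enum 'I_N])) = off k.
Proof.
rewrite shape_inputs; elim: k => [|k IH] kN; first by rewrite take0 /row_offset big_ord0.
rewrite (take_nth 0%N); last by rewrite size_map size_enum_ord.
rewrite sumn_rcons (IH (ltnW kN)) offS; congr (_ + _)%N.
rewrite (nth_map (Ordinal kN)) ?size_enum_ord //.
by rewrite -[X in nth _ _ X]/(val (Ordinal kN)) nth_ord_enum -height_ord.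
Qed.

Lemma size_inputs U : size (inputs U) = off N.
Proof.
rewrite size_flatten -(sumn_shape_inputs U (leqnn N)) take_oversize //.
by rewrite 2!size_map size_enum_ord.
Qed.

Lemma nth_inputs U j t c : (j < N)%N -> (t < height j)%N -> (c < r)%N ->
  nth 0 (inputs U) (off j + t * r + c) = entry U j t c.
Proof.
move=> jN tn cr; have [t' ->] : exists t' : 'I_(I (Ordinal jN)), t = t'.
  by rewrite -[j]/(val (Ordinal jN)) height_ord in tn; exists (Ordinal tn).
rewrite -[j in RHS]/(val (Ordinal jN)) -[c in RHS]/(val (Ordinal cr)) entry_ord.
have E : nth [::] [seq entries (U j) | j <- enum 'I_N] j = entries (U (Ordinal jN)).
  by rewrite (nth_map (Ordinal jN)) ?size_enum_ord // -[j in LHS]/(val (Ordinal jN)) nth_ord_enum.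
rewrite -addnA -(sumn_shape_inputs U (ltnW jN)) nth_flatten_index E.
  exact: (nth_allpairs_ord 0 _ t' (Ordinal cr)).
rewrite size_allpairs_ord; have : (t'.+1 * r <= I (Ordinal jN) * r)%N.
  by rewrite leq_mul2r ltn_ord orbT.
by rewrite mulSn; lia.
Qed.

Lemma off_split i k : (i < off k)%N -> exists j t c,
  [/\ (j < k)%N, (t < height j)%N, (c < r)%N & i = (off j + t * r + c)%N].
Proof.
elim: k => [|k IH]; first by rewrite /row_offset big_ord0.
rewrite offS; have [ik|ik] := ltnP i (off k).
  by have [j [t [c [jk tn cr ->]]]] := IH ik; move=> _; exists j, t, c; split=> //; exact: ltnW.
move=> il; exists k, ((i - off k) %/ r)%N, ((i - off k) %% r)%N; split=> //.
- by rewrite ltn_divLR //; lia.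
- by rewrite ltn_mod.
by rewrite -addnA -divn_eq subnKC.
Qed.

Lemma inputsP U l : size l = off N ->
  (forall j t c, (j < N)%N -> (t < height j)%N -> (c < r)%N ->
     nth 0 l (off j + t * r + c) = entry U j t c) -> l = inputs U.
Proof.
move=> sl H; apply: (eq_from_nth (x0 := 0)); first by rewrite sl size_inputs.
rewrite sl => i /off_split [j [t [c [jN tn cr ->]]]].
by rewrite H // nth_inputs.
Qed.

Lemma entry_dfwith U (j : 'I_N) (V : 'M[R]_(I j, r)) j' t c :
  (j' < N)%N -> (t < height j')%N -> (c < r)%N ->
  entry (dfwith U j V) j' t c = set_matrix (entry U) j (fun t c => nth 0 (entries V) (t * r + c)) j' t c.
Proof.
move=> jN; rewrite -[j']/(val (Ordinal jN)); move: (Ordinal jN) => {jN} {}j'.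
rewrite height_ord => tn cr; rewrite -[t]/(val (Ordinal tn)) -[c]/(val (Ordinal cr)).
rewrite entry_ord /set_matrix val_eqE; case: (eqVneq j' j) => [jj|ne]; last first.
  by rewrite dfwithout 1?eq_sym // entry_ord.
subst j'; rewrite dfwithin; exact/esym/nth_allpairs_ord.
Qed.

Lemma entry_set_entry U (j : 'I_N) (i : 'I_(I j)) (c : 'I_r) x j' t c' :
  (j' < N)%N -> (t < height j')%N -> (c' < r)%N ->
  entry (set_entry U i c x) j' t c' = set_entry_nat (entry U) j i c x j' t c'.
Proof.
move=> jN; rewrite -[j']/(val (Ordinal jN)); move: (Ordinal jN) => {jN} {}j'.
rewrite height_ord => tn cr; rewrite -[t]/(val (Ordinal tn)) -[c']/(val (Ordinal cr)).
rewrite entry_ord /set_entry /set_entry_nat val_eqE; case: (eqVneq j' j) => [jj|ne]; last first.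
  by rewrite dfwithout 1?eq_sym // entry_ord.
by subst j'; rewrite dfwithin mxE -!val_eqE /= -(entry_ord U (Ordinal tn) (Ordinal cr)).
Qed.

End Encoding.

(** The arrays are placed in an otherwise empty state, so that the predicates on states used for the
    programs can be reused; they are applied to the regions [Data] only. *)
Definition valid_memory (R : realType) N r (I : 'I_N -> nat) (U : forall j, 'M[R]_(I j, r))
    (w : nat -> seq nat) (x : nat -> seq R) : Prop :=
  let s := State (fun=> 0%N) (fun a => if a is Data k then w k else [::])
             (fun a => if a is Data k then x k else [::]) in
  [/\ forall j, (j <= N)%N -> ird s (Data 0) j = row_offset r (height I) j,
      forall i, (i <= row_offset r (height I) N)%N -> ird s (Data 1) i = trunc_log 2 i &
      forall j, (j < N)%N -> tree_ok r (height I) (entry U) s j].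

Section Correctness.
Variables (R : realType) (N r : nat) (I : 'I_N -> nat) (W C : nat).
Hypothesis N0 : (0 < N)%N.
Hypothesis r0 : (0 < r)%N.
Hypothesis I0 : forall j, (0 < I j)%N.
Hypothesis C_large : (100 * 400 <= C)%N.
Hypothesis W_large : (C * (\sum_(j < N) I j * r + r ^ 3) <= W)%N.
Implicit Types (U : forall j, 'M[R]_(I j, r)) (s : state R).

Local Notation n := (height I).
Local Notation off := (row_offset r n).
Local Notation space := (C * \sum_(j < N) I j * r)%N.

Let hW : (16 * (off N + r ^ 3) <= W)%N.
Proof. by apply: leq_trans W_large; rewrite off_total leq_mul2r; apply/orP; right; lia. Qed.

Let n0 j : (j < N)%N -> (0 < n j)%N.
Proof. by move=> jN; rewrite -[j]/(val (Ordinal jN)) height_ord. Qed.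

Let offW : (2 * off N <= space)%N.
Proof. by rewrite -off_total leq_mul2r; apply/orP; right; lia. Qed.

Lemma stored_header U P s : stored C space U P s ->
  [/\ header N r n s, rows_in N r n (entry U) s, size (rmem s Inp) = off N &
    forall k, (k < 2)%N ->
      (2 * off N <= size (imem s (Data k)))%N /\ (2 * off N <= size (rmem s (Data k)))%N].
Proof.
move=> [h1 h2 h3 h4 _]; split.
- by split; rewrite /ird h1 //= => j jN; rewrite heights_nth.
- by move=> j t c jN tn cr; rewrite /rd h2; exact: nth_inputs.
- by rewrite h2 size_inputs.
by move=> k k2; rewrite h3 h4 ifT //; lia.
Qed.

Lemma stored_valid U s : stored C space U (valid_memory U) s ->
  env N r n s /\ forall j, (j < N)%N -> tree_ok r n (entry U) s j.
Proof.
move=> st; have [[h1 h2 h3] _ _ _] := stored_header st.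
by have [_ _ _ _ [v1 v2 v3]] := st; split; [split|exact: v3].
Qed.

Lemma valid_env U s : env N r n s -> (forall j, (j < N)%N -> tree_ok r n (entry U) s j) ->
  valid_memory U (fun k => imem s (Data k)) (fun k => rmem s (Data k)).
Proof. by move=> es ts; split; [exact: env_off es|exact: env_lg es|exact: ts]. Qed.

Lemma build_correct U s : stored C space U (fun _ _ => True) s ->
  Pr (run W build_prog s) (fun time s' => (time <= C * \sum_(j < N) I j * r ^ 2)%N /\
    stored C space U (valid_memory U) s') = 1.
Proof.
move=> st; have [hs us _ sz] := stored_header st.
have [[sz1 szr] [sz2 _]] := (sz 0%N isT, sz 1%N isT).
apply: (Pr_safe (safe_frame (build_prog_safe r0 n0 hW N0 hs us sz1 sz2 szr))).
move=> time s' tT [[es ts] fs]; split.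
  apply: leq_trans tT _; rewrite (eq_bigr (fun j => I j * r ^ 2)%N) => [|j _]; last by rewrite height_ord.
  by rewrite leq_mul2r; apply/orP; right; lia.
have [h1 h2 h3 h4 _] := st; split.
- by rewrite (fr_words fs).
- by rewrite (fr_reals fs).
- by move=> k; rewrite (fr_wsize fs).
- by move=> k; rewrite (fr_rsize fs).
exact: valid_env.
Qed.

Lemma update_entry_correct U (j : 'I_N) (i : 'I_(I j)) (c : 'I_r) x s :
  stored C space U (valid_memory U) s ->
  called C 0 0 [:: j : nat; i : nat; c : nat] [:: x] s ->
  Pr (run W update_entry_prog s) (fun time s' =>
    time%:R <= C%:R * (r%:R * log1 ((I j)%:R / r%:R : R)) /\
    stored C space (set_entry U i c x) (valid_memory (set_entry U i c x)) s') = 1.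
Proof.
move=> st [[ia ra] _ _ _ _]; have [hs us si sz] := stored_header st.
have [es ts] := stored_valid st; have [_ szr] := sz 0%N isT.
have nj := height_ord I j; have ij : (i < n j)%N by rewrite nj.
have sj : (off N <= size (rmem s Inp))%N by rewrite si.
apply: (Pr_safe (safe_frame (@update_entry_safe R W N r n (entry U) r0 n0 hW s j i c x es
  (ltn_ord j) ij (ltn_ord c) _ _ _ _ us ts szr sj))); rewrite /ird /rd ?ia ?ra //.
move=> time s' tT [[ts' us'] fs]; split.
  apply: le_trans (_ : (1000 * (r * (trunc_log 2 (block_count r n j) + 2)))%:R <= _).
    by rewrite ler_nat.
  have B0 := nblk_gt0 r n j.
  have := @trunc_log_le_log1 R (block_count r n j) ((I j)%:R / r%:R) B0.
  have : (block_count r n j)%:R <= Num.max 1 ((I j)%:R / r%:R) :> R.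
    rewrite /block_count nj; case: (leqP 1 (I j %/ r)) => _; last by rewrite le_max lexx.
    by rewrite le_max ler_pdivlMr ?ltr0n // -natrM ler_nat leq_trunc_div orbT.
  move=> h /(_ h) {h}; have := log1_ge1 ((I j)%:R / r%:R : R).
  move: (log1 _) (trunc_log _ _) => L l L1 lL.
  rewrite !natrM natrD mulrCA [C%:R * _]mulrCA ler_wpM2l //.
  have C1 : 4000 <= C%:R :> R by rewrite ler_nat; lia.
  apply: le_trans (_ : 4000 * L <= _); last by rewrite ler_wpM2r //; lra.
  lra.
have [h1 h2 h3 h4 _] := st; split.
- by rewrite (fr_words fs).
- apply: (inputsP r0); first by rewrite (fr_rsize fs).
  move=> j' t c' jN tn cr; have := us' (off j' + t * r + c')%N; rewrite /rd => ->.
  rewrite (row_index_inj r0 jN (ltn_ord j) tn ij cr (ltn_ord c)) entry_set_entry //.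
  by rewrite /set_entry_nat; case: ifP => // _; exact: us.
- by move=> k; rewrite (fr_wsize fs).
- by move=> k; rewrite (fr_rsize fs).
apply: valid_env; first exact: env_frame fs isT es.
move=> j' jN; apply: (tree_ok_ext r0) (ts' j' jN) => t c' tn cr.
by rewrite entry_set_entry.
Qed.

Lemma update_matrix_correct U (j : 'I_N) (V : 'M[R]_(I j, r)) s :
  stored C space U (valid_memory U) s ->
  called C 0 0 [:: j : nat] (entries V) s ->
  Pr (run W update_matrix_prog s) (fun time s' => (time <= C * (I j * r ^ 2))%N /\
    stored C space (dfwith U j V) (valid_memory (dfwith U j V)) s') = 1.
Proof.
move=> st [[ia ra] _ _ _ _]; have [hs us si sz] := stored_header st.
have [es ts] := stored_valid st; have [_ szr] := sz 0%N isT.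
have nj := height_ord I j.
have sj : (off N <= size (rmem s Inp))%N by rewrite si.
apply: (Pr_safe (safe_frame (@update_matrix_safe R W N r n (entry U) r0 n0 hW s j
  (fun t c => nth 0 (entries V) (t * r + c)) es (ltn_ord j) _ us ts _ szr sj))).
- by rewrite /ird ia.
- by move=> t c _ _; rewrite /rd ra.
move=> time s' tT [[ts' us'] fs]; split.
  by apply: leq_trans tT _; rewrite nj leq_mul2r; apply/orP; right; lia.
have [h1 h2 h3 h4 _] := st; split.
- by rewrite (fr_words fs).
- apply: (inputsP r0); first by rewrite (fr_rsize fs).
  move=> j' t c jN tn cr; have := us' (off j' + t * r + c)%N; rewrite /rd => ->.
  rewrite entry_dfwith // /set_matrix.
  have tr : (t.+1 * r <= n j' * r)%N by rewrite leq_mul2r tn orbT.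
  rewrite mulSn in tr; case: (eqVneq j' j) => [jj|ne].
    rewrite ifT; last by rewrite jj in tr *; lia.
    by rewrite ra; congr nth; rewrite jj; lia.
  rewrite ifF; first exact: us.
  have lt k l : (k < l)%N -> (off k + n k * r <= off l)%N.
    by move=> kl; exact: off_le.
  apply/negP => H; case: (ltngtP j' j) => [/lt|/lt|/eqP]; last by rewrite (negbTE ne).
    by lia.
  by lia.
- by move=> k; rewrite (fr_wsize fs).
- by move=> k; rewrite (fr_rsize fs).
apply: valid_env; first exact: env_frame fs isT es.
move=> j' jN; apply: (tree_ok_ext r0) (ts' j' jN) => t c tn cr.
by rewrite entry_dfwith.
Qed.

Section Sample.
Variables (U : forall j, 'M[R]_(I j, r)) (m : nat) (f : 'I_m -> 'I_N) (J : nat) (s : state R).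
Let A := khatri_rao (fun k => U (f k)).
Hypothesis m0 : (0 < m)%N.
Hypothesis f_inj : injective f.
Hypothesis A0 : A != 0.
Hypothesis JW : (C * (J * m) <= W)%N.
Hypothesis st : stored C space U (valid_memory U) s.
Hypothesis ca : called C (C * r ^ 3) (J * m) (J :: m :: [seq nat_of_ord (f k) | k <- enum 'I_m])
  [::] s.

Let pick (k : nat) : nat := if insub k is Some k' then f k' else 0%N.

Let pick_ord (k : 'I_m) : pick k = f k. Proof. by rewrite /pick valK. Qed.

Let khatri_rao_gram :
  mxflat r (gram_suffix r n (entry U) m pick 0) = A^T *m A.
Proof.
apply/matrixP => a b; rewrite !mxE /gram_suffix big_mkord.
transitivity (\prod_(k < m) \sum_(t < I (f k)) U (f k) t a * U (f k) t b).
  apply: eq_bigr => k _; rewrite pick_ord /gram_entry height_ord.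
  by apply: eq_bigr => t _; rewrite flat_div ?flat_mod // !entry_ord.
rewrite (prod_sum_dffun (fun k t => U (f k) t a * U (f k) t b)).
rewrite [RHS](reindex (@enum_rank (multi_index (fun k => I (f k))))) /=; last first.
  exact/onW_bij/enum_rank_bij.
apply: eq_bigr => g _; rewrite !mxE -big_split /=; apply: eq_bigr => k _.
by rewrite enum_rankK.
Qed.

Let J_le : (J * m <= W)%N.
Proof. by apply: leq_trans JW; rewrite leq_pmull //; lia. Qed.

(** Distinctness of the chosen matrices enters here: it gives m <= N, hence a loop counter that fits
    into a word. *)
Let m_le : (m <= W)%N.
Proof.
have mN : (m <= N)%N by have := leq_card f f_inj; rewrite !card_ord.
have := off_geN r0 n0 (leqnn N); have := hW; have := mN; clear; lia.
Qed.

Let prepared_s : prepared N r n (entry U) m pick J s.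
Proof.
have [hs us si _] := stored_header st; have [es ts] := stored_valid st.
have [[ia _] so _ _ sr] := ca; split; last exact: so.
  split=> //; last by move=> k k14; rewrite sr ifT ?leq_mul2r; lia.
  split; first by rewrite /ird ia.
  - move=> k km; rewrite /ird ia /= (nth_map (Ordinal km)) ?size_enum_ord //.
    by rewrite -[k in LHS]/(val (Ordinal km)) nth_ord_enum -pick_ord.
  - by move=> k km; rewrite -[k]/(val (Ordinal km)) pick_ord.
by rewrite /ird ia.
Qed.

Let sample_time_le : (sample_time r n m pick J)%:R <= C%:R * (m%:R * r%:R ^+ 3 + J%:R *
  \sum_(k < m) r%:R ^+ 2 * log1 ((maxn (I (f k)) r)%:R : R)) :> R.
Proof.
set S := \sum_(k < m) _.
(* Each of the two logarithms is at most 2 * [log1] and the summand 1 at most [log1], together 5;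
   with the factor 8000 in [sample_time] this gives the constant 40000. *)
have LS : (\sum_(k < m) r * r * (trunc_log 2 r + trunc_log 2 (block_count r n (pick k)) + 1))%:R <=
    5 * S :> R.
  rewrite natr_sum /S big_distrr /=; apply: ler_sum => k _; rewrite pick_ord.
  set x : R := (maxn _ _)%:R.
  have xE : Num.max 1 x = x by rewrite max_r // ler1n leq_max r0 orbT.
  have h1 : (trunc_log 2 r)%:R <= 2 * log1 x.
    by apply: trunc_log_le_log1 => //; rewrite xE ler_nat leq_maxr.
  have h2 : (trunc_log 2 (block_count r n (f k)))%:R <= 2 * log1 x.
    apply: trunc_log_le_log1; rewrite ?nblk_gt0 // xE ler_nat /block_count height_ord.
    rewrite geq_max leq_max r0 orbT /= leq_max; apply/orP; left; exact: leq_div.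
  have h3 := log1_ge1 x.
  rewrite natrM (natrM _ r r) !natrD -expr2 mulrCA ler_wpM2l ?exprn_ge0 //; lra.
have S0 : 0 <= S.
  by apply: sumr_ge0 => k _; rewrite mulr_ge0 ?exprn_ge0 // (le_trans ler01) ?log1_ge1.
have JLS := ler_wpM2l (ler0n R J) LS.
rewrite /sample_time natrD natrM (natrM _ m) natrX [X in _ + X]natrM (natrM _ J).
set X := m%:R * r%:R ^+ 3; have X0 : 0 <= X by rewrite mulr_ge0 ?exprn_ge0.
set L := (\sum_(k < m) _)%:R in LS JLS *.
have JS : 0 <= J%:R * S by rewrite mulr_ge0.
have C1 : (100 * 400)%:R <= C%:R :> R by rewrite ler_nat.
apply: le_trans (_ : (100 * 400)%:R * (X + J%:R * S) <= _); last first.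
  by rewrite ler_wpM2r // addr_ge0.
rewrite !natrM; move: JLS; rewrite mulrCA; move: (J%:R * S) (J%:R * L) JS X0.
by move=> y z; lra.
Qed.

Lemma sample_time_correct : Pr (run W sample_prog s) (fun time s' =>
  time%:R <= C%:R * (m%:R * r%:R ^+ 3 + J%:R *
    \sum_(k < m) r%:R ^+ 2 * log1 ((maxn (I (f k)) r)%:R : R)) /\
  stored C space U (valid_memory U) s') = 1.
Proof.
have lt d k : (d < J)%N -> (k < m)%N -> (0 < n (pick k))%N.
  by move=> _ km; apply: n0; rewrite -[k]/(val (Ordinal km)) pick_ord.
(* Only time and safety are extracted, so any legal target will do; row 0 exists as no matrix is
   empty. *)
have [sf _] := sample_prog_steps r0 n0 hW khatri_rao_gram (target := fun _ _ => 0%N) lt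
  m0 m_le J_le A0 prepared_s.
apply: (Pr_safe (safe_frame sf)) => time s' tT [_ fs]; split.
  by apply: le_trans sample_time_le; rewrite ler_nat.
have [h1 h2 h3 h4 h5] := st; split.
- by rewrite (fr_words fs).
- by rewrite (fr_reals fs).
- by move=> k; rewrite (fr_wsize fs).
- by move=> k; rewrite (fr_rsize fs).
have -> : (fun k => imem s' (Data k)) = (fun k => imem s (Data k)).
  by apply/funext => k; rewrite (fr_words fs).
have -> // : (fun k => rmem s' (Data k)) = (fun k => rmem s (Data k)).
by apply/funext => k; rewrite (fr_reals fs).
Qed.

Lemma sample_prob_correct (t : 'I_J -> multi_index (fun k => I (f k))) :
  Pr (run W sample_prog s) (fun _ s' => imem s' Out = encode_samples t)
  = \prod_(d < J) leverage_prob A (enum_rank (t d)).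
Proof.
pose target d k : nat := if insub d is Some d' then if insub k is Some k' then t d' k' else 0%N else 0%N.
have targetE (d : 'I_J) (k : 'I_m) : target d k = t d k by rewrite /target !valK.
have lt d k : (d < J)%N -> (k < m)%N -> (target d k < n (pick k))%N.
  move=> dJ km; rewrite -[d]/(val (Ordinal dJ)) -[k]/(val (Ordinal km)) targetE pick_ord.
  by rewrite height_ord.
have [sf wpE] := sample_prog_steps r0 n0 hW khatri_rao_gram lt m0 m_le J_le A0 prepared_s.
rewrite Pr_wp; transitivity (\prod_(d < J) (score r n (entry U) m pick target d /
  level r n (entry U) m pick 0 (fun=> 1))); last first.
  apply: eq_bigr => d _; rewrite /leverage_prob (level0 r0 khatri_rao_gram); congr (_ / _).
  apply: (levelm r0 khatri_rao_gram) => c; rewrite mxE enum_rankK.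
  by apply: eq_bigr => k _; rewrite pick_ord targetE entry_ord.
rewrite -wpE; apply: (eq_wp (safe_frame sf)) => s' [_ fs].
have so : size (imem s' Out) = (J * m)%N.
  by rewrite (fr_wsize fs); have [_ ->] := ca.
congr (if _ then _ else _); apply/asboolP/forallP => [E d|H].
  apply/forallP => k; rewrite /out_row /ird E /encode_samples.
  by rewrite (nth_allpairs_ord _ (fun d k => nat_of_ord (t d k))) targetE.
apply: (eq_from_nth (x0 := 0%N)); first by rewrite so size_allpairs_ord.
rewrite so => i iJ; have dJ : (i %/ m < J)%N by rewrite ltn_divLR.
have km : (i %% m < m)%N by rewrite ltn_mod.
rewrite (divn_eq i m) (nth_allpairs_ord _ _ (Ordinal dJ) (Ordinal km)).
by have /forallP /(_ (Ordinal km)) /eqP := H (Ordinal dJ); rewrite /out_row /ird targetE => ->.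
Qed.

End Sample.

End Correctness.

Theorem theorem1p1 (R : realType) :
  exists (D : data_structure) (C : nat)
    (valid : forall (N r : nat) (I : 'I_N -> nat), (forall j, 'M[R]_(I j, r)) ->
       (nat -> seq nat) -> (nat -> seq R) -> Prop),
  forall (N r : nat) (I : 'I_N -> nat) (W : nat),
    (0 < N)%N -> (0 < r)%N -> (forall j, (0 < I j)%N) ->
    (C * (\sum_(j < N) I j * r + r ^ 3) <= W)%N ->
  let space := (C * \sum_(j < N) I j * r)%N in
  [/\ (* construction *)
      forall (U : forall j, 'M[R]_(I j, r)) (s : state R),
        stored C space U (fun _ _ => True) s ->
        called C 0 0 [::] [::] s ->
        Pr (run W (build D) s) (fun time s' =>
          (time <= C * \sum_(j < N) I j * r ^ 2)%N /\
          stored C space U (valid N r I U) s') = 1,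
      (* replacing one entry *)
      forall (U : forall j, 'M[R]_(I j, r)) (j : 'I_N) (i : 'I_(I j)) (c : 'I_r)
          (x : R) (s : state R),
        stored C space U (valid N r I U) s ->
        called C 0 0 [:: j : nat; i : nat; c : nat] [:: x] s ->
        Pr (run W (update_entry D) s) (fun time s' =>
          time%:R <= C%:R * (r%:R * log1 ((I j)%:R / r%:R : R)) /\
          stored C space (set_entry U i c x) (valid N r I (set_entry U i c x)) s') = 1,
      (* replacing one matrix *)
      forall (U : forall j, 'M[R]_(I j, r)) (j : 'I_N) (V : 'M[R]_(I j, r))
          (s : state R),
        stored C space U (valid N r I U) s ->
        called C 0 0 [:: j : nat] (entries V) s ->
        Pr (run W (update_matrix D) s) (fun time s' =>
          (time <= C * (I j * r ^ 2))%N /\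
          stored C space (dfwith U j V) (valid N r I (dfwith U j V)) s') = 1
    & (* drawing J samples from the product of the matrices U (f 0), U (f 1), ...;
         f = id gives the product of all the matrices *)
      forall (U : forall j, 'M[R]_(I j, r)) (m : nat) (f : 'I_m -> 'I_N) (J : nat)
          (s : state R),
        let A := khatri_rao (fun k => U (f k)) in
        (0 < m)%N -> injective f -> A != 0 ->
        (C * (J * m) <= W)%N ->
        stored C space U (valid N r I U) s ->
        called C (C * r ^ 3) (J * m) (J :: m :: [seq nat_of_ord (f k) | k <- enum 'I_m])
          [::] s ->
        Pr (run W (sample D) s) (fun time s' =>
          time%:R <= C%:R * (m%:R * r%:R ^+ 3 + J%:R *
            \sum_(k < m) r%:R ^+ 2 * log1 ((maxn (I (f k)) r)%:R : R)) /\
          stored C space U (valid N r I U) s') = 1 /\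
        forall t : 'I_J -> multi_index (fun k => I (f k)),
          Pr (run W (sample D) s) (fun _ s' => imem s' Out = encode_samples t)
          = \prod_(d < J) leverage_prob A (enum_rank (t d))].
Proof.
exists (DataStructure build_prog update_entry_prog update_matrix_prog sample_prog).
(* One constant bounds times, array lengths, numbers of arrays and word size; the sampling time is
   what requires 40000. *)
exists (100 * 400)%N, (@valid_memory R) => N r I W N0 r0 I0 hW space; split.
- by move=> U s st _; exact: (build_correct N0 r0 I0 (leqnn _) hW st).
- by move=> U j i c x s st ca; exact: (update_entry_correct N0 r0 I0 (leqnn _) hW st ca).
- by move=> U j V s st ca; exact: (update_matrix_correct N0 r0 I0 (leqnn _) hW st ca).
move=> U m f J s A m0 f_inj A0 JW st ca; split.
  exact: (sample_time_correct N0 r0 I0 (leqnn _) hW m0 f_inj A0 JW st ca).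
by move=> t; exact: (sample_prob_correct N0 r0 I0 (leqnn _) hW m0 f_inj A0 JW st ca).
Qed.
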